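(* (Addition theorem.) Let $d\ge1$ be an integer and $k>0$. Then for all $\mathbf r,\mathbf r'\in\mathbb{R}^d$, $$\mathrm{J}_{d,0}(k|\mathbf r-\mathbf r'|)=\sum_{n=0}^\infty\ \sum_{m=1}^{\dim\mathscr{Y}_n}\mathrm{J}_{d,n}(k|\mathbf r|)\,Y_n^m(\mathbf r/|\mathbf r|)\ \mathrm{J}_{d,n}(k|\mathbf r'|)\,\overline{Y_n^m(\mathbf r'/|\mathbf r'|)} .$$
   Context: $S^{d-1}$ is the unit sphere in $\mathbb{R}^d$ with its surface measure (counting measure on $\{\pm1\}$ if $d=1$). $\mathscr{Y}_n$ is the complex vector space of spherical harmonics of degree $n$, i.e. restrictions to $S^{d-1}$ of complex-valued homogeneous harmonic polynomials of degree $n$ on $\mathbb{R}^d$, and for each $n$, $\{Y_n^m\}_{1\le m\le\dim\mathscr{Y}_n}$ is an arbitrary fixed basis of $\mathscr{Y}_n$ that is orthonormal for the $L^2(S^{d-1})$ inner product. For $z>0$, $\mathrm{J}_{d,n}(z):=(2\pi)^{d/2} J_{n+\frac d2-1}(z)/z^{\frac d2-1}$, where $J_\nu$ is the Bessel function of the first kind, and $\mathrm{J}_{d,n}(0)$ is defined by continuous extension; thus $\mathrm{J}_{d,n}(0)=0$ for $n\ge1$. At $\mathbf r=0$ the product $\mathrm{J}_{d,n}(k|\mathbf r|)Y_n^m(\mathbf r/|\mathbf r|)$ is understood as $0$ for $n\ge1$ and as $\mathrm{J}_{d,0}(0)$ times the constant value of $Y_0^1$ for $n=0$ (and likewise for $\mathbf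 r'$). *)

(* Defs.v *)
From HB Require Import structures.
From mathcomp Require Import all_boot all_order all_algebra.
(* The notations of mpoly can only be combined with those of MathComp-Analysis
   when mpoly is imported first. *)
From mathcomp.multinomials Require Import mpoly.
From mathcomp.real_closed Require Import complex.
From mathcomp Require Import all_classical all_reals all_analysis.
From mathcomp Require Import measurable_realfun.

Set Implicit Arguments.
Unset Strict Implicit.
Unset Printing Implicit Defensive.

Import Order.TTheory GRing.Theory Num.Theory numFieldNormedType.Exports.

Local Open Scope classical_set_scope.
Local Open Scope ring_scope.
Local Open Scope complex_scope.

(* The Borel sigma-algebra of R^n, generated by the coordinates; this mirrors
   the library's structure on n.-tuple. *)
Fact rV_display : measure_display.
Proof. exact: default_measure_display. Qed.

Section rV_measurable.
Context {R : realType} (n : nat).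

Let coord : 'I_n -> 'rV[R]_n -> R := fun i x => x ord0 i.

Let rV_set0 : g_sigma_preimage coord set0.
Proof. exact: sigma_algebra0. Qed.

Let rV_setC A : g_sigma_preimage coord A -> g_sigma_preimage coord (~` A).
Proof. exact: sigma_algebraC. Qed.

Let rV_bigcup (F : _^nat) : (forall i, g_sigma_preimage coord (F i)) ->
  g_sigma_preimage coord (\bigcup_i (F i)).
Proof. exact: sigma_algebra_bigcup. Qed.

HB.instance Definition _ := @isMeasurable.Build rV_display
  'rV[R]_n (g_sigma_preimage coord) rV_set0 rV_setC rV_bigcup.

End rV_measurable.

Lemma measurable_coord (R : realType) n (i : 'I_n) :
  measurable_fun [set: 'rV[R]_n] (fun x : 'rV[R]_n => x ord0 i).
Proof.
move=> _ Y mY; rewrite setTI; apply: sub_sigma_algebra => /=.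
rewrite -bigcup_seq/=; exists i => /=; first by rewrite mem_index_enum.
by exists Y => //; rewrite setTI.
Qed.

Lemma measurable_fun_coordP (R : realType) d (T : measurableType d) n
    (f : T -> 'rV[R]_n) :
  (forall i, measurable_fun [set: T] (fun t => f t ord0 i)) ->
  measurable_fun [set: T] f.
Proof.
move=> mf.
have mfG : g_sigma_preimage (fun i t => f t ord0 i) `<=` measurable.
  apply: smallest_sub; first exact: sigma_algebra_measurable.
  case: n => [|n] in f mf *; first by rewrite big_ord0.
  rewrite -bigcup_mkord_ord; apply: bigcup_sub => i Ii.
  by move=> A [B mB <-]; exact: mf.
move=> _ A mA; apply: mfG.
suff -> : g_sigma_preimage (fun i t => f t ord0 i) =
  preimage_set_system [set: T] f (g_sigma_preimage (fun i (x : 'rV[R]_n) => x ord0 i)).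
  by exists A.
exact: (g_sigma_preimage_comp (fun i (x : 'rV[R]_n) => x ord0 i) f).
Qed.

(* Lebesgue measure on R^n, as the n-fold product of the Lebesgue measure
   on R. *)
Section lebesgue_rV.
Context {R : realType}.

Definition rV_cons n (p : measurableTypeR R * 'rV[R]_n) : 'rV[R]_n.+1 :=
  row_mx (p.1%:M : 'rV_1) p.2.

Definition rV_uncons n (x : 'rV[R]_n.+1) : measurableTypeR R * 'rV[R]_n :=
  (x ord0 ord0, \row_i x ord0 (lift ord0 i)).

Lemma rV_cons0 n p : @rV_cons n p ord0 ord0 = p.1.
Proof.
rewrite /rV_cons (_ : ord0 = lshift n (ord0 : 'I_1)); last exact: val_inj.
by rewrite [LHS]row_mxEl mxE eqxx mulr1n.
Qed.

Lemma rV_consS n p i : @rV_cons n p ord0 (lift ord0 i) = p.2 ord0 i.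
Proof.
rewrite /rV_cons (_ : lift ord0 i = rshift 1 i); last exact: val_inj.
by rewrite [LHS]row_mxEr.
Qed.

Lemma rV_consK n : cancel (@rV_cons n) (@rV_uncons n).
Proof.
case=> x v; rewrite /rV_uncons rV_cons0; congr pair.
by apply/rowP => i; rewrite mxE rV_consS.
Qed.

Lemma measurable_rV_cons n : measurable_fun setT (@rV_cons n).
Proof.
apply: measurable_fun_coordP => i; have [j ->|->] := unliftP ord0 i.
  under eq_fun do rewrite rV_consS.
  exact: (measurableT_comp (measurable_coord j) measurable_snd).
by under eq_fun do rewrite rV_cons0; exact: measurable_fst.
Qed.

Lemma measurable_rV_uncons n : measurable_fun setT (@rV_uncons n).
Proof.
apply/measurable_fun_pair => /=; first exact: measurable_coord.
apply: measurable_fun_coordP => i.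
under eq_fun do rewrite mxE.
exact: measurable_coord.
Qed.

Section step.
Local Open Scope ereal_scope.
Variables (n : nat) (mu : {sigma_finite_measure set 'rV[R]_n -> \bar R}).

Definition lebesgue_rV_step : set 'rV[R]_n.+1 -> \bar R :=
  pushforward (@lebesgue_measure R \x mu) (@rV_cons n).

Let mcons := @measurable_rV_cons n.

Let step0 : lebesgue_rV_step set0 = 0.
Proof. by rewrite /lebesgue_rV_step /pushforward preimage_set0 measure0. Qed.

Let step_ge0 A : 0 <= lebesgue_rV_step A.
Proof. exact: measure_ge0. Qed.

Let step_sigma_additive : semi_sigma_additive lebesgue_rV_step.
Proof. exact: measure_semi_sigma_additive. Qed.

HB.instance Definition _ := isMeasure.Build _ _ _ lebesgue_rV_step
  step0 step_ge0 step_sigma_additive.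

Let step_sigma_finite : sigma_finite setT lebesgue_rV_step.
Proof.
have /sigma_finiteP[F [TF ndF Foo]] := sigma_finiteT (@lebesgue_measure R).
have /sigma_finiteP[G [TG ndG Goo]] := sigma_finiteT mu.
exists (fun k => @rV_uncons n @^-1` (F k `*` G k)).
  rewrite -preimage_bigcup (_ : \bigcup_k (F k `*` G k) = setT)//.
  rewrite -setXTT TF TG; apply/seteqP; split=> -[x y].
    by move=> [k _ []/= ? ?]; split; exists k.
  move=> [/= [k _ Fx] [l _ Gy]]; exists (maxn k l) => //; split.
  - by move: x Fx; exact/subsetPset/ndF/leq_maxl.
  - by move: y Gy; exact/subsetPset/ndG/leq_maxr.
move=> k; have [mF Fk] := Foo k; have [mG Gk] := Goo k.
have mFG : measurable (F k `*` G k) by exact: measurableX.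
split.
  by rewrite -[X in measurable X]setTI; exact: measurable_rV_uncons.
rewrite /lebesgue_rV_step /pushforward -comp_preimage.
rewrite (_ : _ \o _ = id) ?preimage_id; last first.
  by apply/funext => p /=; rewrite rV_consK.
by rewrite product_measure1E// lte_mul_pinfty// ge0_fin_numE.
Qed.

HB.instance Definition _ :=
  Measure_isSigmaFinite.Build _ _ _ lebesgue_rV_step step_sigma_finite.

End step.

Fixpoint lebesgue_rV n : {sigma_finite_measure set 'rV[R]_n -> \bar R} :=
  match n with
  | 0 => \d_(0 : 'rV[R]_0)
  | m.+1 => lebesgue_rV_step (lebesgue_rV m)
  end.

End lebesgue_rV.

Section sphere.
Context {R : realType} {d : nat}.
Implicit Types x : 'rV[R]_d.

(* The library's norm on 'rV[R]_d is the sup norm. *)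
Definition enorm x : R := Num.sqrt (\sum_i x ord0 i ^+ 2).

Definition direction x : 'rV[R]_d := (enorm x)^-1 *: x.

Definition sphere : set 'rV[R]_d := [set x | enorm x = 1].

Definition punctured_ball : set 'rV[R]_d := [set x | 0 < enorm x <= 1].

Lemma enorm_ge0 x : 0 <= enorm x. Proof. exact: sqrtr_ge0. Qed.

Lemma measurable_enorm : measurable_fun setT enorm.
Proof.
rewrite (_ : enorm = (@powR R ^~ 2^-1) \o (fun x => \sum_i x ord0 i ^+ 2)).
  apply: measurableT_comp; first exact: measurable_powR.
  apply: measurable_sum => i; apply: measurable_funX; exact: measurable_coord.
apply/funext => x /=; rewrite powR12_sqrt//.
by apply: sumr_ge0 => i _; exact: sqr_ge0.
Qed.

Lemma measurable_direction : measurable_fun setT direction.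
Proof.
apply: measurable_fun_coordP => i.
under eq_fun do rewrite /direction mxE -(powR_inv1 (enorm_ge0 _)).
apply: measurable_funM; last exact: measurable_coord.
exact: (measurableT_comp (measurable_powR (-1)) measurable_enorm).
Qed.

Lemma measurable_punctured_ball : measurable punctured_ball.
Proof.
rewrite (_ : punctured_ball = enorm @^-1` `]0, 1]%classic).
  rewrite -[X in measurable X]setTI; exact: measurable_enorm.
by apply/seteqP; split => x /=; rewrite in_itv.
Qed.

(* Surface measure: d times the volume of the cone over A. For d = 1 this is
   the counting measure on {-1, 1}. *)
Definition sphere_measure (A : set 'rV[R]_d) : \bar R :=
  (d%:R%:E * lebesgue_rV d (punctured_ball `&` direction @^-1` A))%E.

Local Open Scope ereal_scope.

Let mdir (A : set 'rV[R]_d) : measurable A -> measurable (direction @^-1` A).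
Proof. by rewrite -[X in _ -> measurable X]setTI; exact: measurable_direction. Qed.

Let sphere_measure0 : sphere_measure set0 = 0.
Proof. by rewrite /sphere_measure preimage_set0 setI0 measure0 mule0. Qed.

Let sphere_measure_ge0 A : 0 <= sphere_measure A.
Proof. by rewrite /sphere_measure mule_ge0// lee_fin. Qed.

Let sphere_measure_sigma_additive : semi_sigma_additive sphere_measure.
Proof.
move=> F mF tF mUF; rewrite /sphere_measure preimage_bigcup setI_bigcupr.
under eq_fun do rewrite -ge0_sume_distrr//.
apply: cvgeZl => //.
apply: measure_semi_sigma_additive.
- by move=> n; apply: measurableI; [exact: measurable_punctured_ball|exact: mdir].
- apply: trivIset_setIl; apply/trivIsetP => i j _ _ ij.
  by move/trivIsetP: tF => tF; rewrite -preimage_setI tF// preimage_set0.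
- rewrite -setI_bigcupr -preimage_bigcup; apply: measurableI.
    exact: measurable_punctured_ball.
  exact: mdir.
Qed.

HB.instance Definition _ := isMeasure.Build _ _ _ sphere_measure
  sphere_measure0 sphere_measure_ge0 sphere_measure_sigma_additive.

End sphere.

Section spherical_harmonics.
Context {R : realType} {d : nat}.
Local Notation C := R[i].
Local Notation V := 'rV[R]_d.

Definition laplacian (p : {mpoly C[d]}) : {mpoly C[d]} :=
  \sum_(i < d) p^`M(i)^`M(i).

(* Functions on the sphere are represented by functions on R^d, of which only
   the values on the sphere matter. *)
Definition spherical_harmonic (n : nat) (f : V -> C) : Prop :=
  exists p : {mpoly C[d]},
    [/\ p \is n.-homog, laplacian p = 0 &
        forall x, sphere x -> f x = p.@[fun i => (x ord0 i)%:C]].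

Definition sphere_integral (f : V -> C) : C :=
  (\int[sphere_measure]_(x in sphere) complex.Re (f x))%R +i*
  (\int[sphere_measure]_(x in sphere) complex.Im (f x))%R.

Definition sphere_inner (f g : V -> C) : C :=
  sphere_integral (fun x => f x * (g x)^*).

(* (Y_m) is a basis of the space of spherical harmonics of degree n, of
   dimension N, that is orthonormal in L^2 of the sphere. *)
Definition orthonormal_basis (n N : nat) (Y : 'I_N -> V -> C) : Prop :=
  [/\ forall m, spherical_harmonic n (Y m),
      forall c : 'I_N -> C,
        (forall x, sphere x -> \sum_(m < N) c m * Y m x = 0) ->
        forall m, c m = 0,
      forall f, spherical_harmonic n f ->
        exists c : 'I_N -> C,
          forall x, sphere x -> f x = \sum_(m < N) c m * Y m x &
      forall m m', sphere_inner (Y m) (Y m') = (m == m')%:R].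

End spherical_harmonics.

Section bessel.
Context {R : realType}.

(* Only used for 0 < x, where the integral converges. *)
Definition Gamma (x : R) : R :=
  (\int[lebesgue_measure]_(t in `]0%R, +oo[) (t `^ (x - 1) * expR (- t)))%R.

(* Only used for nu >= - 1/2 and 0 < z. *)
Definition besselJ (nu z : R) : R :=
  limn (series (fun m : nat =>
    (-1) ^+ m / (m`!%:R * Gamma (m%:R + nu + 1))
      * (z / 2) `^ (2 * m%:R + nu))).

Definition besselJd_pos (d n : nat) (z : R) : R :=
  (2 * pi) `^ (d%:R / 2) * besselJ (n%:R + d%:R / 2 - 1) z
    / z `^ (d%:R / 2 - 1).

Definition besselJd (d n : nat) (z : R) : R :=
  if z == 0 then lim (besselJd_pos d n t @[t --> 0^'+])
  else besselJd_pos d n z.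

End bessel.

Section wave.
Context {R : realType} {d : nat}.

(* The first vector of the canonical basis, a point of the sphere when
   0 < d. *)
Definition pole : 'rV[R]_d := \row_i ((i : nat) == 0%N)%:R.

(* J_{d,n}(k|r|) Y(r/|r|); at r = 0 this is 0 if n > 0, and for n = 0 the
   function Y is constant on the sphere. *)
Definition spherical_wave (k : R) (n : nat) (Y : 'rV[R]_d -> R[i])
    (r : 'rV[R]_d) : R[i] :=
  if r == 0 then
    if n == 0%N then (besselJd d 0 0)%:C * Y pole else 0
  else (besselJd d n (k * enorm r))%:C * Y (direction r).

End wave.

(* Main.v *)
(* The sphere integral L, as a functional on complex polynomials, satisfies
   (k + d) L(x_i p) = L(d_i p) for p homogeneous of degree k + 1, as follows
   from the Gaussian moments in polar coordinates. Hence harmonic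
   polynomials of different degrees are orthogonal, and, for Y harmonic of
   degree n, L((r.x)^j Y) is an explicit multiple of |r|^(j-n) Y(r) (by
   recursion on j); summing over j, the exponential e^(i k r.x) satisfies
   <e_r, Y> = i^n J_{d,n}(k|r|) conj(Y)(r/|r|), as power series. The addition
   theorem is thus Parseval's identity for <e_r', e_r> = J_{d,0}(k|r - r'|). No
   completeness is needed: by Fischer's decomposition Parseval is exact on
   polynomials of degree < M (the Taylor sections of e_r'), and Bessel's
   inequality bounds the error for the remainder by the tail of exp. *)

From HB Require Import structures.
Require Import Defs.
From mathcomp Require Import all_boot all_order all_algebra.
From mathcomp.multinomials Require Import mpoly.
From mathcomp.real_closed Require Import complex.
From mathcomp Require Import all_classical all_reals all_analysis.
From mathcomp Require Import measurable_realfun gauss_integral.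
From mathcomp Require Import ring lra zify.

Set Implicit Arguments.
Unset Strict Implicit.
Unset Printing Implicit Defensive.

Import Order.TTheory GRing.Theory Num.Theory numFieldNormedType.Exports.

Local Open Scope classical_set_scope.
Local Open Scope ring_scope.
Local Open Scope complex_scope.


(** * Harmonic polynomials *)

(** The rule for L is the divergence theorem: the integral of x_i p over the sphere is that of d_i p
    over the ball, and d_i p, of degree k, contributes the radial factor 1/(k + d). It is obtained
    without any change of variables: Tonelli's theorem on a region 0 < |x| <= rho(t), together with
    the scaling of Lebesgue measure, links the surface measure to Gaussian integrals, which factor
    over the coordinates. Everything else stays polynomial: the plane wave is replaced by its Taylor
    section of N terms, so that L is only ever applied to polynomials and no complex exponential
    occurs. This costs two errors. The product of the sections for r' and (conjugated) r is not the
    section for r' - r, but the difference is majorized by the same expression at real arguments,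
    where it tends to 0. And Parseval's identity up to degree M is applied to sections with N >= M:
    N tends to infinity first, with a bound that is uniform in N, and M afterwards. The factors i^n
    and (-i)^n of the two coefficients cancel. *)

Section mpoly_derivatives.
Context {F : numFieldType} {d : nat}.
Implicit Types (p q : {mpoly F[d]}) (r : 'I_d -> F).

(** The same expression as [laplacian], over any numeric field, since harmonic polynomials are first
    treated algebraically. *)
Definition mlaplacian p : {mpoly F[d]} := \sum_(i < d) p^`M(i)^`M(i).

Definition mpoly_r2 : {mpoly F[d]} := \sum_(i < d) 'X_i ^+ 2.

Definition linear_form r : {mpoly F[d]} := \sum_(i < d) r i *: 'X_i.

Definition dir_deriv r p : {mpoly F[d]} := \sum_(i < d) r i *: p^`M(i).

Lemma mderiv_homog n p i : p \is n.+1.-homog -> p^`M(i) \is n.-homog.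
Proof.
move=> /dhomogP hp; rewrite (mpolyE p) linear_sum/= big_seq.
apply: rpred_sum => m /hp /= mn; rewrite mderivZ mderivX; apply: dhomogZ.
have [->|mi0] := eqVneq (m i) 0%N; first by rewrite scale0r dhomog0.
apply: dhomogZ; rewrite dhomogX/=; apply/eqP.
have /addmBA : (U_(i) <= m)%MM by rewrite lep1mP.
have := mdegD (m - U_(i)) U_(i).
rewrite submK ?lep1mP// mdeg1 mn => + _; lia.
Qed.

Lemma mderiv_homog0 p i : p \is 0.-homog -> p^`M(i) = 0.
Proof.
move=> /dhomogP hp; rewrite (mpolyE p) linear_sum/= big_seq big1// => m /hp /= /eqP.
by rewrite mdeg_eq0 => /eqP ->; rewrite mderivZ mpolyX0 mderivC scaler0.
Qed.

Lemma mderiv_prehomog n p i : p \is n.-homog -> p^`M(i) \is n.-1.-homog.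
Proof.
by case: n => [/mderiv_homog0 ->|n /mderiv_homog//]; exact: dhomog0.
Qed.

Lemma euler_homog n p : p \is n.-homog ->
  \sum_(i < d) 'X_i * p^`M(i) = n%:R *: p.
Proof.
move=> /dhomogP hp.
have eqi (i : 'I_d) : 'X_i * p^`M(i) = \sum_(m <- msupp p) (m i)%:R *: (p@_m *: 'X_[m]).
  rewrite {1}(mpolyE p) linear_sum/= mulr_sumr; apply: eq_bigr => m _.
  rewrite mderivZ mderivX -!scalerAr scalerA mulrC -scalerA.
  have [->|mi0] := eqVneq (m i) 0%N; first by rewrite !scale0r.
  by rewrite -mpolyXD addmC submK// lep1mP.
rewrite (eq_bigr _ (fun i _ => eqi i)) exchange_big/=.
rewrite [in RHS](mpolyE p) scaler_sumr !big_seq; apply: eq_bigr => m /hp/= mn.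
by rewrite -scaler_suml -natr_sum -mdegE mn.
Qed.

Lemma mderivXU (i j : 'I_d) : ('X_j : {mpoly F[d]})^`M(i) = (j == i)%:R.
Proof.
rewrite mderivX mnm1E; case: eqP => [->|_]; last by rewrite scale0r.
by rewrite scale1r -{1}[U_(i)%MM]add0m addmK mpolyX0.
Qed.

Lemma mderiv_linear_form r i : (linear_form r)^`M(i) = (r i)%:MP.
Proof.
rewrite linear_sum/= (bigD1 i)//= big1 ?addr0 => [|j ji].
  by rewrite mderivZ mderivXU eqxx -mul_mpolyC mulr1.
by rewrite mderivZ mderivXU (negbTE ji) scaler0.
Qed.

Lemma mderiv_r2 i : mpoly_r2^`M(i) = 2%:R *: 'X_i.
Proof.
rewrite linear_sum/= (bigD1 i)//= big1 ?addr0 => [|j ji].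
  by rewrite mderivM mderivXU eqxx mulr1 mul1r scaler_nat.
by rewrite mderivM mderivXU (negbTE ji) mulr0 mul0r addr0.
Qed.

Lemma linear_form_homog r : linear_form r \is 1.-homog.
Proof.
by apply: rpred_sum => i _; apply: dhomogZ; rewrite dhomogX/= mdeg1.
Qed.

Lemma r2_homog : mpoly_r2 \is 2.-homog.
Proof.
apply: rpred_sum => i _; rewrite -[2%N]/(1 * 2)%N; apply: dhomogMn.
by rewrite dhomogX/= mdeg1.
Qed.

Lemma mlaplacianD p q : mlaplacian (p + q) = mlaplacian p + mlaplacian q.
Proof. by rewrite -big_split; apply: eq_bigr => i _; rewrite !mderivD. Qed.

Lemma mlaplacianZ c p : mlaplacian (c *: p) = c *: mlaplacian p.
Proof. by rewrite /mlaplacian scaler_sumr; apply: eq_bigr => i _; rewrite !mderivZ. Qed.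

Lemma mlaplacian_homog n p : p \is n.+2.-homog -> mlaplacian p \is n.-homog.
Proof. by move=> hp; apply: rpred_sum => i _; do 2!apply: mderiv_homog. Qed.

Lemma mlaplacian_homog1 n p : p \is n.-homog -> (n < 2)%N -> mlaplacian p = 0.
Proof.
move=> hp n2; apply: big1 => i _; apply: mderiv_homog0.
by have := mderiv_prehomog i hp; case: n n2 {hp} => [|[|]].
Qed.

(** By Leibniz: the Laplacian of |x|^2 is 2d, and the cross term 4 sum_i x_i d_i q is 4m q by
    Euler's identity. *)
Lemma mlaplacian_r2M m q : q \is m.-homog ->
  mlaplacian (mpoly_r2 * q) = (2 * d + 4 * m)%:R *: q + mpoly_r2 * mlaplacian q.
Proof.
move=> hq.
have eqi (i : 'I_d) : (mpoly_r2 * q)^`M(i)^`M(i) =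
    2%:R *: q + 4%:R *: ('X_i * q^`M(i)) + mpoly_r2 * q^`M(i)^`M(i).
  rewrite mderivM mderiv_r2 mderivD !mderivM mderivZ mderiv_r2 mderivXU eqxx.
  rewrite -!scalerAl mul1r !scaler_nat.
  by ring.
rewrite /mlaplacian (eq_bigr _ (fun i _ => eqi i)) !big_split/= sumr_const card_ord.
rewrite -scaler_sumr (euler_homog hq) -mulr_sumr -[_ *+ d]scaler_nat !scalerA.
by rewrite -scalerDl -!natrM -natrD (mulnC d).
Qed.

(** For harmonic [q] the last term vanishes, and the Laplacian lowers the power of |x|^2 by one up
    to a scalar that is nonzero when d > 0. This is what makes it invertible in the Fischer
    decomposition. *)
Lemma mlaplacian_r2XM m q l : q \is m.-homog ->
  mlaplacian (mpoly_r2 ^+ l.+1 * q) =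
  (2 * l.+1 * (2 * l + d + 2 * m))%:R *: (mpoly_r2 ^+ l * q)
  + mpoly_r2 ^+ l.+1 * mlaplacian q.
Proof.
move=> hq; elim: l => [|l IH].
  by rewrite expr1 expr0 mul1r (mlaplacian_r2M hq); congr (_%:R *: _ + _); lia.
rewrite exprS -mulrA (@mlaplacian_r2M (2 * l.+1 + m)); last first.
  by rewrite dhomogM// -[X in X.-homog]/(2 * l.+1)%N dhomogMn// r2_homog.
rewrite IH mulrDr -scalerAr addrA mulrA -exprS mulrA -exprS -scalerDl -natrD.
by congr (_%:R *: _ + _); lia.
Qed.



(* Fischer decomposition. *)
Lemma harmonic_ind (P : {mpoly F[d]} -> Prop) j : (0 < d)%N ->
    (forall p q, P p -> P q -> P (p + q)) ->
    (forall l n h, (2 * l + n)%N = j -> h \is n.-homog -> mlaplacian h = 0 ->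
      P (mpoly_r2 ^+ l * h)) ->
  forall p, p \is j.-homog -> P p.
Proof.
move=> d0; elim/ltn_ind: j P => j IH P PD Ph p hp.
have [j2|j2] := ltnP j 2.
  by rewrite -[p]mul1r; apply: (Ph 0%N j) => //; exact: mlaplacian_homog1 j2.
case: j j2 => [|[|j]]// _ in IH hp Ph *.
(* The induction hypothesis is applied to the Laplacian of [p]: [P'] asks for a preimage under the
   Laplacian that satisfies [P]. Subtracting such a preimage from [p] leaves a harmonic polynomial,
   which is the case l = 0 of the hypothesis on [P]. *)
pose P' q := exists p', [/\ p' \is j.+2.-homog, mlaplacian p' = q & P p'].
have [] := IH j _ P' _ _ (mlaplacian p) _; rewrite ?ltnS ?leqnSn//.
- move=> p1 p2 [q1 [h1 <- P1]] [q2 [h2 <- P2]].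
  exists (q1 + q2); split; [exact: dhomogD|exact: mlaplacianD|exact: PD].
- move=> l n h jln hh Dh.
  pose c : F := (2 * l.+1 * (2 * l + d + 2 * n))%:R.
  have c0 : c != 0 by rewrite pnatr_eq0; lia.
  exists (mpoly_r2 ^+ l.+1 * (c^-1 *: h)); split.
  + rewrite (_ : j.+2 = 2 * l.+1 + n)%N; last lia.
    by rewrite dhomogM ?dhomogZ// dhomogMn// r2_homog.
  + rewrite (@mlaplacian_r2XM n) ?dhomogZ// mlaplacianZ Dh scaler0 mulr0 addr0.
    by rewrite -scalerAr scalerA mulfV// scale1r.
  + by apply: (Ph _ n); [lia|exact: dhomogZ|rewrite mlaplacianZ Dh scaler0].
- exact: mlaplacian_homog.
- move=> p' [hp' Dp' Pp'].
  rewrite -(subrK p' p); apply: (PD) => //; rewrite -[_ - _]mul1r.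
  apply: (Ph 0%N j.+2) => //; first by rewrite dhomogD ?dhomogN.
  by rewrite mlaplacianD -scaleN1r mlaplacianZ Dp' scaleN1r subrr.
Qed.

End mpoly_derivatives.

(** * Functionals obeying the integration by parts of the sphere *)

Section sphere_functional.
Context {F : numFieldType} {d : nat}.
Implicit Types (p q : {mpoly F[d]}) (r : 'I_d -> F).

Lemma dir_deriv_homog r n p : p \is n.-homog -> dir_deriv r p \is n.-1.-homog.
Proof. by move=> hp; apply: rpred_sum => i _; apply/dhomogZ/mderiv_prehomog. Qed.

Lemma dir_deriv_homog0 r p : p \is 0.-homog -> dir_deriv r p = 0.
Proof. by move=> hp; apply: big1 => i _; rewrite mderiv_homog0// scaler0. Qed.

Lemma mderiv_dir_deriv r p j : (dir_deriv r p)^`M(j) = dir_deriv r p^`M(j).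
Proof.
rewrite /dir_deriv [LHS]linear_sum; apply: eq_bigr => i _.
by rewrite [LHS]mderivZ mderiv_comm.
Qed.

Lemma mlaplacian_dir_deriv r p : mlaplacian p = 0 -> mlaplacian (dir_deriv r p) = 0.
Proof.
move=> p0; rewrite /mlaplacian; under eq_bigr do rewrite !mderiv_dir_deriv.
rewrite exchange_big big1//= => i _; rewrite -scaler_sumr.
rewrite (_ : \sum_j _ = (mlaplacian p)^`M(i)); first by rewrite p0 mderiv0 scaler0.
by rewrite [RHS]linear_sum.
Qed.

Lemma meval_dir_deriv r n p : p \is n.-homog -> (dir_deriv r p).@[r] = n%:R * p.@[r].
Proof.
move=> /euler_homog/(congr1 (meval r)); rewrite mevalZ => <-.
rewrite !raddf_sum/=; apply: eq_bigr => i _.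
by rewrite mevalZ mevalM mevalXU.
Qed.

Lemma mderiv_exp p i j : (p ^+ j.+1)^`M(i) = j.+1%:R *: (p ^+ j * p^`M(i)).
Proof.
elim: j => [|j IH]; first by rewrite expr1 expr0 mul1r scale1r.
rewrite exprS mderivM IH -scalerAr mulrA -exprS [X in X + _]mulrC.
by rewrite -[j.+2]addn1 natrD scalerDl scale1r addrC.
Qed.

Lemma dir_derivM r p q : dir_deriv r (p * q) = dir_deriv r p * q + p * dir_deriv r q.
Proof.
rewrite /dir_deriv mulr_suml mulr_sumr -big_split; apply: eq_bigr => i _ /=.
by rewrite mderivM scalerDr -scalerAl -scalerAr.
Qed.

Lemma dir_deriv_linear_formX r j : dir_deriv r (linear_form r ^+ j) =
  (j%:R * \sum_i r i ^+ 2) *: linear_form r ^+ j.-1.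
Proof.
case: j => [|j].
  by rewrite expr0 /dir_deriv big1 ?mul0r ?scale0r// => i _; rewrite mderivC scaler0.
rewrite /dir_deriv.
under eq_bigr do rewrite mderiv_exp mderiv_linear_form mulrC mul_mpolyC !scalerA.
by rewrite -scaler_suml mulr_sumr; congr (_ *: _); apply: eq_bigr => i _; ring.
Qed.

(** An abstract stand-in for the sphere integral. [L_parts] is the divergence theorem on the ball
    combined with radial integration; it speaks of positive degrees only, and [L_X] supplies degree
    0. *)
Variable L : {scalar {mpoly F[d]}}.
Hypothesis d_gt0 : (0 < d)%N.
Hypothesis L_X : forall i, L 'X_i = 0.
Hypothesis L_parts : forall n p i, p \is n.+1.-homog ->
  (n + d)%:R * L ('X_i * p) = L p^`M(i).

Lemma L_XC i c : L ('X_i * c%:MP) = 0.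
Proof. by rewrite mulrC mul_mpolyC linearZ/= L_X mulr0. Qed.

Lemma dhomog0_const p : p \is 0.-homog -> p = (p@_0)%:MP.
Proof.
move=> /dhomogP hp; apply: msize1_polyC; rewrite msizeE; apply/bigmax_leqP_seq => m mp _.
by rewrite (hp m mp).
Qed.

(** Euler's identity writes (n + 1) L p as sum_i L(x_i d_i p), and [L_parts] turns this into a
    multiple of L applied to the Laplacian. In degree 1 the d_i p are constants, and [L_X] takes
    over. *)
Lemma harmonic_mean0 n p : p \is n.+1.-homog -> mlaplacian p = 0 -> L p = 0.
Proof.
move=> hp p0.
have n0 : (n.+1%:R : F) != 0 by rewrite pnatr_eq0.
apply/(mulfI n0); rewrite mulr0.
have -> : n.+1%:R * L p = \sum_i L ('X_i * p^`M(i)).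
  by rewrite -linearZ -(euler_homog hp) linear_sum.
have hpi i := mderiv_homog i hp.
case: n hp n0 hpi => [|n] hp n0 hpi.
  by apply: big1 => i _; rewrite (dhomog0_const (hpi i)) L_XC.
have nd0 : ((n + d)%:R : F) != 0 by rewrite pnatr_eq0; lia.
apply/(mulfI nd0); rewrite mulr0 mulr_sumr.
under eq_bigr do rewrite (L_parts _ (hpi _)).
by rewrite -linear_sum [X in L X]p0 linear0.
Qed.

(** Green's identity: Euler's identity for [p], then [L_parts] and harmonicity of [p], express (deg
    p) L(p q) as a multiple of sum_i L(d_i p d_i q). This is symmetric in [p] and [q], hence (deg p)
    L(p q) = (deg q) L(p q). *)
Lemma harmonic_ortho n m p q : p \is n.-homog -> q \is m.-homog ->
  mlaplacian p = 0 -> mlaplacian q = 0 -> n != m -> L (p * q) = 0.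
Proof.
case: n => [|n] hp hq p0 q0 nm.
  rewrite (dhomog0_const hp) mul_mpolyC linearZ/= (@harmonic_mean0 m.-1) ?mulr0//.
  by rewrite prednK// lt0n eq_sym.
case: m => [|m] in hq nm *.
  by rewrite (dhomog0_const hq) mulrC mul_mpolyC linearZ/= (@harmonic_mean0 n) ?mulr0.
have sym n1 n2 u v : u \is n1.+1.-homog -> v \is n2.+1.-homog -> mlaplacian u = 0 ->
    (n1 + n2 + d)%:R * (n1.+1%:R * L (u * v)) = \sum_i L (u^`M(i) * v^`M(i)).
  move=> hu hv u0.
  have -> : n1.+1%:R * L (u * v) = \sum_i L ('X_i * (u^`M(i) * v)).
    rewrite -linearZ -linear_sum/= scalerAl -(euler_homog hu) mulr_suml.
    by congr (L _); apply: eq_bigr => i _; rewrite mulrA.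
  rewrite mulr_sumr.
  have huv i : u^`M(i) * v \is (n1 + n2).+1.-homog.
    by rewrite -addnS; apply: dhomogM => //; exact: mderiv_homog.
  under eq_bigr do rewrite (L_parts _ (huv _)) mderivM linearD/=.
  by rewrite big_split/= -linear_sum/= -mulr_suml [X in L (X * _)]u0 mul0r linear0 add0r.
have nd0 : ((n + m + d)%:R : F) != 0 by rewrite pnatr_eq0; lia.
have : n.+1%:R * L (p * q) = m.+1%:R * L (p * q).
  apply/(mulfI nd0); rewrite (sym n m)// [p * q]mulrC (addnC n) (sym m n)//.
  by under eq_bigr do rewrite mulrC.
move/eqP; rewrite -subr_eq0 -mulrBl mulf_eq0 subr_eq0 eqr_nat (negbTE nm)/=.
by move/eqP.
Qed.

Lemma linear_form_parts r m q : q \is m.+1.-homog ->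
  (m + d)%:R * L (linear_form r * q) = L (dir_deriv r q).
Proof.
move=> hq; rewrite mulr_suml !linear_sum/= mulr_sumr; apply: eq_bigr => i _.
by rewrite -scalerAl !linearZ/= mulrCA (L_parts _ hq).
Qed.

(** One factor r.x is traded for a derivative in the direction [r]. The sum of the r_i^2 is
    bilinear, without conjugates: [r] will be a complex vector. *)
Lemma linear_formX_parts r j n q : q \is n.-homog -> (0 < j + n)%N ->
  ((j + n).-1 + d)%:R * L (linear_form r ^+ j.+1 * q) =
  j%:R * (\sum_i r i ^+ 2) * L (linear_form r ^+ j.-1 * q)
  + L (linear_form r ^+ j * dir_deriv r q).
Proof.
move=> hq jn; rewrite exprS -mulrA linear_form_parts; last first.
  rewrite prednK//; apply: dhomogM => //.
  by rewrite -[X in X.-homog]mul1n; apply/dhomogMn/linear_form_homog.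
by rewrite dir_derivM linearD/= dir_deriv_linear_formX -scalerAl linearZ/=.
Qed.

(** The condition is inherited along the recursion: the pair (j + 1, n) of exponent and degree leads
    to (j - 1, n) and (j, n - 1), which keep both the inequality and the parity. *)
Lemma linear_formX_harmonic0 r j n q : q \is n.-homog -> mlaplacian q = 0 ->
  (j < n)%N || odd (j + n) -> L (linear_form r ^+ j * q) = 0.
Proof.
elim/ltn_ind: j n q => -[|j] IH n q hq q0 jn.
  by rewrite expr0 mul1r (@harmonic_mean0 n.-1)//; case: n hq jn.
have [/eqP|jn0] := posnP (j + n)%N.
  rewrite addn_eq0 => /andP[/eqP-> /eqP n0]; rewrite {}n0 in hq *.
  rewrite expr1 (dhomog0_const hq) mulrC mul_mpolyC linearZ/= linear_sum.
  by rewrite big1 ?mulr0// => i _; rewrite linearZ/= L_X mulr0.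
have nd0 : (((j + n).-1 + d)%:R : F) != 0 by rewrite pnatr_eq0; lia.
apply/(mulfI nd0); rewrite mulr0 (linear_formX_parts _ hq)//.
have [n0|n0] := posnP n.
  rewrite n0 in hq jn; rewrite dir_deriv_homog0// mulr0 linear0 addr0.
  by case: j IH jn {jn0 nd0} => [|j] IH jn; rewrite ?mul0r//= (IH j _ 0%N) ?mulr0//; lia.
rewrite (IH j _ n.-1 (dir_deriv r q)); [|lia|exact: dir_deriv_homog|
  exact: mlaplacian_dir_deriv|lia].
by case: j IH jn {jn0 nd0} => [|j] IH jn; rewrite ?mul0r ?addr0//= (IH j _ n) ?mulr0//; lia.
Qed.

(** What the recursion of [linear_formX_parts] produces, apart from a factorial. For the sphere
    integral it is, up to the sign (-1)^l, the coefficient of z^(2l) in J_{d,n}(z) / z^n. *)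
Definition sphere_coef l n : F :=
  L 1 / (l`!%:R * 2 ^+ l * \prod_(i < l + n) (d + 2 * i)%:R).

Lemma sphere_coef_neq0 l n : l`!%:R * 2 ^+ l * \prod_(i < n) ((d + 2 * i)%:R : F) != 0.
Proof.
rewrite !mulf_neq0 ?expf_neq0 ?pnatr_eq0 -?lt0n ?fact_gt0//.
by rewrite prodf_seq_neq0; apply/allP => i _; rewrite pnatr_eq0; lia.
Qed.

(** Here and in [sphere_coef_recr] the factor in front is the last one of the product in the
    denominator. The two lemmas serve the two terms of [linear_formX_parts], in which [l] or [n] is
    lowered. *)
Lemma sphere_coef_recl l n : ((l + n) * 2 + d)%:R * sphere_coef l.+1 n = sphere_coef l n / (2 * l.+1)%:R.
Proof.
have := sphere_coef_neq0 l (l + n); rewrite /sphere_coef addSn big_ord_recr/=.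
set P := \prod_(i < _) _; rewrite !mulf_eq0 !negb_or -!andbA => /and3P[l0 l2 P0].
have h1 : ((d + 2 * (l + n))%:R : F) != 0 by rewrite pnatr_eq0; lia.
have h2 : (2 * l.+1)%:R != 0 :> F by rewrite pnatr_eq0.
rewrite factS exprS (_ : (l + n) * 2 + d = d + 2 * (l + n))%N; last lia.
rewrite natrM in h2 *; rewrite !natrM.
move: h2; rewrite mulf_eq0 negb_or => /andP[h2 h3]; field.
by rewrite P0 l2 l0 -!natrD -natrM -natrD h1 nat1r h3.
Qed.

Lemma sphere_coef_recr l n : ((l + n) * 2 + d)%:R * sphere_coef l n.+1 = sphere_coef l n.
Proof.
have := sphere_coef_neq0 l (l + n); rewrite /sphere_coef addnS big_ord_recr/=.
set P := \prod_(i < _) _; rewrite !mulf_eq0 !negb_or -!andbA => /and3P[l0 l2 P0].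
have h1 : ((d + 2 * (l + n))%:R : F) != 0 by rewrite pnatr_eq0; lia.
rewrite (_ : (l + n) * 2 + d = d + 2 * (l + n))%N; last lia.
by field; rewrite P0 l2 l0 -!natrD -natrM -natrD h1.
Qed.

(** Both terms of [linear_formX_parts] are known by induction, one with [l] lowered and one with [n]
    lowered. They are multiples of the same quantity with weights 2l and n, which add up to the next
    factor n + 2l of the factorial. *)
Lemma linear_formX_harmonic r l n q : q \is n.-homog -> mlaplacian q = 0 ->
  L (linear_form r ^+ (n + 2 * l) * q) =
  (n + 2 * l)`!%:R * sphere_coef l n * (\sum_i r i ^+ 2) ^+ l * q.@[r].
Proof.
move: {2}(n + 2 * l)%N (leqnn (n + 2 * l)%N) => s.
elim: s l n q => [|s IH] l n q sln hq q0.
  have [? ?] : n = 0%N /\ l = 0%N by lia.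
  subst n l; rewrite (dhomog0_const hq) mevalC.
  rewrite /sphere_coef big_ord0 !expr0 mulr1 !mul1r invr1 !mulr1.
  by rewrite -[_%:MP]mulr1 mul_mpolyC linearZ/= mulrC.
have [ln0|ln0] := posnP (n + 2 * l)%N.
  by apply: IH => //; rewrite ln0.
set rr := \sum_i _; rewrite -(prednK ln0); set j := (n + 2 * l).-1.
have jn0 : (0 < j + n)%N by lia.
have nd0 : (((j + n).-1 + d)%:R : F) != 0 by rewrite pnatr_eq0; lia.
apply/(mulfI nd0); rewrite (linear_formX_parts _ hq)// -/rr.
have -> : j%:R * rr * L (linear_form r ^+ j.-1 * q) =
    (if l is l'.+1 then j`!%:R * sphere_coef l' n * rr ^+ l * q.@[r] else 0).
  (* For l = 0 the exponent j - 1 = n - 2 is below the degree [n], so that the term vanishes; for n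
     = 1 it carries the factor j = 0. *)
  case: l @j sln ln0 jn0 nd0 => [|l] j sln ln0 jn0 nd0.
    have [n1|n1] := eqVneq n 1%N; first by rewrite /j n1 !mul0r.
    by rewrite (linear_formX_harmonic0 _ hq)// ?mulr0//; apply/orP; left; lia.
  have -> : j = (n + 2 * l).+1 by lia.
  by rewrite IH//; [rewrite factS natrM exprS; ring|lia].
have -> : L (linear_form r ^+ j * dir_deriv r q) =
    (if n is n'.+1 then j`!%:R * sphere_coef l n' * rr ^+ l * n%:R * q.@[r] else 0).
  have hD := dir_deriv_homog r hq; have DD := mlaplacian_dir_deriv r q0.
  have eD := meval_dir_deriv r hq.
  case: n @j sln ln0 jn0 nd0 hq hD eD => [|n] j sln ln0 jn0 nd0 hq hD eD.
    by rewrite dir_deriv_homog0// mulr0 linear0.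
  have -> : j = (n + 2 * l)%N by lia.
  by rewrite (IH l n)// eD -/rr; ring.
rewrite factS; move: @j ln0 jn0 nd0 => j ln0 jn0 _.
case: l n {hq q0 sln jn0} @j ln0 => [|l] [|n] j ln0 //.
- rewrite -(sphere_coef_recr 0 n) add0r [(_ * j`!)%:R]natrM.
  have [-> ->] : (j + n.+1).-1 = ((0 + n) * 2)%N /\ j.+1 = n.+1 by lia.
  move: (j`!%:R : F) (sphere_coef 0 n.+1) => A B; clearbody rr; ring.
- have h2 : ((2 * l.+1)%:R : F) != 0 by rewrite pnatr_eq0.
  rewrite addr0 -[sphere_coef l 0](mulfVK h2) -sphere_coef_recl [(_ * j`!)%:R]natrM.
  have [-> ->] : (j + 0).-1 = ((l + 0) * 2)%N /\ j.+1 = (2 * l.+1)%N by lia.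
  move: (j`!%:R : F) (sphere_coef l.+1 0) => A B; clearbody rr; ring.
- have h2 : ((2 * l.+1)%:R : F) != 0 by rewrite pnatr_eq0.
  rewrite -[sphere_coef l n.+1](mulfVK h2) -sphere_coef_recl -(sphere_coef_recr l.+1 n) [(_ * j`!)%:R]natrM.
  have [-> [-> ->]] : (j + n.+1).-1 = ((l + n.+1) * 2)%N /\
    j.+1 = (n.+1 + 2 * l.+1)%N /\ (l.+1 + n = l + n.+1)%N by lia.
  move: (j`!%:R : F) (sphere_coef l.+1 n.+1) => A B; clearbody rr; ring.
Qed.

End sphere_functional.

(** * Integration in polar coordinates *)

Section scaling.
Context {R : realType}.
Local Notation mu := (@lebesgue_measure R).
Local Open Scope ereal_scope.

Lemma measurable_mulr_realType (t : R) :
  measurable_fun [set: measurableTypeR R]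
    ((fun x => t * x)%R : measurableTypeR R -> measurableTypeR R).
Proof. exact: measurable_funM. Qed.

(** By uniqueness of Lebesgue measure: [t] times its image under multiplication by [t] agrees with
    it on intervals. *)
Lemma ge0_integral_scale1 (t : R) (f : R -> \bar R) : (0 < t)%R ->
  measurable_fun setT f -> (forall x, 0 <= f x) ->
  \int[mu]_x f (t * x)%R = t^-1%:E * \int[mu]_x f x.
Proof.
move=> t0 mf f0; have mt := measurable_mulr_realType t.
pose phi : measurableTypeR R -> measurableTypeR R := (fun x => t * x)%R.
have tnn : (0 <= t)%R by exact: ltW.
have muE A : measurable A -> mu A = mscale (NngNum tnn) (pushforward mu phi) A.
  apply: lebesgue_measure_unique => _ [[a b] _ <-] /=.
  rewrite /mscale/= [X in _ = _ * X](_ : _ = mu `](t^-1 * a)%R, (t^-1 * b)%R]%classic).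
    rewrite !lebesgue_measure_itv/= !lte_fin ltr_pM2l ?invr_gt0//.
    case: ifPn => _; last by rewrite mule0.
    by rewrite -!EFinD -EFinM; congr EFin; field; rewrite gt_eqF.
  rewrite /pushforward; congr (mu _); apply/seteqP; split=> x /=; rewrite !in_itv/= /phi.
    by rewrite ltr_pdivrMl// ler_pdivlMl.
  by rewrite ltr_pdivrMl// ler_pdivlMl.
transitivity (\int[pushforward mu phi]_x f x).
  by rewrite ge0_integral_pushforward// preimage_setT.
rewrite [in RHS](eq_measure_integral (mscale (NngNum tnn) (pushforward mu phi))); last first.
  by move=> A mA _; exact: muE.
by rewrite ge0_integral_mscale//= muleA -EFinM mulVf ?gt_eqF// mul1e.
Qed.

Lemma ge0_integral_lebesgue_rVS n (f : 'rV[R]_n.+1 -> \bar R) :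
  measurable_fun setT f -> (forall x, 0 <= f x) ->
  \int[lebesgue_rV n.+1]_x f x =
  \int[mu]_x \int[lebesgue_rV n]_y f (rV_cons (x, y)).
Proof.
move=> mf f0; rewrite [LHS]ge0_integral_pushforward//; last exact: measurable_rV_cons.
rewrite preimage_setT fubini_tonelli1//; last by move=> x; exact: f0.
by apply: measurableT_comp => //; exact: measurable_rV_cons.
Qed.

Lemma measurable_scale_rV n (t : R) : measurable_fun [set: 'rV[R]_n] (fun x => (t *: x)%R).
Proof.
apply: measurable_fun_coordP => i; under eq_fun do rewrite mxE.
by apply: measurable_funM => //; exact: measurable_coord.
Qed.

Lemma ge0_integral_scale n (t : R) (f : 'rV[R]_n -> \bar R) : (0 < t)%R ->
  measurable_fun setT f -> (forall x, 0 <= f x) ->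
  \int[lebesgue_rV n]_x f (t *: x)%R = (t^-1 ^+ n)%:E * \int[lebesgue_rV n]_x f x.
Proof.
move=> t0; elim: n f => [|n IH] f mf f0.
  rewrite expr0 mul1e; apply: eq_integral => x _.
  by congr f; apply/rowP => -[].
have mfs : measurable_fun setT (fun x : 'rV[R]_n.+1 => f (t *: x)%R).
  by apply: measurableT_comp => //; exact: measurable_scale_rV.
have mfc : measurable_fun setT (fun p => f (@rV_cons _ n p)).
  by apply: measurableT_comp => //; exact: measurable_rV_cons.
rewrite !ge0_integral_lebesgue_rVS//.
have consZ x (y : 'rV[R]_n) : (t *: rV_cons (x, y) = rV_cons ((t * x)%R, t *: y))%R.
  apply/rowP => i; rewrite mxE; have [j ->|->] := unliftP ord0 i.
    by rewrite !rV_consS mxE.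
  by rewrite !rV_cons0.
under eq_integral do under eq_integral do rewrite consZ.
pose F x := \int[lebesgue_rV n]_y f (rV_cons (x, y)).
have mF : measurable_fun setT F.
  exact: (measurable_fun_fubini_tonelli_F (fun p => f (rV_cons p))).
have F0 x : 0 <= F x by exact: integral_ge0.
transitivity (\int[mu]_x ((t^-1 ^+ n)%:E * (F \o (fun x => t * x)%R) x)).
  apply: eq_integral => x _; rewrite (IH (fun y => f (rV_cons ((t * x)%R, y))))//.
  apply: measurableT_comp mf _.
  by apply: measurableT_comp (@measurable_rV_cons _ _) _; exact: measurable_fun_pair.
have mFt := measurableT_comp mF (measurable_mulr_realType t).
have tn0 : (0 <= t^-1 ^+ n)%R by rewrite exprn_ge0// invr_ge0 ltW.
have F0t x : setT x -> 0 <= (F \o *%R t) x by move=> _; exact: F0.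
have := ge0_integralZl_EFin mu measurableT F0t mFt tn0.
move=> ->.
have /= -> := ge0_integral_scale1 t0 mF F0.
by rewrite muleA -EFinM -exprSr.
Qed.

End scaling.

(** * Integrals of powers and of the exponential on the line *)

Section real_integrals.
Context {R : realType}.
Local Notation mu := (@lebesgue_measure R).

Lemma continuous_powR_gt0 (p x : R) : 0 < x -> {for x, continuous (@powR R ^~ p)}.
Proof.
move=> x0; apply: differentiable_continuous; apply/derivable1_diffP.
by apply: derivable_powR; rewrite in_itv/= andbT.
Qed.

(** The factor [c] serves negative exponents: with c = -1 and p = -a the integrand is the
    nonnegative weight a x^(-a-1). *)
Lemma integral_powR_segment (c p a b : R) : 0 < a -> a <= b ->
  (\int[mu]_(x in `[a, b]) (c * p * x `^ (p - 1))%:E = (c * (b `^ p - a `^ p))%:E)%E.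
Proof.
move=> a0; rewrite le_eqVlt => /predU1P[<-|ab].
  by rewrite set_itv1 integral_set1 subrr mulr0.
have x0 x : a <= x -> 0 < x by exact: lt_le_trans.
have dF (x : R) : 0 < x -> is_derive x 1 (fun x => c * x `^ p) (c * p * x `^ (p - 1)).
  move=> xp; have := is_deriveZ c (is_derive1_powR p xp).
  by rewrite -mulrA.
have cF (x : R) : 0 < x -> {for x, continuous (fun x => c * x `^ p)}.
  move=> ?; apply: continuousM; [exact: cst_continuous|exact: continuous_powR_gt0].
rewrite (@continuous_FTC2 _ _ (fun x => c * x `^ p) a b ab) -?EFinB ?mulrBr//.
- apply: continuous_in_subspaceT => x; rewrite inE/= in_itv/= => /andP[ax _].
  apply: (@continuousM _ _ (cst (c * p)) (@powR R ^~ (p - 1))); first exact: cst_continuous.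
  exact/continuous_powR_gt0/x0.
- split.
  + move=> x; rewrite in_itv/= => /andP[ax _].
    by case: (dF x (x0 x (ltW ax))).
  + exact/cvg_at_right_filter/cF.
  + by apply/cvg_at_left_filter/cF; rewrite x0// ltW.
- move=> x; rewrite in_itv/= => /andP[ax _].
  by rewrite derive1E; case: (dF x (x0 x (ltW ax))).
Qed.

(** For p < 1 the integrand is unbounded at 0, so the interval is exhausted by the segments
    [t/(k+1), t], on which the fundamental theorem applies. *)
Lemma integral_powR_oc (p t : R) : 0 < p -> 0 < t ->
  (\int[mu]_(x in `]0%R, t]) (p * x `^ (p - 1))%:E = (t `^ p)%:E)%E.
Proof.
move=> p0 t0; pose F (k : nat) : set R := `[t / k.+1%:R, t]%classic.
have tk k : 0 < t / k.+1%:R by rewrite divr_gt0.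
have UF : `]0, t]%classic = \bigcup_k F k.
  apply/seteqP; split=> [x /=|x [k _]]; rewrite /F/= !in_itv/=.
    move=> /andP[x0 xt]; exists (Num.truncn (t / x)) => //=; rewrite in_itv/= xt andbT.
    rewrite ler_pdivrMr// mulrC -ler_pdivrMr//; apply/ltW; exact: truncnS_gt.
  by move=> /andP[kx ->]; rewrite andbT (lt_le_trans (tk k)).
have Fint k : (\int[mu]_(x in F k) (p * x `^ (p - 1))%:E = (t `^ p - (t / k.+1%:R) `^ p)%:E)%E.
  have := @integral_powR_segment 1 p _ t (tk k); rewrite !mul1r; apply.
  by rewrite ler_pdivrMr// ler_peMr// ?ler1n// ltW.
have cvg1 : (\int[mu]_(x in F k) (p * x `^ (p - 1))%:E)%E @[k --> \oo] -->
    (\int[mu]_(x in `]0%R, t]) (p * x `^ (p - 1))%:E)%E.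
  rewrite UF; apply: ge0_nondecreasing_set_cvg_integral.
  - apply/nondecreasing_seqP => k; rewrite subsetEset => x; rewrite /F /= !in_itv/=.
    move=> /andP[kx ->]; rewrite andbT (le_trans _ kx)//.
    by rewrite ler_pM2l// lef_pV2 ?posrE// ler_nat.
  - by move=> k; exact: measurable_itv.
  - move=> k; apply/measurable_EFinP; apply: measurable_funM => //.
    apply: measurable_funTS; exact: measurable_powR.
  - by move=> k x _; rewrite lee_fin mulr_ge0// ?powR_ge0// ltW.
have cvg2 : (\int[mu]_(x in F k) (p * x `^ (p - 1))%:E)%E @[k --> \oo] --> (t `^ p)%:E.
  under eq_fun do rewrite Fint.
  apply: cvg_EFin; first exact: nearW.
  rewrite -[X in _ --> X]subr0; apply: cvgB; first exact: cvg_cst.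
  apply: ((cvg_at_rightP (@powR R ^~ p) 0 0).1 (powR_cvg0 p0) (fun k : nat => t / k.+1%:R)).
  split => //; rewrite -[X in _ --> X](mulr0 t); apply: cvgM; first exact: cvg_cst.
  exact: cvg_harmonic.
by rewrite -(cvg_lim _ cvg1)// (cvg_lim _ cvg2).
Qed.

Lemma integral_expRN (a : R) :
  (\int[mu]_(x in `[a, +oo[) (expR (- x))%:E = (expR (- a))%:E)%E.
Proof.
rewrite (@ge0_continuous_FTC2y _ _ (fun x => - expR (- x)) a 0).
- by rewrite sub0e EFinN oppeK.
- by move=> x _; exact: expR_ge0.
- apply: continuous_subspaceT => x.
  by apply: continuous_comp; [exact: continuousN|exact: continuous_expR].
- by rewrite -oppr0; apply: cvgN; exact: cvgr_expR.
- move=> x _; exact: ex_derive.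
- apply: cvg_at_right_filter; apply: cvgN.
  by apply: continuous_comp; [exact: continuousN|exact: continuous_expR].
- move=> x _; rewrite derive1E.
  have dN : is_derive x 1 (fun x : R => - expR (- x)) (expR (- x)).
    by apply: is_derive_eq; rewrite mulrN1 opprK.
  exact: derive_val.
Qed.

End real_integrals.

Section tonelli_section.
Context d1 d2 (T1 : measurableType d1) (T2 : measurableType d2) (R : realType).
Variables (m1 : {sigma_finite_measure set T1 -> \bar R}).
Variables (m2 : {sigma_finite_measure set T2 -> \bar R}).
Local Open Scope ereal_scope.

Lemma integral_scale_section d (T : measurableType d) (m : {measure set T -> \bar R})
    (B : set T) (w : T -> R) (c : R) :
  measurable B -> measurable_fun setT w -> (forall y, 0 <= w y)%R -> (0 <= c)%R ->
  \int[m]_y (c * (w y * \1_B y))%:E = c%:E * \int[m]_(y in B) (w y)%:E.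
Proof.
move=> mB mw w0 c0.
have mwB : measurable_fun setT (fun y => (w y * \1_B y)%:E).
  by apply/measurable_EFinP; apply: measurable_funM => //; exact: measurable_indic.
have wB0 y : setT y -> 0 <= (w y * \1_B y)%:E by move=> _; rewrite lee_fin mulr_ge0.
have := ge0_integralZl_EFin m measurableT wB0 mwB c0.
under eq_integral do rewrite -EFinM.
move=> ->; congr (_ * _); rewrite [RHS]integral_mkcond; apply: eq_integral => y _.
by rewrite patchE indicE; case: ifPn => _; rewrite ?mulr1 ?mulr0.
Qed.

(** Tonelli's theorem for the weight F(x) w(y) on a region [A], written with sections. It yields
    both the recursion of Gamma and the polar formula. *)
Lemma tonelli_section (F : T1 -> R) (w : T2 -> R) (A : set (T1 * T2)) :
  measurable A -> measurable_fun setT F -> measurable_fun setT w ->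
  (forall x, 0 <= F x)%R -> (forall y, 0 <= w y)%R ->
  \int[m1]_x ((F x)%:E * \int[m2]_(y in [set y | A (x, y)]) (w y)%:E) =
  \int[m2]_y ((w y)%:E * \int[m1]_(x in [set x | A (x, y)]) (F x)%:E).
Proof.
move=> mA mF mw F0 w0.
pose f p := (F p.1 * (w p.2 * \1_A p))%:E.
have mf : measurable_fun setT f.
  apply/measurable_EFinP; apply: measurable_funM.
    by apply: measurableT_comp mF _; exact: measurable_fst.
  apply: measurable_funM; last exact: measurable_indic.
  by apply: measurableT_comp mw _; exact: measurable_snd.
have f0 p : 0 <= f p by rewrite lee_fin !mulr_ge0.
transitivity (\int[m1]_x \int[m2]_y f (x, y)).
  apply: eq_integral => x _; rewrite -integral_scale_section//.
  rewrite (_ : [set y | A (x, y)] = xsection A x); first exact: measurable_xsection.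
  by apply/seteqP; split=> y; rewrite /xsection/= ?inE.
rewrite (fubini_tonelli f mf f0).
apply: eq_integral => y _; rewrite -integral_scale_section//.
  by apply: eq_integral => x _; rewrite /f/= mulrCA.
rewrite (_ : [set x | A (x, y)] = ysection A y); first exact: measurable_ysection.
by apply/seteqP; split=> x; rewrite /ysection/= ?inE.
Qed.

End tonelli_section.

(** * The recursion of Gamma *)

Section gamma.
Context {R : realType}.
Local Notation mu := (@lebesgue_measure R).
Local Open Scope ereal_scope.

(** With extended real values, identities can be proved before convergence is known; [Gamma] takes
    the finite part and would be 0 if the integral diverged. *)
Definition GammaE (x : R) : \bar R :=
  \int[mu]_(t in `]0%R, +oo[) (t `^ (x - 1) * expR (- t))%:E.

Lemma GammaE_fine (x : R) : Gamma x = fine (GammaE x). Proof. by []. Qed.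

Lemma measurable_expRN : measurable_fun [set: R] (fun t : R => expR (- t)).
Proof. by apply: measurableT_comp => //; exact: measurableT_comp. Qed.

Lemma GammaE_ge0 x : 0 <= GammaE x.
Proof. by apply: integral_ge0 => t _; rewrite lee_fin mulr_ge0// ?powR_ge0 ?expR_ge0. Qed.

(** Integrate x s^(x-1) e^(-t) over 0 < s <= t in both orders: integrating in s first leaves t^x
    e^(-t), integrating in t first leaves x s^(x-1) e^(-s). *)
Lemma GammaE_S (x : R) : (0 < x)%R -> GammaE (x + 1) = x%:E * GammaE x.
Proof.
move=> x0; pose A : set (measurableTypeR R * measurableTypeR R) := [set p | 0 < p.2 <= p.1]%R.
have mA : measurable A.
  rewrite (_ : A = (fun p => p.2) @^-1` `]0%R, +oo[%classic `&`
      (fun p => p.1 - p.2)%R @^-1` `[0%R, +oo[%classic); last first.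
    apply/seteqP; split=> p; rewrite /A/= !in_itv/= !andbT subr_ge0.
      by move=> /andP[].
    by move=> [-> ->].
  apply: measurableI; rewrite -[X in measurable X]setTI.
    by apply: measurable_snd => //; exact: measurable_itv.
  have mB : measurable_fun [set: measurableTypeR R * measurableTypeR R] (fun p => p.1 - p.2)%R.
    by apply: measurable_funB; [exact: measurable_fst|exact: measurable_snd].
  by apply: mB => //; exact: measurable_itv.
have mw : measurable_fun [set: measurableTypeR R] (fun s : R => x * s `^ (x - 1))%R.
  by apply: measurable_funM => //; exact: measurable_powR.
have := tonelli_section mu mu mA measurable_expRN mw (fun t => expR_ge0 (- t))%R _.
have w0 (s : R) : (0 <= x * s `^ (x - 1))%R by rewrite mulr_ge0 ?powR_ge0// ltW.
move=> /(_ w0) E.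
transitivity (\int[mu]_t ((expR (- t))%:E * \int[mu]_(s in [set s | A (t, s)]) (x * s `^ (x - 1))%:E)).
  rewrite /GammaE integral_mkcond; apply: eq_integral => t _.
  rewrite patchE mem_setE in_itv/= andbT addrK.
  case: ifPn => [t0|]; last first.
    rewrite -leNgt => t0; rewrite (_ : [set s | _] = set0) ?integral_set0 ?mule0//.
    by rewrite -subset0 => s/= /andP[s0 st]; have := lt_le_trans s0 (le_trans st t0); rewrite ltxx.
  rewrite (_ : [set s | _] = `]0%R, t]%classic).
    by rewrite integral_powR_oc// muleC.
  by apply/seteqP; split => s; rewrite /= in_itv.
pose D : set (measurableTypeR R) := `]0%R, +oo[%classic.
have mg : measurable_fun D (fun t : measurableTypeR R => (t `^ (x - 1) * expR (- t))%:E).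
  apply/measurable_EFinP; apply: measurable_funM; apply: measurable_funTS.
    exact: measurable_powR.
  exact: measurable_expRN.
have g0 (t : R) : D t -> 0 <= (t `^ (x - 1) * expR (- t))%:E.
  by move=> _; rewrite lee_fin mulr_ge0// ?powR_ge0 ?expR_ge0.
have mitv : measurable D by exact: measurable_itv.
have := ge0_integralZl_EFin mu mitv g0 mg (ltW x0).
rewrite E /GammaE => <-.
rewrite [RHS]integral_mkcond; apply: eq_integral => s _.
rewrite patchE mem_setE in_itv/= andbT; case: ifPn => [s0|].
  rewrite (_ : [set t | _] = `[s, +oo[%classic); last first.
    by apply/seteqP; split => t; rewrite /A/= in_itv/= s0 andbT.
  by rewrite integral_expRN -!EFinM mulrA.
rewrite -leNgt => s0; rewrite (_ : [set t | _] = set0) ?integral_set0 ?mule0//.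
by rewrite -subset0 => t/= /andP[]; rewrite ltNge s0.
Qed.

End gamma.

(** * Polar coordinates by Tonelli's theorem *)

Section polar.
Context {R : realType} {n : nat}.
Implicit Types (x : 'rV[R]_n) (F : 'rV[R]_n -> R).
Local Notation mu := (@lebesgue_measure R).
Local Notation lam := (@lebesgue_rV R n).
Local Notation PB := (@punctured_ball R n).

Lemma enormZ (t : R) x : 0 <= t -> enorm (t *: x) = t * enorm x.
Proof.
move=> t0; rewrite /enorm; under eq_bigr do rewrite mxE exprMn.
by rewrite -mulr_sumr sqrtrM ?sqr_ge0// sqrtr_sqr ger0_norm.
Qed.

Lemma enorm_eq0 x : (enorm x == 0) = (x == 0).
Proof.
apply/idP/eqP => [|->]; last first.
  by rewrite /enorm big1 ?sqrtr0// => i _; rewrite mxE expr0n.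
rewrite sqrtr_eq0 => x0; have /eqP : \sum_i x ord0 i ^+ 2 = 0.
  by apply/eqP; rewrite eq_le x0 sumr_ge0// => i _; exact: sqr_ge0.
rewrite psumr_eq0 => [/allP h|i _]; last exact: sqr_ge0.
by apply/rowP => i; rewrite mxE; apply/eqP; have := h i (mem_index_enum _); rewrite sqrf_eq0.
Qed.

Definition ball_between (t : R) : set 'rV[R]_n := [set x | 0 < enorm x <= t].

Lemma measurable_ball_between t : measurable (ball_between t).
Proof.
rewrite (_ : ball_between t = enorm @^-1` `]0, t]%classic).
  rewrite -[X in measurable X]setTI; exact: measurable_enorm.
by apply/seteqP; split => x /=; rewrite in_itv.
Qed.

Definition homogeneous_fun (a : R) F := forall t x, 0 < t -> F (t *: x) = t `^ a * F x.

Local Open Scope ereal_scope.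

(** Scaling by [t] contributes t^n from the measure and t^a from [F]. *)
Lemma integral_ball_between F (a t : R) : (0 < t)%R -> homogeneous_fun a F ->
  measurable_fun setT F -> (forall x, 0 <= F x)%R ->
  \int[lam]_(x in ball_between t) (F x)%:E =
  (t `^ (n%:R + a))%:E * \int[lam]_(x in PB) (F x)%:E.
Proof.
move=> t0 hF mF F0; rewrite integral_mkcond.
set g := _ \_ _.
have mEF : measurable_fun setT (EFin \o F) by apply/measurable_EFinP.
have mg : measurable_fun setT g.
  apply/(measurable_restrictT (EFin \o F) (measurable_ball_between t)).
  exact: measurable_funS mEF.
have g0 x : 0 <= g x by rewrite /g patchE; case: ifPn => // _; rewrite lee_fin.
have gt x : g (t *: x)%R = (t `^ a)%:E * ((EFin \o F) \_ PB) x.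
  rewrite /g !patchE (_ : (t *: x)%R \in ball_between t = (x \in PB)).
    by case: ifPn => _; rewrite ?mule0//= hF// EFinM.
  by rewrite /ball_between /punctured_ball !mem_setE /in_mem/= enormZ ?(ltW t0)// pmulr_rgt0// ger_pMr.
have := ge0_integral_scale t0 mg g0.
have -> : \int[lam]_x g (t *: x)%R = \int[lam]_x ((t `^ a)%:E * ((EFin \o F) \_ PB) x).
  by apply: eq_integral => x _; exact: gt.
have mP : measurable_fun setT ((EFin \o F) \_ PB).
  apply/(measurable_restrictT (EFin \o F) (@measurable_punctured_ball R n)).
  exact: measurable_funS mEF.
have P0 x : setT x -> 0 <= ((EFin \o F) \_ PB) x.
  by move=> _; rewrite patchE; case: ifPn => // _; rewrite lee_fin.
rewrite (ge0_integralZl_EFin lam measurableT P0 mP (powR_ge0 t a)) -integral_mkcond.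
have tn0 : (t ^+ n != 0)%R by rewrite expf_neq0 ?gt_eqF.
move=> /(congr1 (fun z => (t ^+ n)%:E * z)); rewrite !muleA -!EFinM.
rewrite [(_ * t^-1 ^+ n)%R](_ : _ = 1%R) ?mul1e; last by rewrite exprVn mulfV.
by move=> <-; rewrite powRD ?powR_mulrn ?(ltW t0)// (gt_eqF t0) implybT.
Qed.

(* Both sides integrate F(x) w(t) over the region 0 < |x| <= rho(t). Suitable
   choices of rho and w replace integration in polar coordinates. *)
Lemma polar_tonelli F (a : R) (rho w : R -> R) : homogeneous_fun a F ->
  measurable_fun setT F -> (forall x, 0 <= F x)%R ->
  measurable_fun setT rho -> measurable_fun setT w -> (forall t, 0 <= w t)%R ->
  \int[lam]_x ((F x)%:E * \int[mu]_(t in [set t | 0 < enorm x <= rho t]%R) (w t)%:E) =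
  (\int[mu]_(t in [set t | 0 < rho t]%R) (w t * rho t `^ (n%:R + a))%:E) *
  \int[lam]_(x in PB) (F x)%:E.
Proof.
move=> hF mF F0 mrho mw w0.
pose A : set ('rV[R]_n * measurableTypeR R) := [set p | 0 < enorm p.1 <= rho p.2]%R.
have me : measurable_fun [set: 'rV[R]_n * measurableTypeR R] (fun p => enorm p.1).
  by apply: measurableT_comp; [exact: measurable_enorm|exact: measurable_fst].
have mr : measurable_fun [set: 'rV[R]_n * measurableTypeR R] (fun p => rho p.2).
  by apply: measurableT_comp; [exact: mrho|exact: measurable_snd].
have mA : measurable A.
  rewrite (_ : A = (fun p => enorm p.1) @^-1` `]0%R, +oo[%classic `&`
      (fun p => rho p.2 - enorm p.1)%R @^-1` `[0%R, +oo[%classic); last first.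
    apply/seteqP; split=> p; rewrite /A/= !in_itv/= !andbT subr_ge0.
      by move=> /andP[].
    by move=> [-> ->].
  apply: measurableI; rewrite -[X in measurable X]setTI.
    by apply: me => //; exact: measurable_itv.
  have mB := measurable_funB mr me.
  by apply: mB => //; exact: measurable_itv.
have := tonelli_section lam mu mA mF mw F0 w0; rewrite {1}/A/= => ->.
pose D : set (measurableTypeR R) := [set t | 0 < rho t]%R.
have mD : measurable D.
  rewrite (_ : D = setT `&` rho @^-1` `]0%R, +oo[%classic); last first.
    by apply/seteqP; split=> t; rewrite /D/= in_itv/= andbT => // -[].
  by apply: mrho => //; exact: measurable_itv.
have mg : measurable_fun D (fun t => (w t * rho t `^ (n%:R + a))%:E).
  apply/measurable_EFinP; apply: measurable_funM; apply: measurable_funTS; first exact: mw.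
  by apply: (measurableT_comp (measurable_powR _) mrho).
have g0 t : D t -> 0 <= (w t * rho t `^ (n%:R + a))%:E.
  by move=> _; rewrite lee_fin mulr_ge0// powR_ge0.
have PB0 : 0 <= \int[lam]_(x in PB) (F x)%:E.
  by apply: integral_ge0 => x _; rewrite lee_fin.
have := ge0_integralZr mu mD mg g0 PB0.
move=> <-.
rewrite [RHS]integral_mkcond; apply: eq_integral => t _; rewrite patchE.
case: ifPn => [/set_mem/= rt|/negP rt].
  by rewrite [X in _ * X](@integral_ball_between F a (rho t))// EFinM muleA.
rewrite (_ : [set x | A (x, t)] = set0) ?integral_set0 ?mule0//.
rewrite -subset0 => x; rewrite /A/= => /andP[x0 xr].
by apply/rt/mem_set/(lt_le_trans x0).
Qed.

End polar.

Section sphere_polar.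
Context {R : realType} {n : nat}.
Implicit Types (x : 'rV[R]_n) (F : 'rV[R]_n -> R).
Local Notation mu := (@lebesgue_measure R).
Local Notation lam := (@lebesgue_rV R n).
Local Notation PB := (@punctured_ball R n).
Local Open Scope ereal_scope.

Lemma direction_homogeneous F (a : R) x : homogeneous_fun a F -> (0 < enorm x)%R ->
  F (direction x) = (enorm x `^ (- a) * F x)%R.
Proof.
by move=> hF x0; rewrite /direction hF ?invr_gt0// -powR_inv1 ?ltW// -powRrM mulN1r.
Qed.

(** On the punctured ball F(x/|x|) = |x|^(-a) F(x), and |x|^(-a) - 1 is the integral of w(t) = a
    t^(-a-1) from |x| to 1. So [polar_tonelli] applies to the excess over F(x), with rho(t) = t cut
    off at t = 1, and its radial integral of a t^(n-1) over ]0, 1] is a/n. *)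
Lemma integral_direction F (a : R) : (0 < n)%N -> (0 <= a)%R -> homogeneous_fun a F ->
  measurable_fun setT F -> (forall x, 0 <= F x)%R ->
  \int[lam]_(x in PB) (F (direction x))%:E =
  ((n%:R + a) / n%:R)%:E * \int[lam]_(x in PB) (F x)%:E.
Proof.
move=> n0 a0 hF mF F0.
pose rho (t : R) : R := (t * \1_(`]-oo, 1%R]%classic : set R) t)%R.
pose w (t : R) : R := (a * t `^ (- a - 1))%R.
have mrho : measurable_fun setT rho.
  by apply: measurable_funM => //; apply: measurable_indic; exact: measurable_itv.
have mw : measurable_fun setT w by apply: measurable_funM => //; exact: measurable_powR.
have w0 t : (0 <= w t)%R by rewrite mulr_ge0// powR_ge0.
have rhoE t : rho t = if (t <= 1)%R then t else 0%R.
  rewrite /rho indicE mem_setE in_itv/=; case: ifPn => _; rewrite ?mulr1 ?mulr0//.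
have n0R : (n%:R != 0 :> R)%R by rewrite pnatr_eq0 -lt0n.
have := polar_tonelli hF mF F0 mrho mw w0.
rewrite (_ : \int[mu]_(t in _) _ = (a / n%:R)%:E); last first.
  rewrite (_ : [set t | _] = `]0%R, 1%R]%classic); last first.
    apply/seteqP; split=> t; rewrite /= rhoE in_itv/=.
      by case: ifPn => [_ ->//|_]; rewrite ltxx.
    by move=> /andP[t0 t1]; rewrite t1.
  transitivity (\int[mu]_(t in `]0%R, 1%R]) (a / n%:R * (n%:R * t `^ (n%:R - 1)))%:E).
    apply: eq_integral => t /set_mem/=; rewrite in_itv/= => /andP[t0 t1].
    rewrite rhoE t1 /w -mulrA -powRD ?(gt_eqF t0) ?implybT//.
    rewrite mulrA mulfVK//; congr (_ * _ `^ _)%:E; ring.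
  have := @integral_powR_oc R n%:R 1 _ ltr01; rewrite ltr0n => /(_ n0) E.
  pose D : set (measurableTypeR R) := `]0%R, 1%R]%classic.
  have mD : measurable D by exact: measurable_itv.
  have mg : measurable_fun D (fun t : measurableTypeR R => (n%:R * t `^ (n%:R - 1))%:E).
    apply/measurable_EFinP; apply: measurable_funM => //; apply: measurable_funTS.
    exact: measurable_powR.
  have g0 (t : R) : D t -> 0 <= (n%:R * t `^ (n%:R - 1))%:E.
    by move=> _; rewrite lee_fin mulr_ge0// powR_ge0.
  have an0 : (0 <= a / n%:R)%R by rewrite divr_ge0.
  have := ge0_integralZl_EFin mu mD g0 mg an0.
  under eq_integral do rewrite -EFinM.
  by rewrite E powR1 mule1.
move=> E.
have PBE x : x \in PB -> (0 < enorm x <= 1)%R by move=> /set_mem.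
transitivity (\int[lam]_(x in PB) ((F x)%:E + (F x * (enorm x `^ (- a) - 1))%:E)).
  apply: eq_integral => x /PBE/andP[x0 x1].
  by rewrite (direction_homogeneous hF x0) -EFinD; congr EFin; ring.
have mPB := @measurable_punctured_ball R n.
have mF' : measurable_fun PB (EFin \o F).
  by apply/measurable_EFinP; exact: measurable_funTS.
have F0' x : PB x -> 0 <= (EFin \o F) x by move=> _; rewrite lee_fin.
have mG : measurable_fun PB (fun x => (F x * (enorm x `^ (- a) - 1))%:E).
  apply/measurable_EFinP; apply: measurable_funTS; apply: measurable_funM => //.
  apply: measurable_funB => //.
  by apply: (measurableT_comp (measurable_powR _)); exact: measurable_enorm.
have G0 x : PB x -> 0 <= (F x * (enorm x `^ (- a) - 1))%:E.
  move=> /andP[x0 x1]; rewrite lee_fin mulr_ge0// subr_ge0 powRN.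
  rewrite invf_ge1 ?powR_gt0//.
  by rewrite -[leRHS](congr1 (@^~ a) (powR1 R)) ge0_ler_powR// nnegrE ltW.
have -> := ge0_integralD lam mPB F0' mF' G0 mG.
transitivity (\int[lam]_(x in PB) (F x)%:E + (a / n%:R)%:E * \int[lam]_(x in PB) (F x)%:E).
  congr (_ + _); rewrite -E integral_mkcond; apply: eq_integral => x _.
  rewrite patchE; case: ifPn => [/PBE/andP[x0 x1]|/negP xPB].
    rewrite (_ : [set t | _] = `[enorm x, 1%R]%classic); last first.
      apply/seteqP; split=> t; rewrite /= rhoE in_itv/= x0/=.
        by case: ifPn => _; [rewrite andbT|rewrite leNgt x0].
      by move=> /andP[? ->].
    have := @integral_powR_segment R (-1) (- a) _ _ x0 x1.
    rewrite mulN1r opprK => ->; rewrite powR1 -EFinM; congr EFin; ring.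
  rewrite (_ : [set t | _] = set0) ?integral_set0 ?mule0//.
  rewrite -subset0 => t/=; rewrite rhoE => /andP[x0]; case: ifPn => [t1 xt|_].
    by apply/xPB/mem_set; rewrite /punctured_ball/= x0 (le_trans xt).
  by rewrite leNgt x0.
rewrite -[X in X + _]mul1e -ge0_muleDl ?lee_fin ?divr_ge0//. 
by rewrite -EFinD; congr (_%:E * _); field.
Qed.

Lemma integral_sphere_measure (G : 'rV[R]_n -> R) : measurable_fun setT G ->
  (forall x, 0 <= G x)%R ->
  \int[sphere_measure]_(x in sphere) (G x)%:E =
  n%:R%:E * \int[lam]_(x in PB) (G (direction x))%:E.
Proof.
move=> mG G0.
have mPB := @measurable_punctured_ball R n.
have md := @measurable_direction R n.
have n0 : (0 <= n%:R :> R)%R by [].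
(* Sending the complement of the punctured ball to 0, which is not on the sphere, makes the preimage
   of a subset of the sphere lie in the punctured ball. On such subsets the surface measure is thus
   [n] times an image of Lebesgue measure. *)
pose dir x := (\1_PB x *: direction x)%R.
have mdir : measurable_fun setT dir.
  apply: measurable_fun_coordP => i; under eq_fun do rewrite mxE.
  apply: measurable_funM; first exact: measurable_indic.
  by apply: (measurableT_comp (measurable_coord i)); exact: measurable_direction.
have dirE A : A `<=` @sphere R n -> dir @^-1` A = PB `&` direction @^-1` A.
  move=> AS; apply/seteqP; split=> x; rewrite /dir/= indicE.
    have [xPB|xPB] := boolP (x \in PB); first by rewrite scale1r => ?; split=> //; exact: set_mem.
    rewrite scale0r => /AS e1; have := @enorm_eq0 R n 0; rewrite eqxx => /eqP e0.
    by move: e1; rewrite /sphere/= e0 => /esym/eqP; rewrite oner_eq0.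
  by move=> [/mem_set -> ?]; rewrite scale1r.
have dirS : dir @^-1` (@sphere R n) = PB.
  rewrite dirE//; apply/setIidl => x /andP[x0 _]; rewrite /sphere/= /direction.
  by rewrite enormZ ?invr_ge0 ?enorm_ge0// mulVf// gt_eqF.
have msph : measurable (@sphere R n).
  rewrite (_ : sphere = setT `&` enorm @^-1` [set 1%R]); last by rewrite setTI.
  by apply: measurable_enorm => //; exact: measurable_set1.
have mEG : measurable_fun (@sphere R n) (EFin \o G).
  by apply/measurable_EFinP; exact: measurable_funTS.
have EG0 x : sphere x -> 0 <= (EFin \o G) x by move=> _; rewrite lee_fin.
rewrite (eq_measure_integral (mscale (NngNum n0) (pushforward lam dir))); last first.
  move=> A mA AS; by transitivity (n%:R%:E * lam (dir @^-1` A)); first by rewrite (dirE A AS).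
have := ge0_integral_mscale (pushforward lam dir) msph (NngNum n0) mEG EG0.
move=> ->; congr (_ * _).
have := ge0_integral_pushforward mdir lam msph mEG _.
move=> ->; last by move=> x _; rewrite lee_fin.
rewrite dirS; apply: eq_integral => x xPB /=.
by rewrite /dir indicE xPB scale1r.
Qed.

(** [polar_tonelli] with rho(t) = sqrt t and w(t) = e^(-t): the region is t >= |x|^2, over which [w]
    integrates to e^(-|x|^2), while the other order gives the integral of e^(-t) t^((n+a)/2). *)
Lemma integral_gaussian_punctured F (a : R) : homogeneous_fun a F ->
  measurable_fun setT F -> (forall x, 0 <= F x)%R ->
  \int[lam]_(x in [set x | 0 < enorm x]%R) (F x * expR (- enorm x ^+ 2))%:E =
  GammaE ((n%:R + a) / 2 + 1) * \int[lam]_(x in PB) (F x)%:E.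
Proof.
move=> hF mF F0.
have msq : measurable_fun setT (@Num.sqrt R).
  by apply: continuous_measurable_fun; exact: sqrt_continuous.
have := polar_tonelli hF mF F0 msq (@measurable_expRN R) (fun t => expR_ge0 (- t))%R.
rewrite (_ : \int[mu]_(t in _) _ = GammaE ((n%:R + a) / 2 + 1)); last first.
  rewrite /GammaE (_ : [set t | _] = `]0%R, +oo[%classic); last first.
    by apply/seteqP; split=> t; rewrite /= in_itv/= sqrtr_gt0 andbT.
  apply: eq_integral => t /set_mem/=; rewrite in_itv/= andbT => t0.
  by rewrite mulrC addrK -powR12_sqrt ?(ltW t0)// -powRrM [(2^-1 * _)%R]mulrC.
move=> <-; rewrite integral_mkcond; apply: eq_integral => x _; rewrite patchE.
case: ifPn => [/set_mem/= x0|/negP x0].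
  rewrite (_ : [set t | _] = `[(enorm x ^+ 2)%R, +oo[%classic).
    by rewrite integral_expRN -EFinM.
  apply/seteqP; split=> t; rewrite /= in_itv/= x0 andbT /=.
    move=> xt; have t0 : (0 < Num.sqrt t)%R by exact: lt_le_trans xt.
    rewrite sqrtr_gt0 in t0; rewrite -(sqr_sqrtr (ltW t0)).
    by rewrite ler_pXn2r// nnegrE ?sqrtr_ge0// ltW.
  by move=> /ler_wsqrtr; rewrite sqrtr_sqr ger0_norm// ltW.
rewrite (_ : [set t | _] = set0) ?integral_set0 ?mule0//.
by rewrite -subset0 => t/= /andP[x0' _]; apply/x0/mem_set.
Qed.

End sphere_polar.

Section sphere_gaussian.
Context {R : realType} {n : nat}.
Implicit Types (x : 'rV[R]_n.+1) (F : 'rV[R]_n.+1 -> R).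
Local Notation mu := (@lebesgue_measure R).
Local Notation lam := (@lebesgue_rV R n.+1).
Local Notation PB := (@punctured_ball R n.+1).
Local Open Scope ereal_scope.

(** Used to see that the origin is negligible, which holds in positive dimension: in dimension 0 the
    measure is the Dirac mass there. *)
Lemma lebesgue_rV_hyperplane : lam [set x | x ord0 ord0 = 0%R] = 0.
Proof.
have E : @rV_cons R n @^-1` [set x | x ord0 ord0 = 0%R] = [set 0%R : measurableTypeR R] `*` setT.
  by apply/seteqP; split => -[u v] /=; rewrite rV_cons0//= => -[].
transitivity ((@lebesgue_measure R \x lebesgue_rV n) ([set 0%R : measurableTypeR R] `*` setT)).
  by rewrite -E.
have m0 : measurable ([set 0%R] : set (measurableTypeR R)) by exact: measurable_set1.
rewrite [LHS](product_measure1E _ _ m0 measurableT).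
by rewrite [X in X * _](@lebesgue_measure_set1 R) mul0e.
Qed.

Lemma integral_gaussian F (a : R) : homogeneous_fun a F ->
  measurable_fun setT F -> (forall x, 0 <= F x)%R ->
  \int[lam]_x (F x * expR (- enorm x ^+ 2))%:E =
  GammaE ((n.+1%:R + a) / 2 + 1) * \int[lam]_(x in PB) (F x)%:E.
Proof.
move=> hF mF F0; rewrite -integral_gaussian_punctured//.
have me := @measurable_enorm R n.+1.
pose N : set 'rV[R]_n.+1 := [set x | enorm x = 0%R].
have mN : measurable N.
  rewrite (_ : N = setT `&` enorm @^-1` [set 0%R]); last by rewrite setTI.
  by apply: me => //; exact: measurable_set1.
have mH : measurable [set x : 'rV[R]_n.+1 | x ord0 ord0 = 0%R].
  have mc := @measurable_coord R n.+1 ord0.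
  rewrite (_ : [set x | _] = setT `&` (fun x : 'rV[R]_n.+1 => x ord0 ord0) @^-1` [set 0%R]).
    by apply: mc => //; exact: measurable_set1.
  by rewrite setTI.
have N0 : lam N = 0.
  apply/eqP; rewrite eq_le measure_ge0 andbT -lebesgue_rV_hyperplane.
  apply: le_measure; rewrite ?inE// => x; rewrite /N/= => /eqP.
  by rewrite enorm_eq0 => /eqP ->; rewrite mxE.
have mg : measurable_fun setT (fun x => (F x * expR (- enorm x ^+ 2))%:E).
  apply/measurable_EFinP; apply: measurable_funM => //.
  apply: (measurableT_comp (@measurable_expRN R)); exact: measurable_funX.
have g0 x : setT x -> 0 <= (F x * expR (- enorm x ^+ 2))%:E.
  by move=> _; rewrite lee_fin mulr_ge0 ?expR_ge0.
have := ge0_negligible_integral mN measurableT mg g0 N0.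
move=> ->; congr integral; apply/seteqP; split=> x; rewrite /N/=.
  by move=> [_ /eqP]; rewrite lt_def enorm_ge0 andbT.
by rewrite lt_def => /andP[/eqP].
Qed.

(** The polar formula for a Gaussian weight: the factor Gamma((d + a)/2) / 2 is the radial integral
    of r^(d+a-1) e^(-r^2). *)
Lemma integral_sphere_gaussian F (a : R) : (0 <= a)%R -> homogeneous_fun a F ->
  measurable_fun setT F -> (forall x, 0 <= F x)%R ->
  \int[lam]_x (F x * expR (- enorm x ^+ 2))%:E =
  (2^-1)%:E * GammaE ((n.+1%:R + a) / 2) * \int[sphere_measure]_(x in sphere) (F x)%:E.
Proof.
move=> a0 hF mF F0; rewrite (integral_gaussian hF)// integral_sphere_measure//.
rewrite (integral_direction _ a0 hF)//.
have na0 : (0 < n.+1%:R + a)%R by rewrite ltr_wpDr.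
rewrite GammaE_S ?divr_gt0// !muleA; congr (_ * _).
rewrite -[in RHS]muleA -[in RHS]muleA [in RHS]muleC.
rewrite -EFinM -muleA -EFinM [LHS]muleC; congr (_ * _%:E); field.
by rewrite nat1r pnatr_eq0.
Qed.

End sphere_gaussian.

(** * Gaussian integrals and moments of the sphere *)

Section has_integral.
Local Open Scope ereal_scope.

(** Integrability is kept together with the value, because linearity and Fubini's theorem require it
    for functions of varying sign. *)
Definition has_integral d (T : measurableType d) (R : realType)
    (m : {measure set T -> \bar R}) (D : set T) (f : T -> R) (v : R) : Prop :=
  m.-integrable D (EFin \o f) /\ \int[m]_(x in D) (f x)%:E = v%:E.

Lemma has_integral_prod d1 d2 (T1 : measurableType d1) (T2 : measurableType d2) (R : realType)
    (m1 : {sigma_finite_measure set T1 -> \bar R})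
    (m2 : {sigma_finite_measure set T2 -> \bar R}) (f : T1 -> R) (g : T2 -> R) (u v : R) :
  has_integral m1 setT f u -> has_integral m2 setT g v ->
  has_integral (m1 \x m2) setT (fun p => f p.1 * g p.2)%R (u * v).
Proof.
move=> [intf fu] [intg gv].
have mf : measurable_fun setT f by apply/measurable_EFinP; exact: measurable_int intf.
have mg : measurable_fun setT g by apply/measurable_EFinP; exact: measurable_int intg.
have mfg : measurable_fun setT (EFin \o (fun p : T1 * T2 => f p.1 * g p.2)%R).
  apply/measurable_EFinP; apply: measurable_funM.
    by apply: (measurableT_comp mf); exact: measurable_fst.
  by apply: (measurableT_comp mg); exact: measurable_snd.
have /integrableP[_ fy] := intf.
have /integrableP[_ gy] := intg.
have g_fin : \int[m2]_y `|(g y)%:E| \is a fin_num.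
  by rewrite ge0_fin_numE// integral_ge0.
have intfg : (m1 \x m2).-integrable setT (EFin \o (fun p : T1 * T2 => f p.1 * g p.2)%R).
  apply: (integrable12ltyP _ _ mfg).2.
  rewrite (_ : \int[m1]_x _ = \int[m1]_x ((fine (\int[m2]_y `|(g y)%:E|))%:E * `|(f x)%:E|)).
    have maf : measurable_fun setT (fun x => `|(f x)%:E|).
      by apply: measurableT_comp => //; exact/measurable_EFinP.
    have k0 : (0 <= fine (\int[m2]_y `|(g y)%:E|))%R by rewrite fine_ge0// integral_ge0.
    have := ge0_integralZl_EFin m1 measurableT (fun x _ => abse_ge0 (f x)%:E) maf k0.
    by move=> ->; apply: lte_mul_pinfty => //; rewrite lee_fin.
  apply: eq_integral => x _; rewrite fineK// muleC.
  transitivity (\int[m2]_y (`|f x|%:E * `|(g y)%:E|)).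
    by apply: eq_integral => y _ /=; rewrite normrM EFinM.
  have mag : measurable_fun setT (fun y => `|(g y)%:E|).
    by apply: measurableT_comp => //; exact/measurable_EFinP.
  by have := ge0_integralZl_EFin m2 measurableT (fun y _ => abse_ge0 (g y)%:E) mag (normr_ge0 (f x)).
split => //; rewrite -(integral12_prod_meas1 intfg) /fubini_F.
transitivity (\int[m1]_x (v%:E * (f x)%:E)); last first.
  by rewrite integralZl// fu -EFinM mulrC.
apply: eq_integral => x _.
have := integralZl measurableT intg (f x).
by rewrite gv muleC => <-.
Qed.

Context {R : realType}.
Local Notation mu := (@lebesgue_measure R).

Lemma has_integral_rVS n (f : R -> R) (g : 'rV[R]_n -> R) (u v : R) :
  has_integral mu setT f u -> has_integral (lebesgue_rV n) setT g v ->
  has_integral (lebesgue_rV n.+1) setT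
    (fun x => f (x ord0 ord0) * g (\row_i x ord0 (lift ord0 i)))%R (u * v).
Proof.
move=> intf intg.
set h := (fun x : 'rV[R]_n.+1 => _).
have [intfg E] := has_integral_prod intf intg.
have mf : measurable_fun setT f by apply/measurable_EFinP; exact: measurable_int intf.1.
have mg : measurable_fun setT g by apply/measurable_EFinP; exact: measurable_int intg.1.
have mh : measurable_fun setT (EFin \o h).
  apply/measurable_EFinP; apply: measurable_funM.
    by apply: (measurableT_comp mf); exact: measurable_coord.
  apply: (measurableT_comp mg); apply: measurable_fun_coordP => i.
  by under eq_fun do rewrite mxE; exact: measurable_coord.
have hE : (EFin \o h) \o @rV_cons R n = EFin \o (fun p => f p.1 * g p.2)%R.
  apply/funext => -[x y]; rewrite /h /= rV_cons0/=; congr (_ * g _)%:E.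
  by apply/rowP => i; rewrite mxE rV_consS.
have mc := @measurable_rV_cons R n.
have intc : (mu \x lebesgue_rV n).-integrable (@rV_cons R n @^-1` setT)
    ((EFin \o h) \o @rV_cons R n).
  by rewrite hE preimage_setT.
split.
  exact: (integrable_pushforward mc mh intc).
have := integral_pushforward mc mh intc measurableT.
rewrite hE preimage_setT => Ep.
by rewrite [LHS]Ep.
Qed.

Lemma has_integral_rV0 : has_integral (@lebesgue_rV R 0) setT (cst 1%R) 1%R.
Proof.
split.
  apply/integrableP; split; first by apply/measurable_EFinP; exact: measurable_cst.
  by rewrite integral_dirac//= diracE in_setT mul1e normr1 ltry.
by rewrite integral_dirac//= diracE in_setT mul1e.
Qed.

Lemma has_integral_rV n (f : 'I_n -> R -> R) (v : 'I_n -> R) :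
  (forall i, has_integral mu setT (f i) (v i)) ->
  has_integral (lebesgue_rV n) setT (fun x => \prod_i f i (x ord0 i))%R (\prod_i v i).
Proof.
elim: n f v => [|n IH] f v fv.
  rewrite big_ord0; have := has_integral_rV0.
  by rewrite (_ : cst 1%R = fun x : 'rV[R]_0 => \prod_i f i (x ord0 i))%R//; apply/funext => x; rewrite big_ord0.
have := has_integral_rVS (fv ord0) (IH _ _ (fun i => fv (lift ord0 i))).
rewrite big_ord_recl; congr has_integral; apply/funext => x.
by rewrite big_ord_recl; congr (_ * _)%R; apply: eq_bigr => i _; rewrite mxE.
Qed.

End has_integral.

(** * Gaussian moments on the line *)

Section gaussian_moments.
Context {R : realType}.
Local Notation mu := (@lebesgue_measure R).
Local Open Scope ereal_scope.

Definition abs_moment (k : nat) : \bar R :=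
  \int[mu]_x (`|x| ^+ k * expR (- x ^+ 2))%:E.

Lemma enorm_sqr n (x : 'rV[R]_n) : (enorm x ^+ 2 = \sum_i x ord0 i ^+ 2)%R.
Proof. by rewrite sqr_sqrtr// sumr_ge0// => i _; exact: sqr_ge0. Qed.

(* The one-dimensional case of the polar formula: the recursion for Gaussian
   moments thus follows from that of Gamma. *)
Lemma abs_momentE k : abs_moment k =
  (2^-1)%:E * GammaE ((1 + k%:R) / 2) *
  \int[@sphere_measure R 1]_(x in sphere) 1%:E.
Proof.
pose F (x : 'rV[R]_1) : R := (`|x ord0 ord0| ^+ k)%R.
have hF : homogeneous_fun k%:R F.
  by move=> t x t0; rewrite /F mxE normrM exprMn powR_mulrn ?(ltW t0)// (gtr0_norm t0).
have mF : measurable_fun setT F.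
  apply: measurable_funX; apply: (measurableT_comp (@normr_measurable R _)).
  exact: measurable_coord.
have F0 x : (0 <= F x)%R by exact: exprn_ge0.
have mG : measurable_fun setT (fun x : 'rV[R]_1 => (F x * expR (- enorm x ^+ 2))%:E).
  apply/measurable_EFinP; apply: measurable_funM => //.
  apply: (measurableT_comp (@measurable_expRN R)).
  by apply: measurable_funX; exact: measurable_enorm.
have G0 x : 0 <= (F x * expR (- enorm x ^+ 2))%:E.
  by rewrite lee_fin mulr_ge0 ?expR_ge0.
transitivity (\int[@lebesgue_rV R 1]_x (F x * expR (- enorm x ^+ 2))%:E).
  have := ge0_integral_lebesgue_rVS mG G0 => ->.
  apply: eq_integral => x _.
  transitivity (\int[@lebesgue_rV R 0]_y (cst (`|x| ^+ k * expR (- x ^+ 2))%:E) y).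
    by rewrite integral_dirac//= diracE in_setT mul1e.
  apply: eq_integral => y _ /=.
  by rewrite /F enorm_sqr rV_cons0/= big_ord_recl big_ord0 addr0 rV_cons0.
have := integral_sphere_gaussian (ler0n R k) hF mF F0.
move=> ->; congr (_ * _); apply: eq_integral => x /set_mem sx; congr EFin.
have : (`|x ord0 ord0| ^+ 2 = 1)%R.
  rewrite real_normK ?num_real// -[RHS](expr1n _ 2) -[in RHS]sx enorm_sqr.
  by rewrite big_ord_recl big_ord0 addr0.
by move/eqP; rewrite pexpr_eq1// => /eqP; rewrite /F => ->; rewrite expr1n.
Qed.

Lemma abs_moment0 : abs_moment 0 = (Num.sqrt pi)%:E.
Proof.
by rewrite -integralT_gauss; apply: eq_integral => x _; rewrite expr0 mul1r.
Qed.

Lemma GammaE1 : GammaE 1 = 1 :> \bar R.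
Proof.
rewrite /GammaE subrr.
transitivity (\int[mu]_(t in `]0%R, +oo[) (expR (- t))%:E).
  by apply: eq_integral => t _; rewrite powRr0 mul1r.
rewrite integral_itv_obnd_cbnd; last first.
  by apply/measurable_EFinP; apply: measurable_funTS; exact: measurable_expRN.
by rewrite integral_expRN oppr0 expR0.
Qed.

Lemma abs_moment_rec k : abs_moment k.+2 = ((k%:R + 1) / 2)%:E * abs_moment k.
Proof.
rewrite !abs_momentE (_ : (1 + k.+2%:R) / 2 = (1 + k%:R) / 2 + 1)%R; last first.
  by rewrite -addn2 natrD; field.
by rewrite GammaE_S ?divr_gt0// [(1 + k%:R)%R]addrC !muleA [_ * (2^-1)%:E]muleC.
Qed.

(** By [abs_momentE], half of Gamma(1/2) times this mass is sqrt pi. Both factors are nonnegative,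
    and an infinite mass would make the product 0 or infinite. *)
Lemma sphere_measure1_fin : \int[@sphere_measure R 1]_(x in sphere) 1%:E < +oo.
Proof.
have := abs_moment0; rewrite abs_momentE addr0 div1r.
have : 0 <= GammaE (2^-1) :> \bar R by exact: GammaE_ge0.
have spi : (Num.sqrt pi != 0 :> R)%R by rewrite gt_eqF// sqrtr_gt0 pi_gt0.
case: (\int[_]_(x in _) _) => [c| |]; rewrite ?ltry//.
case: (GammaE _) => [r| |] //.
  rewrite lee_fin le_eqVlt => /predU1P[<-|r0]; rewrite -EFinM mulry.
    by rewrite mulr0 sgr0 mul0e => -[] /esym/eqP; rewrite (negbTE spi).
  by rewrite gtr0_sg ?mulr_gt0 ?invr_gt0// mul1e.
by move=> _; rewrite mulry gtr0_sg ?invr_gt0// mul1e mulyy.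
Qed.

(** Induction on two consecutive moments; the first moment is half the mass of the two-point sphere,
    because Gamma(1) = 1. *)
Lemma abs_moment_fin k : abs_moment k < +oo.
Proof.
suff [] : abs_moment k < +oo /\ abs_moment k.+1 < +oo by [].
elim: k => [|k [IH1 IH2]].
  rewrite abs_moment0 ltry; split => //.
  rewrite abs_momentE (_ : (1 + 1) / 2 = 1)%R ?GammaE1 ?mule1; last by field.
  by apply: lte_mul_pinfty => //; exact: sphere_measure1_fin.
by split => //; rewrite abs_moment_rec; apply: lte_mul_pinfty => //; rewrite lee_fin divr_ge0 ?addr_ge0.
Qed.

(* The integral of x^k exp(-x^2) over the real line. *)
Fixpoint gauss_moment (k : nat) : R :=
  match k with
  | 0 => Num.sqrt pi
  | 1 => 0
  | k'.+2 => (k'%:R + 1) / 2 * gauss_moment k'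
  end.

Lemma gauss_moment_even k : ~~ odd k -> abs_moment k = (gauss_moment k)%:E.
Proof.
elim/ltn_ind: k => -[|[|k]] IH //= ok; first by rewrite abs_moment0.
by rewrite negbK in ok; rewrite abs_moment_rec IH// EFinM.
Qed.

Lemma gauss_moment_odd k : odd k -> gauss_moment k = 0%R.
Proof. by elim/ltn_ind: k => -[|[|k]] IH //= ok; rewrite negbK in ok; rewrite IH ?mulr0. Qed.

Lemma has_integral_gauss_moment k :
  has_integral mu setT (fun x : R => x ^+ k * expR (- x ^+ 2))%R (gauss_moment k).
Proof.
set f := (fun x : R => _).
have mf : measurable_fun setT f.
  apply: measurable_funM; first exact: measurable_funX.
  by apply: (measurableT_comp (@measurable_expRN R)); exact: measurable_funX.
have intf : mu.-integrable setT (EFin \o f).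
  apply/integrableP; split; first exact/measurable_EFinP.
  rewrite (le_lt_trans _ (abs_moment_fin k))// le_eqVlt; apply/orP; left; apply/eqP.
  by apply: eq_integral => x _ /=; rewrite normrM normrX (ger0_norm (expR_ge0 _)).
split=> //; have [ok|ok] := boolP (odd k); last first.
  rewrite -gauss_moment_even//; apply: eq_integral => x _; congr (_ * _)%:E.
  by rewrite -normrX ger0_norm// exprn_even_ge0.
rewrite gauss_moment_odd//.
(* For odd [k], the reflection x -> -x shows that the integral equals its opposite. *)
have mN : measurable_fun setT (-%R : measurableTypeR R -> measurableTypeR R) by [].
have fN : (EFin \o f) \o (-%R : measurableTypeR R -> measurableTypeR R) = (fun x => - (EFin \o f) x).
  apply/funext => x /=; rewrite /f sqrrN exprNn -signr_odd ok.
  by rewrite expr1 mulN1r mulNr EFinN.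
have intN : mu.-integrable ((-%R : measurableTypeR R -> measurableTypeR R) @^-1` setT) ((EFin \o f) \o -%R).
  by rewrite preimage_setT fN; exact: integrableN.
have mEf : measurable_fun setT (EFin \o f) by exact/measurable_EFinP.
have := integral_pushforward mN mEf intN measurableT.
rewrite fN preimage_setT.
rewrite [X in X = _ -> _](eq_measure_integral mu) => [|A mA _]; last exact: lebesgue_measureN.
rewrite integralN/=; last exact: integrable_add_def.
move=> E; have := integrable_fin_num measurableT intf; move: E.
change (\int[mu]_x (f x)%:E = - (\int[mu]_x (f x)%:E) ->
  \int[mu]_x (f x)%:E \is a fin_num -> \int[mu]_x (f x)%:E = 0).
move: (integral mu _ _) => [v| |]// [] /eqP; rewrite -subr_eq0 opprK -mulr2n mulrn_eq0/=.
by move/eqP ->.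
Qed.

End gaussian_moments.

(** * Moments of the surface measure *)

Section sphere_monomials.
Context {R : realType} {n : nat}.
Local Notation d := n.+1.
Local Notation lam := (@lebesgue_rV R d).
Local Open Scope ereal_scope.

(** Induction by steps of 2 with the recursion of Gamma, from Gamma(1) = 1 and from Gamma(1/2). The
    latter is finite and nonzero because its product with the mass of the two-point sphere is 2 sqrt
    pi. *)
Lemma GammaE_half m : (0 < m)%N -> exists2 r : R, (0 < r)%R & GammaE (m%:R / 2) = r%:E.
Proof.
elim/ltn_ind: m => -[|[|[|m]]] IH //= _.
- have := @abs_moment0 R; rewrite abs_momentE addr0.
  have spi : (0 < Num.sqrt pi :> R)%R by rewrite sqrtr_gt0 pi_gt0.
  have : 0 <= GammaE (1 / 2) :> \bar R by exact: GammaE_ge0.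
  have := @sphere_measure1_fin R.
  have : 0 <= \int[@sphere_measure R 1]_(x in sphere) 1%:E by apply: integral_ge0.
  case: (\int[_]_(x in _) _) => [c| |] //.
  case: (GammaE _) => [r| |] //; rewrite !lee_fin => c0 _.
    move=> r0 [E]; exists r => //; rewrite lt_neqAle r0 andbT.
    by apply: contraTneq spi => r0'; rewrite -E -r0' mulr0 mul0r ltxx.
  rewrite mulry gtr0_sg ?invr_gt0// mul1e muleC mulry => _.
  move: c0; rewrite le_eqVlt => /predU1P[<-|c0].
    by rewrite sgr0 mul0e => -[] E; move: spi; rewrite -E ltxx.
  by rewrite gtr0_sg// mul1e.
- by exists 1%R => //; rewrite divff ?pnatr_eq0// GammaE1.
- have [r r0 E] := IH m.+1 (leqnSn _) isT.
  exists (m.+1%:R / 2 * r)%R; first by rewrite !mulr_gt0 ?invr_gt0.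
  rewrite (_ : m.+3%:R / 2 = m.+1%:R / 2 + 1 :> R)%R; last first.
    by rewrite -[in LHS](addn2 m.+1) natrD; field.
  by rewrite GammaE_S ?divr_gt0// E.
Qed.

Lemma Gamma_half_gt0 m : (0 < m)%N -> (0 < Gamma (m%:R / 2) :> R)%R.
Proof. by move=> /GammaE_half[r r0 E]; rewrite GammaE_fine E. Qed.

Lemma GammaE_halfE m : (0 < m)%N -> GammaE (m%:R / 2) = (Gamma (m%:R / 2))%:E :> \bar R.
Proof. by move=> /GammaE_half[r r0 E]; rewrite GammaE_fine E. Qed.

Lemma Gamma_half_S m : (0 < m)%N ->
  Gamma (m%:R / 2 + 1) = (m%:R / 2 * Gamma (m%:R / 2) :> R)%R.
Proof.
by move=> m0; rewrite !GammaE_fine GammaE_S ?divr_gt0 ?ltr0n// GammaE_halfE.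
Qed.

Lemma has_integralB e (T : measurableType e) (m : {measure set T -> \bar R}) D
    (f g : T -> R) (u v : R) : measurable D ->
  has_integral m D f u -> has_integral m D g v ->
  has_integral m D (fun x => f x - g x)%R (u - v).
Proof.
move=> mD [intf fu] [intg gv]; split.
  by apply: (integrableB mD intf intg).
under eq_integral do rewrite EFinB.
by have := integralB mD intf intg; rewrite fu gv.
Qed.

Lemma measurable_sphere k : measurable (@sphere R k).
Proof.
rewrite (_ : sphere = setT `&` enorm @^-1` [set 1%R]); last by rewrite setTI.
by apply: measurable_enorm => //; exact: measurable_set1.
Qed.

Lemma has_integral_sphere_gaussian (j : nat) (F : 'rV[R]_d -> R) (u : R) :
  homogeneous_fun j%:R F -> measurable_fun setT F -> (forall x, 0 <= F x)%R ->
  has_integral lam setT (fun x => F x * expR (- enorm x ^+ 2))%R u ->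
  has_integral sphere_measure sphere F (2 / Gamma ((d + j)%:R / 2) * u).
Proof.
move=> hF mF F0 [_ hu].
have := integral_sphere_gaussian (ler0n R j) hF mF F0.
rewrite hu -natrD (@GammaE_halfE (d + j))// -EFinM => E.
have G0 := @Gamma_half_gt0 (d + j) isT.
have sE : \int[sphere_measure]_(x in sphere) (F x)%:E =
    (2 / Gamma ((d + j)%:R / 2) * u)%:E.
  rewrite EFinM E muleA -EFinM (_ : (_ * _)%R = 1%R) ?mul1e//.
  by field; rewrite gt_eqF.
split=> //; apply/integrableP; split.
  by apply/measurable_EFinP; exact: measurable_funTS.
under eq_integral do rewrite gee0_abs ?lee_fin//.
by rewrite sE ltry.
Qed.

Definition monomial (m : 'X_{1..d}) (x : 'rV[R]_d) : R := (\prod_i x ord0 i ^+ m i)%R.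

Lemma measurable_monomial m : measurable_fun setT (monomial m).
Proof.
rewrite /monomial; apply: measurable_prod => i _.
by apply: measurable_funX; exact: measurable_coord.
Qed.

Lemma monomialZ m t x : monomial m (t *: x)%R = (t ^+ mdeg m * monomial m x)%R.
Proof.
rewrite /monomial mdegE expr_sum -big_split/=; apply: eq_bigr => i _.
by rewrite mxE exprMn.
Qed.

(** The Gaussian integral of the monomial, which factors over the coordinates, divided by the radial
    integral. *)
Definition sphere_moment (m : 'X_{1..d}) : R :=
  (2 / Gamma ((d + mdeg m)%:R / 2) * \prod_i gauss_moment (m i))%R.

Lemma has_integral_monomial_gaussian m :
  has_integral lam setT (fun x => monomial m x * expR (- enorm x ^+ 2))%R
    (\prod_i gauss_moment (m i)).
Proof.
have := has_integral_rV (fun i => @has_integral_gauss_moment R (m i)).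
congr has_integral; apply/funext => x.
rewrite enorm_sqr -sumrN expR_sum -big_split/=; exact: eq_bigr.
Qed.

(** The polar formula concerns nonnegative functions, so the monomial is split into its positive and
    negative parts [F 1] and [F (-1)]; both are again positively homogeneous. *)
Lemma has_integral_sphere_monomial m :
  has_integral sphere_measure sphere (monomial m) (sphere_moment m).
Proof.
have [inth hE] := has_integral_monomial_gaussian m.
set e := (fun x : 'rV[R]_d => expR (- enorm x ^+ 2)).
have me : measurable_fun setT e.
  apply: (measurableT_comp (@measurable_expRN R)).
  by apply: measurable_funX; exact: measurable_enorm.
pose F (s : R) x := Num.max (s * monomial m x)%R 0%R.
have hF s : homogeneous_fun (mdeg m)%:R (F s).
  move=> t x t0; rewrite /F monomialZ powR_mulrn ?(ltW t0)//.
  by rewrite maxr_pMr ?exprn_ge0 ?(ltW t0)// mulr0 mulrCA.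
have mF s : measurable_fun setT (F s).
  apply: measurable_maxr => //; apply: measurable_funM => //; exact: measurable_monomial.
have F0 s x : (0 <= F s x)%R by rewrite le_max lexx orbT.
have Fint s : (`|s| = 1)%R -> exists u, has_integral lam setT (fun x => F s x * e x)%R u.
  move=> s1.
  have intF : lam.-integrable setT (EFin \o (fun x => F s x * e x)%R).
    apply: le_integrable inth => //.
      by apply/measurable_EFinP; exact: measurable_funM.
    move=> x _ /=; rewrite lee_fin !normrM ler_wpM2r// ger0_norm// ge_max normr_ge0 andbT.
    by rewrite (le_trans (ler_norm _))// normrM s1 mul1r.
  have := integrable_fin_num measurableT intF => f.
  by exists (fine (\int[lam]_x (F s x * e x)%:E)); split=> //; rewrite fineK.
have [u Fu] := Fint 1%R (normr1 _).
have [v Fv] : exists v, has_integral lam setT (fun x => F (-1)%R x * e x)%R v.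
  by apply: Fint; rewrite normrN1.
have FB x : (F 1 x - F (-1) x = monomial m x)%R.
  rewrite /F mul1r mulN1r; have [h0|] := boolP (0 <= monomial m x)%R.
    by rewrite max_l// max_r ?oppr_le0// subr0.
  by rewrite -ltNge => h0; rewrite max_r ?(ltW h0)// max_l ?oppr_ge0 ?(ltW h0)// sub0r opprK.
have uv : (u - v = \prod_i gauss_moment (m i))%R.
  have [_] := has_integralB measurableT Fu Fv.
  under eq_integral do rewrite -mulrBl FB.
  by rewrite hE => -[].
have := has_integralB (@measurable_sphere d)
  (has_integral_sphere_gaussian (hF _) (mF _) (F0 _) Fu)
  (has_integral_sphere_gaussian (hF _) (mF _) (F0 _) Fv).
rewrite -mulrBr uv; congr has_integral; apply/funext => x; exact: FB.
Qed.

End sphere_monomials.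

(** * The inner product of the sphere *)

Section complex_sphere_integral.
Context {R : realType} {n : nat}.
Local Notation d := n.+1.
Local Notation V := 'rV[R]_d.
Local Notation C := R[i].
Implicit Types (f g : V -> C) (u v a : C) (p q : {mpoly C[d]}).

Definition complex_point (x : V) : 'I_d -> C := fun i => (x ord0 i)%:C.

Definition has_sphere_integral f v : Prop :=
  has_integral sphere_measure sphere (fun x => complex.Re (f x)) (complex.Re v) /\
  has_integral sphere_measure sphere (fun x => complex.Im (f x)) (complex.Im v).

Lemma sphere_integralE f v : has_sphere_integral f v -> sphere_integral f = v.
Proof.
move=> [[_ fr] [_ fi]]; rewrite /sphere_integral /Rintegral fr fi/=.
by case: v {fr fi}.
Qed.

Lemma has_integral_lin e (T : measurableType e) (m : {measure set T -> \bar R}) D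
    (f g : T -> R) (a b u v : R) : measurable D ->
  has_integral m D f u -> has_integral m D g v ->
  has_integral m D (fun x => a * f x + b * g x) (a * u + b * v).
Proof.
move=> mD [intf fu] [intg gv].
have intaf := integrableZl mD a intf; have intbg := integrableZl mD b intg.
split; first by apply: (integrableD mD intaf intbg).
under eq_integral do rewrite EFinD !EFinM.
have := integralD mD intaf intbg => /= ->.
by rewrite !integralZl// fu gv.
Qed.

Lemma has_sphere_integral_lin f g a u v :
  has_sphere_integral f u -> has_sphere_integral g v ->
  has_sphere_integral (fun x => a * f x + g x) (a * u + v).
Proof.
move=> [fr fi] [gr gi]; have mS := @measurable_sphere R d.
have ReM (x y : C) : complex.Re (x * y) =
    complex.Re x * complex.Re y - complex.Im x * complex.Im y by case: x y => [? ?] [].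
have ImM (x y : C) : complex.Im (x * y) =
    complex.Re x * complex.Im y + complex.Im x * complex.Re y by case: x y => [? ?] [].
have ReD (x y : C) : complex.Re (x + y) = complex.Re x + complex.Re y by case: x y => [? ?] [].
have ImD (x y : C) : complex.Im (x + y) = complex.Im x + complex.Im y by case: x y => [? ?] [].
split.
  have := has_integral_lin 1 1 mS (has_integral_lin (complex.Re a) (- complex.Im a) mS fr fi) gr.
  rewrite ReD ReM !mul1r mulNr; congr has_integral.
  by apply/funext => x; rewrite ReD ReM !mul1r mulNr.
have := has_integral_lin 1 1 mS (has_integral_lin (complex.Re a) (complex.Im a) mS fi fr) gi.
rewrite ImD ImM !mul1r; congr has_integral.
by apply/funext => x; rewrite ImD ImM !mul1r.
Qed.

Lemma meval_monomial (m : 'X_{1..d}) x :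
  ('X_[m] : {mpoly C[d]}).@[complex_point x] = (monomial m x)%:C.
Proof.
rewrite mevalX /monomial rmorph_prod; apply: eq_bigr => i _.
by rewrite /complex_point -rmorphXn.
Qed.

Lemma has_sphere_integral_monomial (m : 'X_{1..d}) :
  has_sphere_integral (fun x => ('X_[m] : {mpoly C[d]}).@[complex_point x])
    (sphere_moment m)%:C.
Proof.
have [hr hi] : has_sphere_integral (fun x => (monomial m x)%:C) (sphere_moment m)%:C.
  split=> /=; first exact: has_integral_sphere_monomial.
  have h := @has_integral_sphere_monomial R n m.
  have := has_integral_lin 0 0 (@measurable_sphere R d) h h.
  rewrite !mul0r addr0; congr has_integral.
  by apply/funext => x; rewrite !mul0r addr0.
by split; [move: hr|move: hi]; congr has_integral; apply/funext => x; rewrite meval_monomial.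
Qed.

(** The instance of the abstract functional L; [sphere_functional_X] and [sphere_functional_parts]
    are its two hypotheses. *)
Definition sphere_functional p : C := sphere_integral (fun x => p.@[complex_point x]).
Arguments sphere_functional : simpl never.

Lemma has_sphere_integral_poly p :
  has_sphere_integral (fun x => p.@[complex_point x]) (sphere_functional p).
Proof.
suff [v hv] : exists v, has_sphere_integral (fun x => p.@[complex_point x]) v.
  by rewrite /sphere_functional (sphere_integralE hv).
elim/mpolyind: p => [|c m p _ _ [v hv]].
  exists 0; have h := has_sphere_integral_monomial 0%MM.
  have := has_sphere_integral_lin (-1) h h; rewrite mulN1r addNr.
  congr has_sphere_integral; apply/funext => x.
  by rewrite mulN1r addNr meval0.
exists (c * (sphere_moment m)%:C + v).
have := has_sphere_integral_lin c (has_sphere_integral_monomial m) hv.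
by congr has_sphere_integral; apply/funext => x; rewrite mevalD mevalZ.
Qed.

Lemma sphere_functional_is_linear : linear_for *%R sphere_functional.
Proof.
move=> a p q; apply: sphere_integralE.
have := has_sphere_integral_lin a (has_sphere_integral_poly p) (has_sphere_integral_poly q).
by congr has_sphere_integral; apply/funext => x; rewrite mevalD mevalZ.
Qed.

HB.instance Definition _ := GRing.isLinear.Build C {mpoly C[d]} C *%R
  sphere_functional sphere_functional_is_linear.

Lemma sphere_functionalX (m : 'X_{1..d}) : sphere_functional 'X_[m] = (sphere_moment m)%:C.
Proof. exact: sphere_integralE (has_sphere_integral_monomial m). Qed.

Lemma eq_sphere_integral f g : (forall x, sphere x -> f x = g x) ->
  sphere_integral f = sphere_integral g.
Proof.
move=> fg; rewrite /sphere_integral; congr (_ +i* _);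
by apply: eq_Rintegral => x /set_mem/fg ->.
Qed.

Lemma eq_sphere_functional p q :
  (forall x, sphere x -> p.@[complex_point x] = q.@[complex_point x]) ->
  sphere_functional p = sphere_functional q.
Proof. exact: eq_sphere_integral. Qed.

Lemma sphere_functional_X i : sphere_functional 'X_i = 0.
Proof.
rewrite sphere_functionalX /sphere_moment (bigD1 i)//= mnm1E eqxx.
by rewrite gauss_moment_odd// mul0r mulr0.
Qed.

(** The recursion of Gamma brings (d + |m| - 1)/2 into the denominator and that of the Gaussian
    moments brings m_i/2 into the numerator; the halves cancel. If m_i = 0 the left side has an odd
    moment and is 0 as well. *)
Lemma sphere_moment_parts (m : 'X_{1..d}) i : (0 < mdeg m)%N ->
  (mdeg m + n)%:R * sphere_moment (U_(i) + m)%MM =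
  (m i)%:R * sphere_moment (m - U_(i))%MM :> R.
Proof.
move=> m0.
have [mi0|mi0] := eqVneq (m i) 0%N.
  rewrite mi0 mul0r /sphere_moment (bigD1 i)//= mnmDE mnm1E eqxx mi0.
  by rewrite gauss_moment_odd// mul0r !mulr0.
have dm : mdeg m = (mdeg (m - U_(i))%MM).+1.
  have := mdegD (m - U_(i)) U_(i).
  by rewrite submK ?lep1mP// mdeg1 addn1.
rewrite /sphere_moment mdegD mdeg1 dm; set j := mdeg (m - U_(i)).
rewrite (bigD1 i)//= [in RHS](bigD1 i)//=.
rewrite (eq_bigr (fun l => gauss_moment (m l))); last first.
  by move=> l li; rewrite mnmDE mnm1E eq_sym (negbTE li).
rewrite [in RHS](eq_bigr (fun l => gauss_moment (m l))); last first.
  by move=> l li; rewrite mnmBE mnm1E eq_sym (negbTE li) subn0.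
rewrite mnmDE mnmBE mnm1E eqxx; set P := \prod_(_ | _) _.
case: (m i) mi0 => // k _; rewrite subn1/= add1n.
have -> : (d + (1 + j.+1))%:R / 2 = (d + j)%:R / 2 + 1 :> R.
  by rewrite (_ : d + (1 + j.+1) = d + j + 2)%N; [rewrite natrD; field|lia].
rewrite Gamma_half_S//.
have G0 := @Gamma_half_gt0 R (d + j) isT.
rewrite (_ : j.+1 + n = d + j)%N; last by lia.
have dj0 : ((d + j)%:R : R) != 0 by rewrite pnatr_eq0.
rewrite -natr1 /=; set G := Gamma _ in G0 *; clearbody G.
move: ((d + j)%:R : R) dj0 => c dj0.
by field; rewrite dj0 gt_eqF.
Qed.

Lemma sphere_functional_parts k p i : p \is k.+1.-homog ->
  (k + d)%:R * sphere_functional ('X_i * p) = sphere_functional p^`M(i).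
Proof.
move=> /dhomogP hp; have -> : p^`M(i) = \sum_(m <- msupp p) p@_m *: ('X_[m])^`M(i).
  by rewrite [in LHS](mpolyE p) linear_sum; apply: eq_bigr => m _; rewrite [LHS]mderivZ.
have -> : 'X_i * p = \sum_(m <- msupp p) p@_m *: 'X_[U_(i) + m].
  rewrite {1}(mpolyE p) mulr_sumr; apply: eq_bigr => m _.
  by rewrite -scalerAr -mpolyXD.
rewrite 2!linear_sum/= mulr_sumr !big_seq; apply: eq_bigr => m /hp/= mk.
rewrite mderivX !linearZ/= mulrCA; congr (_ * _).
rewrite !sphere_functionalX.
have := @sphere_moment_parts m i; rewrite mk => /(_ isT)/(congr1 (real_complex R)).
by rewrite !rmorphM/= !rmorph_nat addSnnS.
Qed.

Lemma sphere_functional1 : sphere_functional 1 = (2 / Gamma (d%:R / 2) * Num.sqrt pi ^+ d)%:C.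
Proof.
rewrite -mpolyX0 sphere_functionalX /sphere_moment mdeg0 addn0.
by rewrite (eq_bigr (fun=> Num.sqrt pi)) ?prodr_const ?card_ord// => i _; rewrite mnm0E.
Qed.

Lemma has_integral_le e (T : measurableType e) (m : {measure set T -> \bar R}) D
    (f g : T -> R) (u v : R) : measurable D ->
  has_integral m D f u -> has_integral m D g v -> (forall x, D x -> f x <= g x) -> u <= v.
Proof.
move=> mD [intf fu] [intg gv] fg; rewrite -lee_fin -fu -gv.
by apply: le_integral => // x /set_mem Dx; rewrite lee_fin fg.
Qed.

Lemma le_sphere_functional p q :
  (forall x, sphere x -> p.@[complex_point x] <= q.@[complex_point x]) ->
  sphere_functional p <= sphere_functional q.
Proof.
move=> pq; have mS := @measurable_sphere R d.
have [pr pi] := has_sphere_integral_poly p; have [qr qi] := has_sphere_integral_poly q.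
have h x : sphere x -> (complex.Im p.@[complex_point x] = complex.Im q.@[complex_point x]) /\
    complex.Re p.@[complex_point x] <= complex.Re q.@[complex_point x].
  by move=> /pq; rewrite lecE => /andP[/eqP -> ->].
rewrite lecE; apply/andP; split; last first.
  by apply: (has_integral_le mS pr qr) => x /h[].
apply/eqP/le_anti/andP; split.
  by apply: (has_integral_le mS qi pi) => x /h[->].
by apply: (has_integral_le mS pi qi) => x /h[->].
Qed.

End complex_sphere_integral.
Arguments sphere_functional : simpl never.

(** The expansion of <u - (w/K) g, u - (w/K) g> with a = <u, u>, b = <g, g>, w = <u, g> and w' its
    conjugate, as an identity in an abstract field. *)
Lemma cauchy_identity (F : fieldType) (a b w w' K : F) : K != 0 ->
  a + - (w' * K^-1) * w + (- (w * K^-1) * w' + - (w * K^-1) * (- (w' * K^-1) * b)) =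
  a - w * w' * K^-1 + w * w' * (K^-1) ^+ 2 * (b - K).
Proof. by move=> K0; field. Qed.

(** * Conjugation of polynomials *)

Section conj_mpoly.
Context {R : realType} {n : nat}.
Local Notation d := n.+1.
Local Notation C := R[i].
Implicit Types (a : C) (p q t u g : {mpoly C[d]}).

Lemma conjcD (x y : C) : conjc (x + y) = conjc x + conjc y. Proof. exact: rmorphD. Qed.

Lemma conjcM (x y : C) : conjc (x * y) = conjc x * conjc y. Proof. exact: rmorphM. Qed.

Lemma conjcN (x : C) : conjc (- x) = - conjc x. Proof. exact: rmorphN. Qed.

(** Only coefficients are conjugated: at real points this conjugates the value, so that the L^2
    inner product can be written as L of a polynomial. *)
Definition conj_mpoly p : {mpoly C[d]} := map_mpoly (@conjc R) p.

Lemma mcoeff_conj p m : (conj_mpoly p)@_m = conjc p@_m.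
Proof. exact: mcoeff_map_mpoly. Qed.

Lemma conj_mpolyM p q : conj_mpoly (p * q) = conj_mpoly p * conj_mpoly q.
Proof. exact: rmorphM. Qed.

Lemma conj_mpolyZ a p : conj_mpoly (a *: p) = conjc a *: conj_mpoly p.
Proof. by apply/mpolyP => m; rewrite mcoeff_conj !mcoeffZ mcoeff_conj rmorphM. Qed.

Lemma conj_mpolyX (m : 'X_{1..d}) : conj_mpoly 'X_[m] = 'X_[m].
Proof. by apply/mpolyP => k; rewrite mcoeff_conj !mcoeffX rmorph_nat. Qed.

Lemma conj_mpoly_sum (I : Type) (r : seq I) (P : pred I) (F : I -> {mpoly C[d]}) :
  conj_mpoly (\sum_(i <- r | P i) F i) = \sum_(i <- r | P i) conj_mpoly (F i).
Proof. exact: raddf_sum. Qed.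

Lemma conj_mpolyK : involutive conj_mpoly.
Proof. by move=> p; apply/mpolyP => m; rewrite !mcoeff_conj conjcK. Qed.

Lemma meval_conj p (z : 'I_d -> C) :
  (conj_mpoly p).@[z] = conjc p.@[fun i => conjc (z i)].
Proof.
rewrite {1}(mpolyE p) conj_mpoly_sum [LHS]raddf_sum/= mevalE rmorph_sum/=.
apply: eq_bigr => m _; rewrite conj_mpolyZ conj_mpolyX mevalZ mevalX rmorphM rmorph_prod/=.
by congr (_ * _); apply: eq_bigr => i _; rewrite rmorphXn/= conjcK.
Qed.

Lemma meval_conj_real p x : (conj_mpoly p).@[complex_point x] = conjc p.@[complex_point x].
Proof.
rewrite meval_conj; congr conjc; apply: meval_eq => i.
by rewrite /complex_point conjc_real.
Qed.

Lemma mderiv_conj p i : (conj_mpoly p)^`M(i) = conj_mpoly p^`M(i).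
Proof.
by apply/mpolyP => m; rewrite mcoeff_conj !mcoeff_mderiv mcoeff_conj rmorphMn.
Qed.

Lemma mlaplacian_conj p : mlaplacian (conj_mpoly p) = conj_mpoly (mlaplacian p).
Proof.
by rewrite /mlaplacian conj_mpoly_sum; apply: eq_bigr => i _; rewrite !mderiv_conj.
Qed.

Lemma conj_homog k p : p \is k.-homog -> conj_mpoly p \is k.-homog.
Proof.
move=> /dhomogP hp; apply/dhomogP => m; rewrite mcoeff_msupp mcoeff_conj conjc_eq0.
by rewrite -mcoeff_msupp => /hp.
Qed.

Lemma sphere_functionalZ a p : sphere_functional (a *: p) = a * sphere_functional p.
Proof. exact: linearZ. Qed.

Lemma sphere_functional_conj p : sphere_functional (conj_mpoly p) = conjc (sphere_functional p).
Proof.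
rewrite {1}(mpolyE p) conj_mpoly_sum [in RHS](mpolyE p) !(linear_sum sphere_functional)/=.
rewrite [RHS](rmorph_sum conjc); apply: eq_bigr => m _; rewrite conj_mpolyZ conj_mpolyX !sphere_functionalZ rmorphM.
by rewrite sphere_functionalX; congr (_ * _); exact/esym/conjc_real.
Qed.

End conj_mpoly.

(** The L^2 inner product, on polynomials instead of functions; locked, so that conversion does not
    unfold it to an integral. *)
HB.lock Definition sphere_ip (R : realType) (n : nat) (p q : {mpoly R[i][n.+1]}) : R[i] :=
  sphere_functional (p * conj_mpoly q).

Section sphere_inner_product.
Context {R : realType} {n : nat}.
Local Notation d := n.+1.
Local Notation C := R[i].
Implicit Types (a : C) (p q t u g : {mpoly C[d]}).

Lemma sphere_ipE p q : sphere_ip p q = sphere_functional (p * conj_mpoly q).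
Proof. by rewrite unlock. Qed.

Lemma sphere_ipDl p q u : sphere_ip (p + q) u = sphere_ip p u + sphere_ip q u.
Proof. by rewrite !sphere_ipE mulrDl linearD. Qed.

Lemma sphere_ipZl a p u : sphere_ip (a *: p) u = a * sphere_ip p u.
Proof. by rewrite !sphere_ipE -scalerAl linearZ. Qed.

Lemma sphere_ipC p q : sphere_ip q p = conjc (sphere_ip p q).
Proof. by rewrite !sphere_ipE -sphere_functional_conj conj_mpolyM conj_mpolyK mulrC. Qed.

Lemma sphere_ipDr p q u : sphere_ip u (p + q) = sphere_ip u p + sphere_ip u q.
Proof. by rewrite [LHS]sphere_ipC sphere_ipDl conjcD; congr (_ + _); exact/esym/sphere_ipC. Qed.

Lemma sphere_ipZr a p u : sphere_ip u (a *: p) = conjc a * sphere_ip u p.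
Proof. by rewrite [LHS]sphere_ipC sphere_ipZl conjcM; congr (_ * _); exact/esym/sphere_ipC. Qed.

Lemma sphere_ip_suml (I : finType) (F : I -> {mpoly C[d]}) u :
  sphere_ip (\sum_i F i) u = \sum_i sphere_ip (F i) u.
Proof.
rewrite sphere_ipE mulr_suml linear_sum; apply: eq_bigr => i _.
by rewrite sphere_ipE.
Qed.

Lemma eq_sphere_ip p q u :
  (forall x, sphere x -> p.@[complex_point x] = q.@[complex_point x]) ->
  sphere_ip p u = sphere_ip q u.
Proof. by move=> pq; rewrite !sphere_ipE; apply: eq_sphere_functional => x /pq E; rewrite !mevalM E. Qed.

Lemma sphere_ip_ge0 p : 0 <= sphere_ip p p.
Proof.
rewrite sphere_ipE; have <- : sphere_functional (0 : {mpoly C[d]}) = 0 by exact: linear0.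
apply: le_sphere_functional => x _.
by rewrite meval0 mevalM meval_conj_real mulcJ_ge0.
Qed.

(** From <u - (w/K) g, u - (w/K) g> >= 0. A positive upper bound [K] in place of <g, g> spares the
    case <g, g> = 0 and fits bounds that are uniform in the truncation. *)
Lemma sphere_ip_cauchy u g (K : C) : 0 < K -> sphere_ip g g <= K ->
  `|sphere_ip u g| ^+ 2 <= K * sphere_ip u u.
Proof.
move=> K0 gK; set w := sphere_ip u g.
have Kr : conjc K = K by have /ger0_Im := ltW K0; case: (K) => a b /= ->; rewrite oppr0.
have Kn0 : K != 0 by rewrite gt_eqF.
have := sphere_ip_ge0 (u - (w / K) *: g); rewrite -scaleNr.
rewrite sphere_ipDl !sphere_ipDr !sphere_ipZl !sphere_ipZr.
rewrite [sphere_ip g u]sphere_ipC -/w.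
rewrite !conjcN !conjcM conjc_inv Kr sqr_normc => h.
suff : 0 <= K * (sphere_ip u u - w * conjc w / K).
  by rewrite mulrBr mulrCA mulfV// mulr1 subr_ge0.
apply: mulr_ge0; first exact: ltW.
move: h; rewrite cauchy_identity// => h; apply: le_trans h _.
by rewrite gerDl mulr_ge0_le0 ?subr_le0// mulr_ge0 ?mulcJ_ge0// exprn_ge0// invr_ge0 ltW//.
Qed.

(** * The error in Parseval's identity for a finite orthonormal family *)

Section orthonormal.
Context {I : finType} (e : I -> {mpoly C[d]}).
Hypothesis e_ortho : forall i j, sphere_ip (e i) (e j) = (i == j)%:R.

(** It is linear in [t] and, for an orthonormal family, vanishes on the span, so that only the part
    of [t] outside the span contributes. *)
Definition parseval_defect t g : C :=
  sphere_ip t g - \sum_i sphere_ip t (e i) * sphere_ip (e i) g.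

Definition ortho_residue t : {mpoly C[d]} := t - \sum_i sphere_ip t (e i) *: e i.

Lemma sphere_ip_residue t g : sphere_ip (ortho_residue t) g = parseval_defect t g.
Proof.
rewrite /ortho_residue -scaleN1r sphere_ipDl sphere_ipZl sphere_ip_suml mulN1r.
by congr (_ - _); apply: eq_bigr => i _; rewrite sphere_ipZl.
Qed.

Lemma parseval_defect_basis t j : parseval_defect t (e j) = 0.
Proof.
rewrite /parseval_defect (bigD1 j isT)/=.
rewrite (e_ortho j j).
rewrite (eqxx j).
rewrite mulr1n mulr1 big1.
  by rewrite addr0 subrr.
by move=> i ij; rewrite (e_ortho i j) (negbTE ij) mulr0n mulr0.
Qed.

(** Bessel's inequality: the residue is orthogonal to the projection, hence <res, res> = <res, t>,
    which is <t, t> minus a sum of squared moduli. *)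
Lemma parseval_defect_le t : sphere_ip (ortho_residue t) (ortho_residue t) <= sphere_ip t t.
Proof.
have res0 : sphere_ip (ortho_residue t) (\sum_i sphere_ip t (e i) *: e i) = 0.
  rewrite [LHS]sphere_ipC sphere_ip_suml big1 ?conjc0// => i _.
  rewrite (sphere_ipZl _ (e i)) (sphere_ipC (ortho_residue t) (e i)) (sphere_ip_residue t (e i)).
  by rewrite parseval_defect_basis conjc0 mulr0.
have -> : sphere_ip (ortho_residue t) (ortho_residue t) = sphere_ip (ortho_residue t) t.
  transitivity (sphere_ip (ortho_residue t) (t + -1 *: \sum_i sphere_ip t (e i) *: e i)).
    by rewrite scaleN1r.
  by rewrite (sphere_ipDr t) (sphere_ipZr (-1)) res0 mulr0 addr0.
rewrite (sphere_ip_residue t t) /parseval_defect gerBl sumr_ge0// => i _.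
by rewrite (sphere_ipC t (e i)) mulcJ_ge0.
Qed.

Lemma parseval_defect_bound t g (K : C) : 0 < K -> sphere_ip g g <= K ->
  `|parseval_defect t g| ^+ 2 <= K * sphere_ip t t.
Proof.
move=> K0 gK; rewrite -(sphere_ip_residue t g) (le_trans (sphere_ip_cauchy _ K0 gK))//.
by rewrite ler_wpM2l ?(ltW K0)// parseval_defect_le.
Qed.

Lemma parseval_defectD t u g :
  parseval_defect (t + u) g = parseval_defect t g + parseval_defect u g.
Proof.
rewrite /parseval_defect sphere_ipDl addrACA -opprD -big_split; congr (_ - _).
by apply: eq_bigr => i _; rewrite sphere_ipDl mulrDl.
Qed.

Lemma parseval_defectZ a t g : parseval_defect (a *: t) g = a * parseval_defect t g.
Proof.
rewrite /parseval_defect sphere_ipZl mulrBr mulr_sumr; congr (_ - _).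
by apply: eq_bigr => i _; rewrite sphere_ipZl mulrA.
Qed.

Lemma parseval_defect_basisl i g : parseval_defect (e i) g = 0.
Proof.
rewrite /parseval_defect (bigD1 i isT)/= (e_ortho i i) eqxx mulr1n mul1r big1.
  by rewrite addr0 subrr.
by move=> j ij; rewrite (e_ortho i j) eq_sym (negbTE ij) mulr0n mul0r.
Qed.

Lemma eq_parseval_defect t u g :
  (forall x, sphere x -> t.@[complex_point x] = u.@[complex_point x]) ->
  parseval_defect t g = parseval_defect u g.
Proof.
move=> tu; rewrite /parseval_defect (eq_sphere_ip _ tu); congr (_ - _).
by apply: eq_bigr => i _; rewrite (eq_sphere_ip _ tu).
Qed.

End orthonormal.

Lemma meval_r2 x : sphere x -> (mpoly_r2 : {mpoly C[d]}).@[complex_point x] = 1.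
Proof.
move=> sx; rewrite /mpoly_r2 raddf_sum/=.
under eq_bigr do rewrite rmorphXn/= mevalXU -rmorphXn.
by rewrite -rmorph_sum -enorm_sqr [enorm x]sx expr1n.
Qed.

(* On the sphere |x|^2 = 1, so the Fischer decomposition reduces p to harmonic
   polynomials of degree < M. *)
Lemma parseval_defect_homog0 {I : finType} (e : I -> {mpoly C[d]}) (M : nat) :
  (forall i j, sphere_ip (e i) (e j) = (i == j)%:R) ->
  (forall k h, (k < M)%N -> h \is k.-homog -> mlaplacian h = 0 ->
    exists c : I -> C, forall x, sphere x ->
      h.@[complex_point x] = (\sum_i c i *: e i).@[complex_point x]) ->
  forall j p g, (j < M)%N -> p \is j.-homog -> parseval_defect e p g = 0.
Proof.
move=> eo espan j p g jM.
apply: (@harmonic_ind _ _ (fun p => parseval_defect e p g = 0)) => //.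
  by move=> p1 p2 h1 h2; rewrite parseval_defectD h1 h2 addr0.
move=> l k h jlk hh Dh.
have [|c hc] := espan k h _ hh Dh; first by rewrite (leq_ltn_trans _ jM)// -jlk leq_addl.
rewrite (@eq_parseval_defect _ _ _ (\sum_i c i *: e i)); last first.
  by move=> x sx; rewrite mevalM rmorphXn/= meval_r2// expr1n mul1r hc.
elim/big_ind: _ => [||i _]; first by rewrite -(scale0r 0) parseval_defectZ mul0r.
  by move=> u v hu hv; rewrite parseval_defectD hu hv addr0.
by rewrite parseval_defectZ parseval_defect_basisl ?mulr0.
Qed.

End sphere_inner_product.

(** * Bessel functions and plane waves *)

Section bessel_series.
Context {R : realType} {n : nat}.
Local Notation d := n.+1.

Definition sphere_area : R := 2 / Gamma (d%:R / 2) * Num.sqrt pi ^+ d.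

Lemma sphere_area_ge0 : 0 <= sphere_area.
Proof.
rewrite /sphere_area mulr_ge0 ?exprn_ge0 ?sqrtr_ge0// divr_ge0// ltW//.
exact: (@Gamma_half_gt0 R d).
Qed.

Definition bessel_coef (l k : nat) : R :=
  sphere_area / (l`!%:R * 2 ^+ l * \prod_(i < l + k) (d + 2 * i)%:R).

Lemma sphere_coef_bessel l k :
  sphere_coef (@sphere_functional R n) l k = (bessel_coef l k)%:C.
Proof.
rewrite /sphere_coef [X in X / _](_ : _ = sphere_area%:C); last exact: sphere_functional1.
rewrite /bessel_coef; move: sphere_area => A.
rewrite fmorph_div !rmorphM rmorph_prod rmorphXn !rmorph_nat.
by congr (_ / (_ * _)); apply: eq_bigr => i _; rewrite rmorph_nat.
Qed.

Definition bessel_term (k : nat) (z : R) (l : nat) : R :=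
  (-1) ^+ l * bessel_coef l k * z ^+ (2 * l).

(** Of the denominator only l! is kept, as the other factors are at least 1; the majorant does not
    depend on [k]. *)
Lemma bessel_term_le k z l : `|bessel_term k z l| <= sphere_area * exp_coeff (z ^+ 2) l.
Proof.
have A0 := sphere_area_ge0.
have P1 : 1 <= 2 ^+ l * \prod_(i < l + k) (d + 2 * i)%:R :> R.
  rewrite mulr_ege1 ?exprn_ege1 ?ler1n//.
  by apply: (big_ind (fun x => 1 <= x)) => // [x y x1 y1|i _]; [exact: mulr_ege1|rewrite ler1n; lia].
have f0 : 0 < l`!%:R :> R by rewrite ltr0n fact_gt0.
rewrite /bessel_term normrM normrM normrX normrN1 expr1n mul1r.
rewrite exprM normrX (ger0_norm (sqr_ge0 _)).
have -> : exp_coeff (z ^+ 2) l = (z ^+ 2) ^+ l / l`!%:R by [].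
rewrite mulrC [leRHS]mulrCA ler_wpM2l ?(exprn_ge0 _ (sqr_ge0 z))//.
rewrite /bessel_coef ger0_norm; last first.
  by rewrite divr_ge0// !mulr_ge0 ?exprn_ge0 ?prodr_ge0.
rewrite ler_wpM2l// -mulrA invfM ler_piMr ?invr_ge0 ?(ltW f0)//.
by rewrite invf_le1// (lt_le_trans ltr01).
Qed.

Lemma cvg_series_bessel_term k z : cvgn (series (bessel_term k z)).
Proof.
apply: normed_cvg.
apply: (@series_le_cvg _ _ (fun l => sphere_area * exp_coeff (z ^+ 2) l)).
- by move=> l; exact: normr_ge0.
- move=> l; rewrite mulr_ge0 ?sphere_area_ge0//; apply: exp_coeff_ge0; exact: sqr_ge0.
- by move=> l; exact: bessel_term_le.
- exact: (@is_cvg_seriesZ _ _ sphere_area (is_cvg_series_exp_coeff (z ^+ 2))).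
Qed.

(* J_{d,k}(z) / z^k, extended to z = 0. *)
Definition bessel_entire (k : nat) (z : R) : R := limn (series (bessel_term k z)).

Lemma bessel_coef0 : bessel_coef 0 0 = sphere_area.
Proof. by rewrite /bessel_coef big_ord0 !mulr1 divr1. Qed.

(** An explicit modulus of continuity at 0, from the terms l >= 1 of the majorant. It serves to
    evaluate the limit in [besselJd]. *)
Lemma bessel_entire_near0 z : `|bessel_entire 0 z - sphere_area| <=
  sphere_area * (expR (z ^+ 2) - 1).
Proof.
have A0 := sphere_area_ge0.
have c1 : (`|series (bessel_term 0 z) N - sphere_area| @[N --> \oo]) -->
    `|bessel_entire 0 z - sphere_area|.
  apply: cvg_norm; apply: cvgB; last exact: cvg_cst.
  exact: cvg_series_bessel_term.
rewrite -(cvg_lim _ c1)//; apply: limr_le; first by apply/cvg_ex; exists `|bessel_entire 0 z - sphere_area|.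
near=> N.
have N0 : (0 < N)%N by near: N; exists 1%N.
rewrite -(prednK N0) /series/= big_nat_recl//=.
rewrite {1}/bessel_term expr0 bessel_coef0 mul1r muln0 expr0 mulr1.
rewrite addrAC subrr add0r (le_trans (ler_norm_sum _ _ _))//.
apply: (@le_trans _ _ (sphere_area * (series (exp_coeff (z ^+ 2)) N - 1))); last first.
  rewrite ler_wpM2l// lerB// /expR; apply: nondecreasing_cvgn_le; last exact: is_cvg_series_exp_coeff.
  by apply: nondecreasing_series => i _ _; exact/exp_coeff_ge0/sqr_ge0.
rewrite -(prednK N0) /series/= big_nat_recl//= {1}/exp_coeff/= expr0 divr1 addrAC subrr add0r.
by rewrite mulr_sumr ler_sum// => i _; exact: bessel_term_le.
Unshelve. all: end_near. Qed.

Lemma Gamma_half_prod j :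
  Gamma ((d + 2 * j)%:R / 2) = Gamma (d%:R / 2) * \prod_(i < j) (d%:R / 2 + i%:R) :> R.
Proof.
elim: j => [|j IH]; first by rewrite muln0 addn0 big_ord0 mulr1.
rewrite (_ : (d + 2 * j.+1)%:R / 2 = (d + 2 * j)%:R / 2 + 1 :> R); last first.
  by rewrite !natrD !natrM -natr1; field.
rewrite Gamma_half_S// IH big_ord_recr/= mulrCA; congr (_ * _).
by rewrite mulrC natrD natrM; congr (_ * _); field.
Qed.

(** The series agree term by term: Gamma(l + nu + 1), with nu = k + d/2 - 1, is Gamma((d + 2(l +
    k))/2), which [Gamma_half_prod] reduces to Gamma(d/2) and the product in [bessel_coef]. The
    constant [c] is z^k times the inverse of the prefactor (2 pi)^(d/2) / z^(d/2 - 1). *)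
Lemma besselJd_posE k z : 0 < z -> besselJd_pos d k z = z ^+ k * bessel_entire k z.
Proof.
move=> z0; rewrite /besselJd_pos /besselJ.
set f := (fun m : nat => _).
pose A : R := 2 `^ (d%:R / 2 - 1); pose Z : R := z `^ (d%:R / 2 - 1).
have A0 : A != 0 by rewrite gt_eqF// powR_gt0.
have Z0 : Z != 0 by rewrite gt_eqF// powR_gt0.
have pA : (2 * pi) `^ (d%:R / 2) = 2 * A * Num.sqrt pi ^+ d :> R.
  rewrite powRM ?pi_ge0//; congr (_ * _).
    rewrite [in LHS](_ : d%:R / 2 = 1 + (d%:R / 2 - 1)); last by ring.
    by rewrite powRD ?pnatr_eq0 ?implybT// powRr1.
  by rewrite -powR12_sqrt ?pi_ge0// -powR_mulrn ?powR_ge0// -powRrM mulrC.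
have G0 : Gamma (d%:R / 2) != 0 :> R by rewrite gt_eqF// (@Gamma_half_gt0 R d).
have zk : z ^+ k != 0 by rewrite expf_neq0 ?gt_eqF.
have S0 : Num.sqrt pi ^+ d != 0 :> R by rewrite expf_neq0// gt_eqF// sqrtr_gt0 pi_gt0.
pose c : R := z ^+ k * Z / (2 * A * Num.sqrt pi ^+ d).
have fE : f = (fun l => c * bessel_term k z l).
  apply/funext => l; rewrite /f.
  rewrite (_ : l%:R + _ + 1 = (d + 2 * (l + k))%:R / 2); last first.
    by rewrite natrD natrM natrD; field.
  rewrite Gamma_half_prod.
  have -> : (z / 2) `^ (2 * l%:R + (k%:R + d%:R / 2 - 1)) =
      z ^+ (2 * l + k) / 2 ^+ (2 * l + k) * (Z / A).
    rewrite (_ : 2 * l%:R + _ = (2 * l + k)%:R + (d%:R / 2 - 1)); last first.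
      by rewrite natrD natrM; ring.
    have z2 : 0 < z / 2 by rewrite divr_gt0.
    rewrite powRD ?(gt_eqF z2) ?implybT// powR_mulrn ?(ltW z2)// expr_div_n; congr (_ * _).
    rewrite powRM ?(ltW z0)//; congr (_ * _).
    by rewrite /A; move: (d%:R / 2 - 1) => s; rewrite -[2^-1]powR_inv1// -powRrM mulN1r powRN.
  have PE : \prod_(i < l + k) (d + 2 * i)%:R =
      2 ^+ (l + k) * \prod_(i < l + k) (d%:R / 2 + i%:R) :> R.
    rewrite -[in 2 ^+ _](card_ord (l + k)) -prodr_const -big_split; apply: eq_bigr => i _ /=.
    by rewrite natrD natrM; field.
  rewrite /bessel_term /bessel_coef PE /sphere_area /c.
  have P0 : \prod_(i < l + k) (d%:R / 2 + i%:R) != 0 :> R.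
    by rewrite prodf_seq_neq0; apply/allP => i _; rewrite gt_eqF// ltr_wpDr.
  have l0 : l`!%:R != 0 :> R by rewrite pnatr_eq0 -lt0n fact_gt0.
  rewrite !mul2n -!addnn !exprD.
  move: (\prod_(i < _) _) P0 => P P0; clearbody A Z.
  have e2 m : 2 ^+ m != 0 :> R by rewrite expf_neq0.
  by field; rewrite P0 !e2 l0 G0 S0 A0.
rewrite [limn _](_ : _ = c * bessel_entire k z); last first.
  by rewrite fE; exact: (lim_seriesZ c (@cvg_series_bessel_term k z)).
by rewrite pA /c -/Z; clearbody A Z; field; rewrite A0 S0 Z0.
Qed.

End bessel_series.

Section complex_limits.
Context {R : realType}.
Local Notation C := R[i].

(** A positive element of R[i] is real, so that all radii may be taken in [R]. *)
Lemma cvg_complexP (f : nat -> C) (a : C) :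
  (f : nat -> R[i]^o) @ \oo --> (a : R[i]^o) <->
  (forall e : R, 0 < e -> \forall N \near \oo, `|f N - a| <= e%:C).
Proof.
split.
  move=> /cvgrPdist_le h e e0; have := h e%:C; rewrite ltcR => /(_ e0).
  by apply: filterS => N; rewrite distrC.
move=> h; apply/cvgrPdist_le => e e0.
have er : e = (complex.Re e)%:C by rewrite RRe_real// gtr0_real.
have e0' : 0 < complex.Re e by rewrite -ltcR -er.
have := h _ e0'; apply: filterS => N; by rewrite distrC -er.
Qed.

Lemma cvg_real_complex (f : nat -> R) (a : R) : f @ \oo --> a ->
  ((fun N => (f N)%:C) : nat -> R[i]^o) @ \oo --> (a%:C : R[i]^o).
Proof.
move=> /cvgrPdist_le h; apply/cvg_complexP => e e0.
have := h _ e0; apply: filterS => N ae.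
by rewrite -rmorphB normc_def/= expr0n addr0 sqrtr_sqr lecR distrC.
Qed.

Lemma normc_real (x : R) : `|x%:C| = `|x|%:C :> C.
Proof. by rewrite normc_def/= expr0n addr0 sqrtr_sqr. Qed.

Lemma cvg_conjc (f : nat -> C) (a : C) : (f : nat -> R[i]^o) @ \oo --> (a : R[i]^o) ->
  ((fun N => conjc (f N)) : nat -> R[i]^o) @ \oo --> (conjc a : R[i]^o).
Proof.
move=> /cvg_complexP h; apply/cvg_complexP => e e0.
by have := h _ e0; apply: filterS => N; rewrite -rmorphB normcJ.
Qed.

Lemma cvg_complexM (f g : nat -> C) (a b : C) :
  (f : nat -> R[i]^o) @ \oo --> (a : R[i]^o) -> (g : nat -> R[i]^o) @ \oo --> (b : R[i]^o) ->
  ((fun N => f N * g N) : nat -> R[i]^o) @ \oo --> (a * b : R[i]^o).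
Proof. by move=> fa gb; exact: (@cvgM _ _ _ _ (f : nat -> R[i]^o) (g : nat -> R[i]^o) a b fa gb). Qed.

End complex_limits.

(** * Spherical waves and truncated plane waves *)

Section spherical_waves.
Context {R : realType} {n : nat}.
Local Notation d := n.+1.
Local Notation C := R[i].
Implicit Types (r : 'rV[R]_d) (p : {mpoly C[d]}).

Lemma bessel_entire00 : bessel_entire (n := n) 0 0 = sphere_area (n := n) :> R.
Proof.
have := @bessel_entire_near0 R n 0.
by rewrite expr0n expR0 subrr mulr0 normr_le0 subr_eq0 => /eqP.
Qed.

(** At z = 0 and order 0, [besselJd] is a limit from the right, which is found by squeezing with
    [bessel_entire_near0]. *)
Lemma besselJd_ge0E k z : 0 <= z -> (0 < z) || (k == 0%N) ->
  besselJd d k z = z ^+ k * bessel_entire (n := n) k z :> R.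
Proof.
rewrite le_eqVlt => /predU1P[<-|z0 _]; last by rewrite /besselJd gt_eqF// besselJd_posE.
rewrite ltxx/= => /eqP ->; rewrite expr0 mul1r /besselJd eqxx bessel_entire00.
apply/cvg_lim => //.
pose A := @sphere_area R n.
pose h (t : R) := A * (expR (t ^+ 2) - 1).
have h0 : h t @[t --> 0^'+] --> 0.
  rewrite -[X in _ --> X](mulr0 A); apply: cvgM; first exact: cvg_cst.
  rewrite -[X in _ --> X](subrr 1); apply: cvgB; last exact: cvg_cst.
  rewrite -[X in _ --> X]expR0 -[X in expR X](expr0n R 2).
  apply: cvg_at_right_filter.
  apply: (@continuous_comp _ _ _ (fun t : R => t ^+ 2) expR).
    exact: exprn_continuous.
  exact: continuous_expR.
apply: (@squeeze_cvgr _ _ _ _ (fun t => A - h t) (fun t => A + h t)).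
- near=> t.
  have t0 : 0 < t by near: t; exact: nbhs_right_gt.
  rewrite besselJd_posE// expr0 mul1r -ler_distl.
  exact: bessel_entire_near0.
- by rewrite -[X in _ --> X]subr0; apply: cvgB => //; exact: cvg_cst.
- by rewrite -[X in _ --> X]addr0; apply: cvgD => //; exact: cvg_cst.
Unshelve. all: end_near. Qed.

Lemma meval_homogZ k p (c : C) (z : 'I_d -> C) : p \is k.-homog ->
  p.@[fun i => c * z i] = c ^+ k * p.@[z].
Proof.
move=> /dhomogP hp; rewrite !mevalE mulr_sumr !big_seq; apply: eq_bigr => m /hp/= mk.
rewrite mulrCA; congr (_ * _).
rewrite -mk mdegE expr_sum -big_split/=; apply: eq_bigr => i _.
by rewrite exprMn.
Qed.

(* J_{d,k}(kappa |r|) p(r / |r|) for p homogeneous of degree k, in a form that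
   is also correct at r = 0. *)
Definition wave_value (kappa : R) (k : nat) p r : C :=
  (kappa ^+ k * bessel_entire (n := n) k (kappa * enorm r))%:C * p.@[complex_point r].

Lemma enorm_pole : enorm (pole : 'rV[R]_d) = 1.
Proof.
apply/eqP; rewrite -(@pexpr_eq1 _ _ 2)// ?enorm_ge0//.
rewrite enorm_sqr big_ord_recl big1 => [|i _]; first by rewrite mxE expr1n addr0.
by rewrite mxE expr0n.
Qed.

Lemma complex_pointZ t r : complex_point (t *: r) = fun i => t%:C * complex_point r i.
Proof. by apply/funext => i; rewrite /complex_point mxE rmorphM. Qed.

Lemma spherical_waveE kappa k (Y : 'rV[R]_d -> C) p r : 0 < kappa -> p \is k.-homog ->
  (forall x, sphere x -> Y x = p.@[complex_point x]) ->
  spherical_wave kappa k Y r = wave_value kappa k p r.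
Proof.
move=> kappa0 hp Yp; rewrite /spherical_wave /wave_value.
have [->|r0] := eqVneq r 0.
  have e0 : enorm (0 : 'rV[R]_d) = 0 by apply/eqP; rewrite enorm_eq0.
  (* The origin is 0 times [pole], so homogeneity gives p(0) = 0^k p(pole); with 0^0 = 1 this covers
     both conventions of [spherical_wave] at r = 0. *)
  have p0 : p.@[complex_point 0] = 0 ^+ k * p.@[complex_point pole].
    rewrite -meval_homogZ//; apply: meval_eq => i.
    by rewrite /complex_point mxE mul0r.
  rewrite p0 e0 mulr0; case: ifPn => [/eqP k0|k0].
    rewrite k0 !expr0 !mul1r besselJd_ge0E ?eqxx ?orbT// expr0 mul1r Yp//.
    by rewrite /sphere/= enorm_pole.
  by rewrite expr0n (negbTE k0) mul0r mulr0.
have e0 : 0 < enorm r by rewrite lt_def enorm_ge0 enorm_eq0 r0.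
have dS : sphere (direction r).
  by rewrite /sphere/= /direction enormZ ?invr_ge0 ?enorm_ge0// mulVf// gt_eqF.
rewrite (Yp _ dS) /direction complex_pointZ (meval_homogZ _ _ hp).
have ke0 : 0 < kappa * enorm r by rewrite mulr_gt0.
rewrite besselJd_ge0E ?(ltW ke0) ?ke0// mulrA -rmorphXn -rmorphM; congr (_%:C * _).
rewrite exprMn exprVn; field.
by rewrite expf_neq0// gt_eqF.
Qed.

(** The Taylor section of e^(z.x): [N] terms, of degrees below [N]. *)
Definition exp_mpoly (N : nat) (z : 'I_d -> C) : {mpoly C[d]} :=
  \sum_(j < N) (j`!%:R)^-1 *: linear_form z ^+ j.

(** Only the powers j = k + 2l of the linear form contribute, and their j! cancels. Exactly
    [uphalf (N - k)] of them satisfy j < N. The sign (-1)^l of the Bessel series comes from the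
    square -s^2 of [z]. *)
Lemma sphere_functional_exp N (z : 'I_d -> C) (s : R) k p :
  p \is k.-homog -> mlaplacian p = 0 -> \sum_i z i ^+ 2 = (- s ^+ 2)%:C ->
  sphere_functional (exp_mpoly N z * p) =
  (series (bessel_term (n := n) k s) (uphalf (N - k)))%:C * p.@[z].
Proof.
move=> hp p0 zs.
pose L := @sphere_functional R n : {scalar {mpoly C[d]}}.
have LX i : L 'X_i = 0 by exact: sphere_functional_X.
have Lp m q i : q \is m.+1.-homog -> (m + d)%:R * L ('X_i * q) = L q^`M(i).
  exact: sphere_functional_parts.
rewrite -[LHS]/(L (exp_mpoly N z * p)).
elim: N => [|N IH].
  rewrite /exp_mpoly big_ord0 mul0r linear0.
  by rewrite sub0n /series/= big_geq// mul0r.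
rewrite /exp_mpoly big_ord_recr/= mulrDl linearD/= [X in X + _]IH -scalerAl linearZ/=.
have [kN|kN] := boolP ((N < k)%N || odd (N + k)).
  rewrite (linear_formX_harmonic0 _ LX Lp z hp p0 kN)// mulr0 addr0.
  by congr ((series _ _)%:C * _); rewrite !uphalfE; lia.
have [l Nkl] : exists l, N = (k + 2 * l)%N by exists ((N - k)./2); lia.
rewrite Nkl (linear_formX_harmonic _ LX Lp)// zs sphere_coef_bessel.
rewrite (_ : uphalf ((k + 2 * l) - k) = l); last by rewrite uphalfE; lia.
rewrite (_ : uphalf ((k + 2 * l).+1 - k) = l.+1); last by rewrite uphalfE; lia.
rewrite /series/= big_nat_recr//= rmorphD mulrDl; congr (_ + _).
have F0 : (k + 2 * l)`!%:R != 0 :> C by rewrite pnatr_eq0 -lt0n fact_gt0.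
have cancel (X b w c : C) : X != 0 -> X^-1 * (X * b * w * c) = b * w * c.
  by move=> X0; field.
rewrite cancel// -rmorphXn -rmorphM /bessel_term exprM [(- s ^+ 2) ^+ l]exprNn.
by congr (_%:C * _); rewrite mulrCA mulrA.
Qed.

End spherical_waves.

(** * Truncated exponentials *)

Section exp_partial_sums.
Context {F : numFieldType}.
Implicit Types (a b u v : F) (N M : nat).

Definition exp_psum N a : F := \sum_(j < N) a ^+ j / j`!%:R.

Lemma exp_psum_norm_le N M a u : (M <= N)%N -> `|a| <= u ->
  `|exp_psum N a - exp_psum M a| <= exp_psum N u - exp_psum M u.
Proof.
move=> MN au; rewrite /exp_psum -!(big_mkord xpredT (fun j => _ ^+ j / j`!%:R)).
rewrite !(big_cat_nat (n := M) (m := 0) (p := N))//= !(addrC (\sum_(0 <= i < M) _)) !addrK.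
rewrite (le_trans (ler_norm_sum _ _ _))// ler_sum// => j _.
rewrite normrM normrX normfV (ger0_norm (ler0n _ _)) ler_wpM2r ?invr_ge0//.
by rewrite lerXn2r// ?nnegrE ?(le_trans _ au).
Qed.

(** What remains are the pairs i, j < N with i + j >= N; those with i + j < N form the expansion of
    the truncated exponential of a + b. *)
Lemma exp_psumM_defect N a b :
  exp_psum N a * exp_psum N b - exp_psum N (a + b) =
  \sum_(i < N) \sum_(N - i <= j < N) (a ^+ i / i`!%:R) * (b ^+ j / j`!%:R).
Proof.
pose G i j := (a ^+ i / i`!%:R) * (b ^+ j / j`!%:R).
have -> : exp_psum N (a + b) = \sum_(i < N) \sum_(0 <= j < N - i) G i j.
  rewrite /exp_psum; elim: N => [|N IH]; first by rewrite !big_ord0.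
  rewrite big_ord_recr/= IH [in RHS]big_ord_recr/= subSnn big_nat1.
  under [in RHS]eq_bigr => i _ do rewrite subSn ?(ltnW (ltn_ord i))// big_nat_recr//=.
  rewrite big_split/= -addrA; congr (_ + _).
  rewrite (addrC a b) exprDn mulr_suml big_ord_recr/= subnn; congr (_ + _).
    apply: eq_bigr => i _; rewrite /G.
    have iN := ltnW (ltn_ord i).
    have f0 k : k`!%:R != 0 :> F by rewrite pnatr_eq0 -lt0n fact_gt0.
    have B : ('C(N, i))%:R = N`!%:R / (i`!%:R * (N - i)`!%:R) :> F.
      by rewrite -(bin_fact iN) natrM natrM mulfK// mulf_neq0.
    rewrite -mulr_natr B; field.
    by rewrite !f0.
  by rewrite /G binn expr0 mul1r fact0 divr1 mulr1 mulr1n.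
rewrite /exp_psum mulr_suml -sumrB; apply: eq_bigr => i _.
rewrite mulr_sumr -(big_mkord xpredT (fun j => G i j)).
by rewrite (big_cat_nat (n := N - i))//= ?leq_subr// addrAC subrr add0r.
Qed.

(** The defect has nonnegative coefficients in [a] and [b], hence is dominated by its value at [u]
    and [v]. For real [u] and [v] that value tends to 0, by the addition law of the real
    exponential. *)
Lemma exp_psumM_norm_le N a b u v : `|a| <= u -> `|b| <= v ->
  `|exp_psum N a * exp_psum N b - exp_psum N (a + b)| <=
  exp_psum N u * exp_psum N v - exp_psum N (u + v).
Proof.
move=> au bv; rewrite !exp_psumM_defect (le_trans (ler_norm_sum _ _ _))// ler_sum// => i _.
rewrite (le_trans (ler_norm_sum _ _ _))// ler_sum// => j _.
have u0 : 0 <= u by rewrite (le_trans _ au).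
have v0 : 0 <= v by rewrite (le_trans _ bv).
rewrite !normrM !normrX !normfV !(ger0_norm (ler0n _ _)).
by rewrite ler_pM ?mulr_ge0 ?invr_ge0 ?exprn_ge0// ler_wpM2r ?invr_ge0// lerXn2r// nnegrE.
Qed.

End exp_partial_sums.

Section exp_waves.
Context {R : realType} {n : nat}.
Local Notation d := n.+1.
Local Notation C := R[i].
Local Notation A := (@sphere_area R n).
Implicit Types (r x : 'rV[R]_d) (p q : {mpoly C[d]}).

Lemma exp_psum_real N (u : R) : exp_psum N u%:C = (exp_psum N u)%:C :> C.
Proof.
rewrite /exp_psum [RHS]rmorph_sum; apply: eq_bigr => j _.
by rewrite rmorphM rmorphXn fmorphV rmorph_nat.
Qed.

Lemma exp_psum_series N (u : R) : exp_psum N u = series (exp_coeff u) N.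
Proof. by rewrite /exp_psum /series/= big_mkord. Qed.

Lemma exp_psum_le_expR N (u : R) : 0 <= u -> exp_psum N u <= expR u.
Proof.
move=> u0; rewrite exp_psum_series; apply: nondecreasing_cvgn_le.
  by apply: nondecreasing_series => i _ _; exact: exp_coeff_ge0.
exact: is_cvg_series_exp_coeff.
Qed.

Lemma cvg_exp_psum (u : R) : exp_psum N u @[N --> \oo] --> expR u.
Proof. by under eq_fun do rewrite exp_psum_series; exact: is_cvg_series_exp_coeff. Qed.

(** The vector i kappa r, for which e^(z.x) is the plane wave in the direction [r]. *)
Definition wave_vector (kappa : R) r : 'I_d -> C := fun i => ('i * kappa%:C) * complex_point r i.

Lemma dot_sphere_le r x : sphere x -> `|\sum_i r ord0 i * x ord0 i| <= enorm r.
Proof.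
move=> sx; set t := \sum_i _.
have e (c : R) : \sum_i (r ord0 i - c * x ord0 i) ^+ 2 =
    enorm r ^+ 2 - 2 * c * (\sum_i r ord0 i * x ord0 i) + c ^+ 2 * enorm x ^+ 2.
  rewrite !enorm_sqr !mulr_sumr -sumrB -big_split/=.
  by apply: eq_bigr => i _; ring.
have : 0 <= \sum_i (r ord0 i - t * x ord0 i) ^+ 2 by apply: sumr_ge0 => i _; exact: sqr_ge0.
rewrite e -/t [enorm x]sx (_ : _ + _ = enorm r ^+ 2 - t ^+ 2); last by ring.
rewrite subr_ge0 => h.
by rewrite -(@ler_pXn2r _ 2) ?nnegrE ?enorm_ge0// -normrX ger0_norm ?sqr_ge0.
Qed.

Lemma norm_wave_vector kappa r x : 0 <= kappa -> sphere x ->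
  `|\sum_i wave_vector kappa r i * complex_point x i| <= (kappa * enorm r)%:C.
Proof.
move=> k0 sx.
have -> : \sum_i wave_vector kappa r i * complex_point x i =
    'i * kappa%:C * (\sum_i r ord0 i * x ord0 i)%:C.
  rewrite [X in _ * X]rmorph_sum mulr_sumr; apply: eq_bigr => i _.
  by rewrite /wave_vector /complex_point rmorphM mulrA.
rewrite normrM normrM normCi mul1r !normc_real -rmorphM lecR (ger0_norm k0).
by rewrite ler_wpM2l// dot_sphere_le.
Qed.

Lemma meval_exp_mpoly N (z : 'I_d -> C) x :
  (exp_mpoly N z).@[complex_point x] = exp_psum N (\sum_i z i * complex_point x i).
Proof.
rewrite /exp_mpoly raddf_sum; apply: eq_bigr => j _ /=.
rewrite mevalZ rmorphXn/= mulrC; congr (_ ^+ _ / _).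
by rewrite /linear_form raddf_sum; apply: eq_bigr => i _ /=; rewrite mevalZ mevalXU.
Qed.

Lemma sphere_ip_le p (B : R) : (forall x, sphere x -> `|p.@[complex_point x]| <= B%:C) ->
  sphere_ip p p <= (A * B ^+ 2)%:C.
Proof.
move=> pB; rewrite sphere_ipE.
have -> : (A * B ^+ 2)%:C = sphere_functional ((B ^+ 2)%:C *: (1 : {mpoly C[d]})).
  rewrite sphere_functionalZ sphere_functional1 -rmorphM; congr _%:C.
  exact: mulrC.
apply: le_sphere_functional => x /pB h.
rewrite mevalM meval_conj_real mevalZ meval1 mulr1 -sqr_normc rmorphXn.
by rewrite lerXn2r// nnegrE// (le_trans _ h).
Qed.

Lemma sphere_area_gt0 : 0 < A.
Proof.
rewrite /sphere_area mulr_gt0 ?exprn_gt0 ?sqrtr_gt0 ?pi_gt0// divr_gt0//.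
exact: (@Gamma_half_gt0 R d).
Qed.

Lemma sphere_ip11 : sphere_ip (1 : {mpoly C[d]}) 1 = A%:C.
Proof.
rewrite sphere_ipE -mpolyX0 conj_mpolyX mpolyX0 mulr1.
exact: sphere_functional1.
Qed.

Lemma norm_le_of_sqr (z : C) (b : R) : 0 <= b -> `|z| ^+ 2 <= (b ^+ 2)%:C -> `|z| <= b%:C.
Proof.
move=> b0; rewrite rmorphXn => h.
by rewrite -(@ler_pXn2r _ 2)// nnegrE ?normr_ge0// ler0c.
Qed.

(** Cauchy-Schwarz against the constant 1, whose squared norm is the area [A]. *)
Lemma norm_sphere_functional_le p (B : R) : 0 <= B ->
  (forall x, sphere x -> `|p.@[complex_point x]| <= B%:C) ->
  `|sphere_functional p| <= (A * B)%:C.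
Proof.
move=> B0 pB; have A0 := sphere_area_gt0.
have -> : sphere_functional p = sphere_ip p 1.
  by rewrite sphere_ipE -mpolyX0 conj_mpolyX mpolyX0 mulr1.
have AC : 0 < A%:C by rewrite ltcR.
have := @sphere_ip_cauchy R n p 1 A%:C AC; rewrite sphere_ip11 => /(_ (lexx _)) h.
apply: norm_le_of_sqr; first by rewrite mulr_ge0// ltW.
apply: (le_trans h); rewrite (_ : (A * B) ^+ 2 = A * (A * B ^+ 2)); last by ring.
have -> : (A * (A * B ^+ 2))%:C = A%:C * (A * B ^+ 2)%:C by exact: rmorphM.
apply: ler_wpM2l; first exact: ltW.
exact: sphere_ip_le.
Qed.

Lemma cvg_complex_norm_le (f : nat -> C) (a : C) (c : R) :
  (f : nat -> R[i]^o) @ \oo --> (a : R[i]^o) ->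
  (\forall N \near \oo, `|f N| <= c%:C) -> `|a| <= c%:C.
Proof.
move=> /cvg_complexP fa fc; rewrite normc_def lecR; apply/ler_addgt0Pr => e e0.
rewrite -lecR -normc_def.
have [N [h1 h2]] : exists N, `|f N| <= c%:C /\ `|f N - a| <= e%:C.
  have h := filterI fc (fa _ e0).
  by have [N _ /(_ N (leqnn _))[? ?]] := h; exists N.
rewrite (_ : a = f N - (f N - a)); last by rewrite opprB addrC subrK.
by rewrite rmorphD (le_trans (ler_normB _ _))// lerD.
Qed.

Lemma cvg_sphere_functional_exp (z : 'I_d -> C) (s : R) k p :
  p \is k.-homog -> mlaplacian p = 0 -> \sum_i z i ^+ 2 = (- s ^+ 2)%:C ->
  ((fun N => sphere_functional (exp_mpoly N z * p)) : nat -> R[i]^o) @ \oo -->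
  ((bessel_entire (n := n) k s)%:C * p.@[z] : R[i]^o).
Proof.
move=> hp p0 zs.
rewrite (_ : (fun N => _) = fun N =>
    (series (bessel_term (n := n) k s) (uphalf (N - k)))%:C * p.@[z]); last first.
  by apply/funext => N; exact: sphere_functional_exp.
apply: cvg_complexM; last exact: cvg_cst.
apply: cvg_real_complex.
have h : (fun N => uphalf (N - k)) @ \oo --> \oo.
  apply/cvgnyPge => B; exists (k + 2 * B)%N => //= N /= BN.
  by rewrite uphalfE; lia.
exact: (cvg_comp _ _ h (@cvg_series_bessel_term R n k s)).
Qed.

Lemma wave_vector_sqr kappa r : \sum_i wave_vector kappa r i ^+ 2 = (- (kappa * enorm r) ^+ 2)%:C.
Proof.
rewrite exprMn enorm_sqr rmorphN rmorphM [X in _ * X]rmorph_sum mulr_sumr -sumrN.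
apply: eq_bigr => i _; rewrite /wave_vector !exprMn sqrCi mulN1r mulNr.
by rewrite /complex_point !rmorphXn.
Qed.

(** The factor i^k arises from evaluating the conjugate of [p], homogeneous of degree [k], at i
    kappa r. *)
Lemma cvg_exp_wave_ip kappa r k p : p \is k.-homog -> mlaplacian p = 0 ->
  ((fun N => sphere_ip (exp_mpoly N (wave_vector kappa r)) p) : nat -> R[i]^o) @ \oo -->
  ('i ^+ k * wave_value kappa k (conj_mpoly p) r : R[i]^o).
Proof.
move=> hp p0; have hc := conj_homog hp.
have c0 : mlaplacian (conj_mpoly p) = 0.
  by rewrite mlaplacian_conj p0; apply/mpolyP => m; rewrite mcoeff_conj mcoeff0 conjc0.
have := cvg_sphere_functional_exp hc c0 (wave_vector_sqr kappa r).
have -> : (bessel_entire (n := n) k (kappa * enorm r))%:C *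
    (conj_mpoly p).@[wave_vector kappa r] = 'i ^+ k * wave_value kappa k (conj_mpoly p) r.
  rewrite (meval_homogZ _ _ hc) /wave_value.
  have -> (u v : R) : (u ^+ k * v)%:C = u%:C ^+ k * v%:C.
    by rewrite [LHS]rmorphM [X in X * _]rmorphXn.
  by rewrite exprMn -!mulrA mulrCA; congr (_ * _); rewrite mulrCA.
rewrite (_ : (fun N => sphere_ip _ _) =
  fun N => sphere_functional (exp_mpoly N (wave_vector kappa r) * conj_mpoly p))//.
by apply/funext => N; rewrite sphere_ipE.
Qed.

End exp_waves.

HB.lock Definition exp_wave (R : realType) (n : nat) (kappa : R) (N : nat)
    (r : 'rV[R]_n.+1) : {mpoly R[i][n.+1]} :=
  exp_mpoly N (wave_vector kappa r).

Section exp_wave_limits.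
Context {R : realType} {n : nat}.
Local Notation d := n.+1.
Local Notation C := R[i].
Local Notation A := (@sphere_area R n).
Implicit Types (r x : 'rV[R]_d) (p q s : {mpoly C[d]}).
Variable kappa : R.
Hypothesis kappa_gt0 : 0 < kappa.

Lemma exp_waveE N r : exp_wave kappa N r = exp_mpoly N (wave_vector kappa r).
Proof. by rewrite unlock. Qed.

Lemma meval_exp_wave N r x : (exp_wave kappa N r).@[complex_point x] =
  exp_psum N (\sum_i wave_vector kappa r i * complex_point x i).
Proof. by rewrite exp_waveE; exact: meval_exp_mpoly. Qed.

Lemma conjc_exp_psum N (w : C) : conjc (exp_psum N w) = exp_psum N (conjc w).
Proof.
rewrite /exp_psum rmorph_sum; apply: eq_bigr => j _.
by rewrite rmorphM rmorphXn fmorphV rmorph_nat.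
Qed.

Lemma meval_mul_conjB p q s x : (p * conj_mpoly q - s * 1).@[complex_point x] =
  p.@[complex_point x] * conjc q.@[complex_point x] - s.@[complex_point x].
Proof. by rewrite mulr1 mevalB mevalM meval_conj_real. Qed.

Lemma wave_vectorD r r' x :
  \sum_i wave_vector kappa (r + r') i * complex_point x i =
  \sum_i wave_vector kappa r i * complex_point x i +
  \sum_i wave_vector kappa r' i * complex_point x i.
Proof.
rewrite -big_split; apply: eq_bigr => i _.
by rewrite /wave_vector /complex_point mxE rmorphD mulrDr mulrDl.
Qed.

Lemma wave_vectorN r x :
  \sum_i wave_vector kappa (- r) i * complex_point x i =
  conjc (\sum_i wave_vector kappa r i * complex_point x i).
Proof.
have -> : conjc (\sum_i wave_vector kappa r i * complex_point x i) =
    \sum_i conjc (wave_vector kappa r i * complex_point x i) by exact: rmorph_sum.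
apply: eq_bigr => i _; rewrite /wave_vector /complex_point mxE !conjcM !conjc_real rmorphN mulrN.
have -> : conjc ('i : C) = - 'i by exact: conjCi.
by rewrite !mulNr.
Qed.

(** On the sphere, the product of the section for r' and the conjugate of that for r differs from
    the section for r' - r by at most [eta N], uniformly. The latter, tested against the harmonic
    polynomial 1, converges to J_{d,0}. *)
Lemma cvg_exp_wave_ip2 r r' :
  ((fun N => sphere_ip (exp_wave kappa N r') (exp_wave kappa N r)) : nat -> R[i]^o) @ \oo -->
  ((bessel_entire (n := n) 0 (kappa * enorm (r' - r)))%:C : R[i]^o).
Proof.
have h1 : (1 : {mpoly C[d]}) \is 0.-homog by exact: dhomog1.
have l1 : mlaplacian (1 : {mpoly C[d]}) = 0 by apply: (mlaplacian_homog1 h1).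
have c1 := cvg_sphere_functional_exp h1 l1 (wave_vector_sqr kappa (r' - r)).
rewrite meval1 mulr1 in c1.
have {}c1 : ((fun N => sphere_functional (exp_wave kappa N (r' - r) * 1)) : nat -> R[i]^o) @ \oo -->
    ((bessel_entire (n := n) 0 (kappa * enorm (r' - r)))%:C : R[i]^o).
  by under eq_fun do rewrite exp_waveE.
pose u := kappa * enorm r'; pose v := kappa * enorm r.
have u0 : 0 <= u by rewrite mulr_ge0 ?enorm_ge0 ?(ltW kappa_gt0).
have v0 : 0 <= v by rewrite mulr_ge0 ?enorm_ge0 ?(ltW kappa_gt0).
pose eta N := exp_psum N u * exp_psum N v - exp_psum N (u + v).
have eta0 : (A * eta N) @[N --> \oo] --> 0.
  rewrite -[X in _ --> X](mulr0 A); apply: cvgM; first exact: cvg_cst.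
  rewrite -[X in _ --> X](subrr (expR (u + v))) [X in X - _]expRD.
  by apply: cvgB; [apply: cvgM|]; exact: cvg_exp_psum.
have bound N : `|sphere_ip (exp_wave kappa N r') (exp_wave kappa N r) -
    sphere_functional (exp_wave kappa N (r' - r) * 1)| <= (A * eta N)%:C.
  rewrite sphere_ipE.
  have -> : sphere_functional (exp_wave kappa N r' * conj_mpoly (exp_wave kappa N r)) -
      sphere_functional (exp_wave kappa N (r' - r) * 1) =
      sphere_functional (exp_wave kappa N r' * conj_mpoly (exp_wave kappa N r) - exp_wave kappa N (r' - r) * 1).
    by rewrite [RHS]linearB.
  have bnd x : sphere x -> `|(exp_wave kappa N r' * conj_mpoly (exp_wave kappa N r)
      - exp_wave kappa N (r' - r) * 1).@[complex_point x]| <= (eta N)%:C.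
    move=> sx.
    have -> : (exp_wave kappa N r' * conj_mpoly (exp_wave kappa N r) - exp_wave kappa N (r' - r) * 1).@[complex_point x] =
        (exp_wave kappa N r').@[complex_point x] * conjc (exp_wave kappa N r).@[complex_point x] -
        (exp_wave kappa N (r' - r)).@[complex_point x].
      exact: meval_mul_conjB.
    have -> : (eta N)%:C = exp_psum N u%:C * exp_psum N v%:C - exp_psum N (u%:C + v%:C).
      have -> : u%:C + v%:C = (u + v)%:C by exact/esym/rmorphD.
      rewrite !exp_psum_real.
      have -> : (exp_psum N u)%:C * (exp_psum N v)%:C = (exp_psum N u * exp_psum N v)%:C :> C.
        exact/esym/rmorphM.
      exact: rmorphB.
    have E (s : 'rV[R]_d) : (exp_wave kappa N s).@[complex_point x] = exp_psum N (\sum_i wave_vector kappa s i * complex_point x i).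
      exact: meval_exp_wave.
    rewrite (E r') (E r) (E (r' - r)) conjc_exp_psum -(wave_vectorN r x) (wave_vectorD r' (- r) x).
    apply: exp_psumM_norm_le; first exact: (norm_wave_vector _ (ltW kappa_gt0) sx).
    by rewrite (wave_vectorN r x) normcJ; exact: (norm_wave_vector _ (ltW kappa_gt0) sx).
  apply: norm_sphere_functional_le => //.
  (* The norm bound at any one point of the sphere shows that [eta N] is nonnegative. *)
  have S0 : sphere (pole : 'rV[R]_d) by rewrite /sphere/= enorm_pole.
  by rewrite -ler0c (le_trans _ (bnd _ S0)).
have c2 : ((fun N => sphere_ip (exp_wave kappa N r') (exp_wave kappa N r) -
    sphere_functional (exp_wave kappa N (r' - r) * 1)) : nat -> R[i]^o) @ \oo --> (0 : R[i]^o).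
  apply/cvg_complexP => e e0; move/cvgrPdist_le: eta0 => /(_ e e0).
  apply: filterS => N; rewrite sub0r normrN => h; rewrite subr0.
  by apply: (le_trans (bound N)); rewrite lecR (le_trans (ler_norm _) h).
have c := cvgD c2 c1; rewrite add0r in c.
rewrite (_ : (fun N => sphere_ip (exp_wave kappa N r') (exp_wave kappa N r)) =
  (fun N => (sphere_ip (exp_wave kappa N r') (exp_wave kappa N r) -
      sphere_functional (exp_wave kappa N (r' - r) * 1)) +
    sphere_functional (exp_wave kappa N (r' - r) * 1))); first exact: c.
apply/funext => N; symmetry; exact: subrK.
Qed.

(** A bound independent of [N], so that [N] can tend to infinity while the number of degrees is
    fixed. *)
Lemma exp_wave_ip_le N r : sphere_ip (exp_wave kappa N r) (exp_wave kappa N r) <=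
  (A * expR (kappa * enorm r) ^+ 2)%:C.
Proof.
apply: sphere_ip_le => x sx; rewrite meval_exp_wave.
have u0 : 0 <= kappa * enorm r by rewrite mulr_ge0 ?enorm_ge0 ?(ltW kappa_gt0).
have := exp_psum_norm_le (leq0n N) (norm_wave_vector r (ltW kappa_gt0) sx).
rewrite ![exp_psum 0 _]big_ord0 !subr0 exp_psum_real => h.
by apply: (le_trans h); rewrite lecR exp_psum_le_expR.
Qed.

Lemma exp_waveB_ip_le M N r : (M <= N)%N ->
  sphere_ip (exp_wave kappa N r - exp_wave kappa M r) (exp_wave kappa N r - exp_wave kappa M r) <=
  (A * (expR (kappa * enorm r) - exp_psum M (kappa * enorm r)) ^+ 2)%:C.
Proof.
move=> MN; apply: sphere_ip_le => x sx; rewrite mevalB !meval_exp_wave.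
have u0 : 0 <= kappa * enorm r by rewrite mulr_ge0 ?enorm_ge0 ?(ltW kappa_gt0).
have h := exp_psum_norm_le MN (norm_wave_vector r (ltW kappa_gt0) sx).
by apply: (le_trans h); rewrite !exp_psum_real -rmorphB lecR lerB// exp_psum_le_expR.
Qed.

End exp_wave_limits.

(** * The addition theorem *)

Lemma cvg_complexD (R : realType) (f g : nat -> R[i]) (a b : R[i]) :
  (f : nat -> R[i]^o) @ \oo --> (a : R[i]^o) -> (g : nat -> R[i]^o) @ \oo --> (b : R[i]^o) ->
  ((fun N => f N + g N) : nat -> R[i]^o) @ \oo --> (a + b : R[i]^o).
Proof. by move=> fa gb; exact: (@cvgD _ (R[i]^o) _ _ _ (f : nat -> R[i]^o) (g : nat -> R[i]^o) a b fa gb). Qed.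

Lemma cvg_complex_sum (R : realType) (I : Type) (s : seq I) (f : I -> nat -> R[i])
    (a : I -> R[i]) :
  (forall i, (f i : nat -> R[i]^o) @ \oo --> (a i : R[i]^o)) ->
  ((fun N => \sum_(i <- s) f i N) : nat -> R[i]^o) @ \oo --> (\sum_(i <- s) a i : R[i]^o).
Proof.
move=> fa; elim: s => [|i s IH].
  by under eq_fun do rewrite big_nil; rewrite big_nil; exact: cvg_cst.
rewrite big_cons (_ : (fun N => _) = fun N => f i N + \sum_(j <- s) f j N).
  exact: (cvg_complexD (fa i) IH).
by apply/funext => N; exact: big_cons.
Qed.

Section wave_series.
Context {R : realType} {n : nat}.
Local Notation d := n.+1.
Local Notation C := R[i].
Local Notation A := (@sphere_area R n).
Implicit Types (r x : 'rV[R]_d) (p q g t : {mpoly C[d]}).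
Variables (kappa : R) (dimY : nat -> nat).
Variable y : forall k, 'I_(dimY k) -> {mpoly C[d]}.
Hypothesis kappa_gt0 : 0 < kappa.
Hypothesis y_homog : forall k (m : 'I_(dimY k)), y m \is k.-homog.
Hypothesis y_harmonic : forall k (m : 'I_(dimY k)), mlaplacian (y m) = 0.
Hypothesis y_ortho : forall k (m m' : 'I_(dimY k)), sphere_ip (y m) (y m') = (m == m')%:R.
Hypothesis y_span : forall k h, h \is k.-homog -> mlaplacian h = 0 ->
  exists c : 'I_(dimY k) -> C, forall x, sphere x ->
    h.@[complex_point x] = \sum_m c m * (y m).@[complex_point x].

Lemma mlaplacian_conj0 p : mlaplacian p = 0 -> mlaplacian (conj_mpoly p) = 0.
Proof.
by move=> p0; rewrite mlaplacian_conj p0; apply/mpolyP => m; rewrite mcoeff_conj mcoeff0 conjc0.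
Qed.

Lemma sphere_ip_degrees k l p q : p \is k.-homog -> q \is l.-homog ->
  mlaplacian p = 0 -> mlaplacian q = 0 -> k != l -> sphere_ip p q = 0.
Proof.
move=> hp hq p0 q0 kl; rewrite sphere_ipE.
pose L := @sphere_functional R n : {scalar {mpoly C[d]}}.
have LX i : L 'X_i = 0 by exact: sphere_functional_X.
have Lp m u i : u \is m.+1.-homog -> (m + d)%:R * L ('X_i * u) = L u^`M(i).
  exact: sphere_functional_parts.
have hc := conj_homog hq; have c0 := mlaplacian_conj0 q0.
exact: (harmonic_ortho (ltn0Sn n) LX Lp hp hc p0 c0 kl).
Qed.

Definition harmonic_index M : finType := {k : 'I_M & 'I_(dimY k)}.

Definition harmonic_family M (s : harmonic_index M) : {mpoly C[d]} := y (tagged s).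

Lemma harmonic_family_ortho M (s s' : harmonic_index M) :
  sphere_ip (harmonic_family s) (harmonic_family s') = (s == s')%:R.
Proof.
case: s s' => [k m] [k' m']; rewrite /harmonic_family/=.
have [kk|kk] := eqVneq k k'.
  rewrite -kk in m' *; rewrite y_ortho; congr (nat_of_bool _)%:R.
  by rewrite -tag_eqE /tag_eq/= eqxx tagged_asE.
rewrite (sphere_ip_degrees (y_homog m) (y_homog m') (y_harmonic m) (y_harmonic m')) //.
by rewrite -tag_eqE /tag_eq/= (negbTE kk).
Qed.

Lemma harmonic_family_span M k h : (k < M)%N -> h \is k.-homog -> mlaplacian h = 0 ->
  exists c : harmonic_index M -> C, forall x, sphere x ->
    h.@[complex_point x] = (\sum_s c s *: harmonic_family s).@[complex_point x].
Proof.
move=> kM hh h0; have [c hc] := y_span hh h0.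
pose k0 := Ordinal kM.
(* The coefficients [c] in degree [k] and 0 in the other degrees; the type of the index depends on
   the degree, so [c] is transported along the equality j = k0. *)
pose c' (j : 'I_M) (m : 'I_(dimY j)) : C :=
  if eqP is ReflectT e in reflect _ b return C then c (cast_ord (congr1 (fun i : 'I_M => dimY i) (e : j = k0)) m) else 0.
exists (fun s => c' (tag s) (tagged s)) => x sx.
rewrite (hc x sx).
have -> : (\sum_s c' (tag s) (tagged s) *: harmonic_family s).@[complex_point x] =
    \sum_(s : harmonic_index M) c' (tag s) (tagged s) * (y (tagged s)).@[complex_point x].
  by rewrite [LHS]raddf_sum; apply: eq_bigr => s _; exact: mevalZ.
rewrite -(sig_big_dep xpredT (fun _ => xpredT) (fun (j : 'I_M) (m : 'I_(dimY j)) => c' j m * (y m).@[complex_point x])).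
rewrite (bigD1 k0)//= [X in _ + X]big1 ?addr0.
  apply: eq_bigr => m _; congr (_ * _).
  rewrite /c'; case: eqP => [e|]//; congr c; exact/esym/val_inj.
move=> j jk; rewrite big1// => m _; rewrite /c'.
by case: eqP => [e|_]; [rewrite e eqxx in jk|rewrite mul0r].
Qed.

Definition wave_term k (m : 'I_(dimY k)) r r' : C :=
  wave_value kappa k (y m) r * wave_value kappa k (conj_mpoly (y m)) r'.

Definition wave_psum M r r' : C := \sum_(k < M) \sum_(m < dimY k) wave_term m r r'.

Lemma parseval_defect_suml M (I : finType) (F : I -> {mpoly C[d]}) g :
  (forall i, parseval_defect (@harmonic_family M) (F i) g = 0) ->
  parseval_defect (@harmonic_family M) (\sum_i F i) g = 0.
Proof.
move=> F0; elim/big_rec: _ => [|i t _ IH]; last by rewrite parseval_defectD F0 IH addr0.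
by rewrite -(scale0r 0) parseval_defectZ mul0r.
Qed.

(** The section of M terms has degrees below M only, and there the family spans all harmonic
    polynomials on the sphere. *)
Lemma parseval_defect_wave0 M r g :
  parseval_defect (@harmonic_family M) (exp_wave kappa M r) g = 0.
Proof.
rewrite exp_waveE /exp_mpoly; apply: parseval_defect_suml => j.
rewrite parseval_defectZ.
rewrite (@parseval_defect_homog0 R n _ _ M (@harmonic_family_ortho M) (@harmonic_family_span M) j) ?mulr0//.
by rewrite -[X in X.-homog]mul1n; exact/dhomogMn/linear_form_homog.
Qed.

(** The section of M terms has no defect, so it can be subtracted from that of N terms. The
    difference is bounded by the tail of the real exponential, and [parseval_defect_bound]
    concludes. *)
Lemma parseval_defect_wave_le M N r r' : (M <= N)%N ->
  `|parseval_defect (@harmonic_family M) (exp_wave kappa N r') (exp_wave kappa N r)| <=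
  (A * expR (kappa * enorm r) * (expR (kappa * enorm r') - exp_psum M (kappa * enorm r')))%:C.
Proof.
move=> MN; set x := exp_wave _ _ _; set x0 := exp_wave kappa M r'.
set b := expR (kappa * enorm r); set dl := _ - exp_psum _ _.
have A0 := @sphere_area_gt0 R n.
have u0 : 0 <= kappa * enorm r' by rewrite mulr_ge0 ?enorm_ge0 ?(ltW kappa_gt0).
have dl0 : 0 <= dl by rewrite subr_ge0 exp_psum_le_expR.
have b0 : 0 < b := expR_gt0 _.
have -> : parseval_defect (@harmonic_family M) x (exp_wave kappa N r) =
    parseval_defect (@harmonic_family M) (x - x0) (exp_wave kappa N r).
  rewrite -{1}(subrK x0 x) [LHS]parseval_defectD.
  by rewrite [X in _ + X](parseval_defect_wave0 M r') addr0.
apply: norm_le_of_sqr.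
  exact: mulr_ge0 (mulr_ge0 (ltW A0) (ltW b0)) dl0.
have K0 : 0 < (A * b ^+ 2)%:C by rewrite ltcR mulr_gt0// exprn_gt0.
have h := parseval_defect_bound (@harmonic_family_ortho M) (x - x0) K0 (exp_wave_ip_le kappa_gt0 N r).
apply: (le_trans h).
have h2 := exp_waveB_ip_le kappa_gt0 r' MN.
have -> : ((A * b * dl) ^+ 2)%:C = (A * b ^+ 2)%:C * (A * dl ^+ 2)%:C :> C.
  have -> : (A * b * dl) ^+ 2 = (A * b ^+ 2) * (A * dl ^+ 2) by ring.
  exact: rmorphM.
by apply: ler_wpM2l; [exact: ltW|exact: h2].
Qed.

(** The coefficient of r' carries i^k, that of r its conjugate (-i)^k, and their product is 1. The
    conjugations also move the bar onto the harmonic at r'. *)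
Lemma cvg_parseval_term k (m : 'I_(dimY k)) r r' :
  ((fun N => sphere_ip (exp_wave kappa N r') (y m) * sphere_ip (y m) (exp_wave kappa N r))
    : nat -> R[i]^o) @ \oo --> (wave_term m r r' : R[i]^o).
Proof.
have h s : ((fun N => sphere_ip (exp_wave kappa N s) (y m)) : nat -> R[i]^o) @ \oo -->
    ('i ^+ k * wave_value kappa k (conj_mpoly (y m)) s : R[i]^o).
  under eq_fun do rewrite exp_waveE.
  exact: cvg_exp_wave_ip.
have h2 := cvg_conjc (h r).
have := cvg_complexM (h r') h2.
have -> : (fun N => sphere_ip (exp_wave kappa N r') (y m) * conjc (sphere_ip (exp_wave kappa N r) (y m))) =
    (fun N => sphere_ip (exp_wave kappa N r') (y m) * sphere_ip (y m) (exp_wave kappa N r)).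
  by apply/funext => N; rewrite -(sphere_ipC (exp_wave kappa N r) (y m)).
congr (_ --> _); rewrite /wave_term.
have -> : conjc ('i ^+ k * wave_value kappa k (conj_mpoly (y m)) r) =
    (- 'i) ^+ k * wave_value kappa k (y m) r.
  rewrite conjcM; congr (_ * _).
    by have -> : - 'i = conjc 'i :> C; [exact/esym/conjCi|exact: rmorphXn].
  rewrite /wave_value conjcM conjc_real; congr (_ * _).
  by rewrite meval_conj_real conjcK.
have i1 : 'i ^+ k * (- 'i) ^+ k = 1 :> C.
  by rewrite -exprMn mulrN -expr2 sqrCi opprK expr1n.
by rewrite mulrACA i1 mul1r mulrC.
Qed.

Lemma cvg_parseval_defect M r r' :
  ((fun N => parseval_defect (@harmonic_family M) (exp_wave kappa N r') (exp_wave kappa N r))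
    : nat -> R[i]^o) @ \oo -->
  ((bessel_entire (n := n) 0 (kappa * enorm (r' - r)))%:C - wave_psum M r r' : R[i]^o).
Proof.
rewrite /parseval_defect; apply: cvgB; first exact: cvg_exp_wave_ip2.
rewrite /wave_psum (sig_big_dep xpredT (fun _ => xpredT) (fun (k : 'I_M) (m : 'I_(dimY k)) => wave_term m r r')).
by apply: cvg_complex_sum => s; exact: cvg_parseval_term.
Qed.

(** The limit N -> oo of the bound on the defect, whose right side is free of [N]; that right side
    then tends to 0 with growing [M]. *)
Lemma wave_psum_le M r r' :
  `|(bessel_entire (n := n) 0 (kappa * enorm (r' - r)))%:C - wave_psum M r r'| <=
  (A * expR (kappa * enorm r) * (expR (kappa * enorm r') - exp_psum M (kappa * enorm r')))%:C.
Proof.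
apply: (cvg_complex_norm_le (@cvg_parseval_defect M r r')).
by exists M => // N /= MN; exact: parseval_defect_wave_le.
Qed.

Lemma cvg_wave_psum r r' : ((fun M => wave_psum M r r') : nat -> R[i]^o) @ \oo -->
  ((bessel_entire (n := n) 0 (kappa * enorm (r' - r)))%:C : R[i]^o).
Proof.
set c := A * expR (kappa * enorm r).
have h : (c * (expR (kappa * enorm r') - exp_psum M (kappa * enorm r'))) @[M --> \oo] --> 0.
  rewrite -[X in _ --> X](mulr0 c); apply: cvgM; first exact: cvg_cst.
  rewrite -[X in _ --> X](subrr (expR (kappa * enorm r'))); apply: cvgB; first exact: cvg_cst.
  exact: cvg_exp_psum.
apply/cvg_complexP => e e0; move/cvgrPdist_le: h => /(_ e e0).
apply: filterS => M; rewrite sub0r normrN => h; rewrite distrC.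
by apply: (le_trans (wave_psum_le M r r')); rewrite lecR (le_trans (ler_norm _) h).
Qed.

End wave_series.

Theorem mainTheorem3 (R : realType) (d : nat) (hd : (1 <= d)%N)
    (k : R) (hk : 0 < k)
    (dimY : nat -> nat)
    (Y : forall n : nat, 'I_(dimY n) -> 'rV[R]_d -> R[i])
    (hY : forall n : nat, orthonormal_basis n (Y n))
    (r r' : 'rV[R]_d) :
  ((fun M : nat => \sum_(n < M) \sum_(m < dimY n)
      spherical_wave k n (Y n m) r *
      spherical_wave k n (fun x => (Y n m x)^*) r') : nat -> R[i]^o) @ \oo
  --> ((besselJd d 0 (k * enorm (r - r')))%:C : R[i]^o).
Proof.
case: d hd Y hY r r' => // d _ Y hY r r'.
(* The functions Y are only known on the sphere; representing polynomials are chosen, since the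
   argument evaluates them at complex points as well. *)
have /all_sig[y yP] j : {y : 'I_(dimY j) -> {mpoly R[i][d.+1]} | forall m,
    [/\ y m \is j.-homog, mlaplacian (y m) = 0 &
        forall x, sphere x -> Y j m x = (y m).@[complex_point x]]}.
  have [H _ _ _] := hY j.
  by exists (fun m => projT1 (cid (H m))) => m; exact: projT2 (cid (H m)).
have y_homog j (m : 'I_(dimY j)) : y j m \is j.-homog by have [] := yP j m.
have y_harm j (m : 'I_(dimY j)) : mlaplacian (y j m) = 0 by have [] := yP j m.
have yE j (m : 'I_(dimY j)) x : sphere x -> Y j m x = (y j m).@[complex_point x].
  by have [_ _] := yP j m; exact.
have y_ortho j (m m' : 'I_(dimY j)) : sphere_ip (y j m) (y j m') = (m == m')%:R.
  have [_ _ _ <-] := hY j; rewrite sphere_ipE; apply: eq_sphere_integral => x sx.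
  by rewrite (yE j m x sx) (yE j m' x sx) mevalM meval_conj_real.
have y_span j h : h \is j.-homog -> mlaplacian h = 0 ->
    exists c : 'I_(dimY j) -> R[i], forall x, sphere x ->
      h.@[complex_point x] = \sum_m c m * (y j m).@[complex_point x].
  move=> hh h0; have [_ _ S _] := hY j.
  have [|c hc] := S (fun x => h.@[complex_point x]); first by exists h.
  exists c => x sx; rewrite (hc x sx); apply: eq_bigr => m _.
  by rewrite (yE j m x sx).
have := @cvg_wave_psum R d k dimY y hk y_homog y_harm y_ortho y_span r r'.
(* The proof pairs the wave of r' with that of r, which yields r' - r; only the norm matters. *)
have <- : besselJd d.+1 0 (k * enorm (r - r')) =
    bessel_entire (n := d) 0 (k * enorm (r' - r)).
  have -> : enorm (r' - r) = enorm (r - r').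
    rewrite /enorm; congr Num.sqrt; apply: eq_bigr => i _.
    by rewrite !mxE -sqrrN opprB.
  by rewrite besselJd_ge0E ?eqxx ?orbT ?expr0 ?mul1r// mulr_ge0 ?enorm_ge0// ltW.
rewrite (_ : (fun M => wave_psum _ _ _ _ _) = fun M : nat => \sum_(n < M) \sum_(m < dimY n)
      spherical_wave k n (Y n m) r *
      spherical_wave k n (fun x => (Y n m x)^*) r')//.
apply/funext => M; apply: eq_bigr => j _; apply: eq_bigr => m _.
rewrite /wave_term; congr (_ * _); symmetry; apply: spherical_waveE => //.
- by move=> x; exact: yE.
- exact: conj_homog.
- by move=> x sx; rewrite (yE j m x sx) meval_conj_real.
Qed.
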